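(* Let $f$ be a minimal Lagrangian immersion into $\mathbb{C}P^2$, translationally equivariant in the $x$-direction ($z=x+iy$), with induced metric $2e^{u}dz\,d\bar z$, $u=u(y)$, and constant cubic Hopf differential $\psi\,dz^3$. Assume that $\psi\ne 0$, that $u$ is not constant, that $u'(0)=0$, and that $e^{u(0)}$ is the largest root of $8w^3-4\beta w^2+4|\psi|^2=0$, where $\beta$ is the constant $$\beta=2e^{u}+|\psi|^2e^{-2u}+\tfrac14(u')^2 .$$ Then $$e^{u(y)}=\frac{\beta}{6}-\frac{\wp(y-\omega';g_2,g_3)}{2},\qquad g_2=\tfrac43\beta^2,\quad g_3=16|\psi|^2-\tfrac{8}{27}\beta^3 ,$$ and $\psi=-ia^2b$, where $a,b$ are the constants occurring in the generating matrix $D(\lambda)$ of $f$.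
   Context: $f$ is defined on an open strip $\mathbb{S}\ni 0$ parallel to the real axis and there is a one-parameter subgroup $R(t)$ of $SU(3)$ with $f(z+t)=R(t)f(z)$. The cubic Hopf differential is $\psi\,dz^3$, $\psi=F_{zz}\cdot\overline{F_{\bar z}}$ for a local horizontal lift $F$ to $S^5(1)\subset\mathbb{C}^3$, where $v\cdot\overline{w}=\sum_k v_k\overline{w_k}$. For a translationally equivariant immersion $u$ depends only on $y$, $\psi$ is constant, $'=d/dy$, and $\beta$ above is indeed constant. Extended frame: $\mathbb{F}(z,\lambda)\in SU(3)$, $\lambda\in S^1$, with $\mathbb{F}(0,\lambda)=I$, $f=[\mathbb{F}(\cdot,1)e_3]$ up to isometry, and $$\mathbb{F}^{-1}\mathbb{F}_z=\begin{pmatrix}\frac{u_z}{2}&0&i\lambda^{-1}e^{u/2}\\-i\lambda^{-1}\psi e^{-u}&-\frac{u_z}{2}&0\\0&i\lambda^{-1}e^{u/2}&0\end{pmatrix},\qquad \mathbb{F}^{-1}\mathbb{F}_{\bar z}=\begin{pmatrix}-\frac{u_{\bar z}}{2}&-i\lambda\bar\psi e^{-u}&0\\0&\frac{u_{\bar z}}{2}&i\lambda e^{u/2}\\i\lambda e^{u/2}&0&0\end{pmatrix}.$$ The generating matrix is the $D(\lambda)$ with $\mathbb{F}(t+z,\lambda)=e^{tD(\lambda)}\mathbb{F}(z,\lambda)$ for $t\in\mathbb{R}$, written as $$D=\begin{pmatrix}\alpha&-\lambda\bar b&\lambda^{-1}a\\ \lambda^{-1}b&-\alpha&-\lambda\bar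 a\\-\lambda\bar a&\lambda^{-1}a&0\end{pmatrix}$$ with constants $\alpha,a,b$. $\wp(\cdot;g_2,g_3)$ is the Weierstrass elliptic function with $(\wp')^2=4\wp^3-g_2\wp-g_3$. Here $4t^3-g_2t-g_3$ has three distinct real roots $e_1>e_2>e_3$; $\omega>0$ and $\omega'\in i\mathbb{R}_{>0}$ are the half-periods $\omega=\int_{e_1}^\infty\frac{dt}{\sqrt{4t^3-g_2t-g_3}}$, $\omega'=i\int_{-\infty}^{e_3}\frac{dt}{\sqrt{|4t^3-g_2t-g_3|}}$, so $\wp(\omega)=e_1$, $\wp(\omega')=e_3$. *)

(* Defs.v *)
From HB Require Import structures.
From mathcomp Require Import all_boot all_order all_algebra.
From mathcomp Require Import all_classical all_reals all_analysis.
From mathcomp Require Import complex.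

Set Implicit Arguments.
Unset Strict Implicit.
Unset Printing Implicit Defensive.

Import Order.TTheory GRing.Theory Num.Theory.
Import numFieldNormedType.Exports.

Local Open Scope classical_set_scope.
Local Open Scope ring_scope.

(* R[i] carries no topology of its own; cast to numClosedFieldType it inherits
   the norm topology of every numFieldType. *)
Definition Cplx (R : realType) : numClosedFieldType := R[i]%C.

Definition toC (R : realType) (x : R) : Cplx R := (x%:C)%C.

(* The norm `|z| is itself an element of Cplx R; this is its real value. *)
Definition modulus (R : realType) (z : Cplx R) : R := Normc.normc z.

(* Derivative at z in direction v along real increments; the library's
   'D_v would use complex increments for functions on Cplx R. *)
Definition rquot (R : realType) (V : normedModType (Cplx R)) (v : Cplx R)
    (g : Cplx R -> V) (z : Cplx R) : R -> V :=
  fun t => (toC t)^-1 *: (g (z + toC t * v) - g z).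

Definition rderivable (R : realType) (V : normedModType (Cplx R)) (v : Cplx R)
    (g : Cplx R -> V) (z : Cplx R) : Prop :=
  cvg (rquot v g z t @[t --> 0^']).

Definition rderive (R : realType) (V : normedModType (Cplx R)) (v : Cplx R)
    (g : Cplx R -> V) (z : Cplx R) : V :=
  lim (rquot v g z t @[t --> 0^']).

Definition dx (R : realType) (V : normedModType (Cplx R)) (g : Cplx R -> V) :=
  rderive 1 g.

Definition dy (R : realType) (V : normedModType (Cplx R)) (g : Cplx R -> V) :=
  rderive 'i g.

Definition dz (R : realType) (V : normedModType (Cplx R)) (g : Cplx R -> V)
    (z : Cplx R) : V := 2^-1 *: (dx g z - 'i *: dy g z).

Definition dzbar (R : realType) (V : normedModType (Cplx R)) (g : Cplx R -> V)
    (z : Cplx R) : V := 2^-1 *: (dx g z + 'i *: dy g z).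

Fixpoint classCn (R : realType) (V : normedModType (Cplx R)) (n : nat)
    (U : set (Cplx R)) (g : Cplx R -> V) : Prop :=
  (forall z, U z -> {for z, continuous g}) /\
  (if n is m.+1 then
     [/\ forall z, U z -> rderivable 1 g z /\ rderivable 'i g z,
         classCn m U (dx g) & classCn m U (dy g)]
   else True).

Definition smooth_on (R : realType) (V : normedModType (Cplx R))
    (U : set (Cplx R)) (g : Cplx R -> V) : Prop :=
  forall n, classCn n U g.

Definition strip (R : realType) (lo hi : \bar R) : set (Cplx R) :=
  [set z : Cplx R | (lo < (complex.Im z)%:E)%E /\ ((complex.Im z)%:E < hi)%E].

Definition hdot (R : realType) (v w : 'cV[Cplx R]_3) : Cplx R :=
  \sum_(k < 3) v k 0 * (w k 0)^*.

Definition SU3 (R : realType) (M : 'M[Cplx R]_3) : Prop :=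
  M \is unitarymx /\ \det M = 1.

Definition cline (R : realType) (v : 'cV[Cplx R]_3) : set 'cV[Cplx R]_3 :=
  [set w | exists c : Cplx R, w = c *: v].

Record CP2 (R : realType) := MkCP2 {
  cp_line :> set 'cV[Cplx R]_3;
  _ : exists2 v : 'cV[Cplx R]_3, v != 0 & cp_line = cline v
}.

Definition local_lift (R : realType) (S : set (Cplx R)) (f : Cplx R -> CP2 R)
    (U : set (Cplx R)) (F : Cplx R -> 'cV[Cplx R]_3) : Prop :=
  [/\ open U, U `<=` S, smooth_on U F &
      forall z, U z -> hdot (F z) (F z) = 1 /\ cp_line (f z) = cline (F z)].

Definition smooth_map (R : realType) (S : set (Cplx R)) (f : Cplx R -> CP2 R)
    : Prop :=
  forall z0, S z0 -> exists U F, U z0 /\ local_lift S f U F.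

(* Horizontal part, at F z, of a vector tangent to the unit sphere S^5: its
   component orthogonal to the fibre direction i F z of the Hopf fibration. *)
Definition hor (R : realType) (F : Cplx R -> 'cV[Cplx R]_3) (z : Cplx R)
    (X : 'cV[Cplx R]_3) : 'cV[Cplx R]_3 :=
  X - hdot X (F z) *: F z.

(* Horizontal representative at F z of df(v). The Fubini-Study metric for
   which S^5(1) -> CP^2 is a Riemannian submersion is Re hdot on horizontal
   vectors, and its Kaehler form is Im hdot up to sign. *)
Definition tang (R : realType) (F : Cplx R -> 'cV[Cplx R]_3) (v z : Cplx R)
    : 'cV[Cplx R]_3 := hor F z (rderive v F z).

Definition fs_metric (R : realType) (X Y : 'cV[Cplx R]_3) : R :=
  complex.Re (hdot X Y).

Definition kahler (R : realType) (X Y : 'cV[Cplx R]_3) : R :=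
  complex.Im (hdot X Y).

(* Horizontal representative of the Levi-Civita derivative of CP^2, in
   direction v, of the vector field along f represented by Y along F. The term
   hdot (F_v) (F z) Y removes the rotation of the phase of F, so that F need
   not be a horizontal lift; when F is horizontal, this is hor (Y_v). *)
Definition cov_deriv (R : realType) (F : Cplx R -> 'cV[Cplx R]_3)
    (v : Cplx R) (Y : Cplx R -> 'cV[Cplx R]_3) (z : Cplx R)
    : 'cV[Cplx R]_3 :=
  hor F z (rderive v Y z - hdot (rderive v F z) (F z) *: Y z).

Definition immersion (R : realType) (S : set (Cplx R)) (f : Cplx R -> CP2 R)
    : Prop :=
  forall U F, local_lift S f U F -> forall z, U z ->
  forall s t : R, toC s *: tang F 1 z + toC t *: tang F 'i z = 0 ->
  s = 0 /\ t = 0.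

Definition lagrangian (R : realType) (S : set (Cplx R)) (f : Cplx R -> CP2 R)
    : Prop :=
  forall U F, local_lift S f U F -> forall z, U z ->
  kahler (tang F 1 z) (tang F 'i z) = 0.

(* Vanishing of the mean curvature vector
   (g22 II(x,x) - 2 g12 II(x,y) + g11 II(y,y)) / (2 (g11 g22 - g12^2)),
   where II is the component of the covariant derivative normal to the surface:
   the same combination of covariant derivatives is tangent to it. *)
Definition minimal (R : realType) (S : set (Cplx R)) (f : Cplx R -> CP2 R)
    : Prop :=
  forall U F, local_lift S f U F -> forall z, U z ->
  let g11 := fs_metric (tang F 1 z) (tang F 1 z) in
  let g12 := fs_metric (tang F 1 z) (tang F 'i z) in
  let g22 := fs_metric (tang F 'i z) (tang F 'i z) in
  exists s t : R,
    toC g22 *: cov_deriv F 1 (tang F 1) z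
    - toC (2 * g12) *: cov_deriv F 1 (tang F 'i) z
    + toC g11 *: cov_deriv F 'i (tang F 'i) z
    = toC s *: tang F 1 z + toC t *: tang F 'i z.

Definition minimal_lagrangian_immersion (R : realType) (S : set (Cplx R))
    (f : Cplx R -> CP2 R) : Prop :=
  [/\ smooth_map S f, immersion S f, lagrangian S f & minimal S f].

(* The metric 2 e^u dz dzbar = 2 e^u (dx^2 + dy^2), with u = u(y). *)
Definition induced_metric (R : realType) (S : set (Cplx R))
    (f : Cplx R -> CP2 R) (u : R -> R) : Prop :=
  forall U F, local_lift S f U F -> forall z, U z ->
  [/\ fs_metric (tang F 1 z) (tang F 1 z) = 2 * expR (u (complex.Im z)),
      fs_metric (tang F 'i z) (tang F 'i z) = 2 * expR (u (complex.Im z)) &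
      fs_metric (tang F 1 z) (tang F 'i z) = 0].

Definition horizontal (R : realType) (U : set (Cplx R))
    (F : Cplx R -> 'cV[Cplx R]_3) : Prop :=
  forall z, U z -> hdot (dx F z) (F z) = 0 /\ hdot (dy F z) (F z) = 0.

(* Two horizontal lifts near a point differ by a constant phase, hence give
   the same F_zz . conj(F_zbar). *)
Definition hopf_differential (R : realType) (S : set (Cplx R))
    (f : Cplx R -> CP2 R) (psi : Cplx R) : Prop :=
  forall z0, S z0 -> exists U F,
  [/\ U z0, local_lift S f U F, horizontal U F &
      forall z, U z -> hdot (dz (dz F) z) (dzbar F z) = psi].

Definition one_parameter_subgroup (R : realType) (rho : R -> 'M[Cplx R]_3)
    : Prop :=
  [/\ continuous rho, forall t, SU3 (rho t) &
      forall s t, rho (s + t) = rho s *m rho t].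

Definition translationally_equivariant (R : realType) (S : set (Cplx R))
    (f : Cplx R -> CP2 R) : Prop :=
  exists2 rho : R -> 'M[Cplx R]_3, one_parameter_subgroup rho &
  forall z t, S z -> cp_line (f (z + toC t)) = [set rho t *m v | v in f z].

Definition mx3 (R : realType) (a00 a01 a02 a10 a11 a12 a20 a21 a22 : Cplx R)
    : 'M[Cplx R]_3 :=
  \matrix_(i < 3, j < 3)
    nth 0 (nth [::] [:: [:: a00; a01; a02]; [:: a10; a11; a12];
                        [:: a20; a21; a22]] i) j.

Definition frame_z (R : realType) (u : R -> R) (psi lam z : Cplx R)
    : 'M[Cplx R]_3 :=
  let y := complex.Im z in
  let uz := dz (fun w : Cplx R => toC (u (complex.Im w)) : (Cplx R)^o) z in
  let eh := toC (expR (u y / 2)) in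
  let em := toC (expR (- u y)) in
  mx3 (uz / 2) 0 ('i * lam^-1 * eh)
      (- 'i * lam^-1 * psi * em) (- (uz / 2)) 0
      0 ('i * lam^-1 * eh) 0.

Definition frame_zbar (R : realType) (u : R -> R) (psi lam z : Cplx R)
    : 'M[Cplx R]_3 :=
  let y := complex.Im z in
  let uzb := dzbar (fun w : Cplx R => toC (u (complex.Im w)) : (Cplx R)^o) z in
  let eh := toC (expR (u y / 2)) in
  let em := toC (expR (- u y)) in
  mx3 (- (uzb / 2)) (- 'i * lam * psi^* * em) 0
      0 (uzb / 2) ('i * lam * eh)
      ('i * lam * eh) 0 0.

(* FF z lam is determined by u and psi through these equations. The surface
   [FF(., lam) e3] has metric 2 e^u dz dzbar and, with the sign and phase
   conventions of hopf_differential, Hopf differential -i lam^-3 psi; so the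
   surface with data (u, psi) is the member lam = i of the family, and no
   relation with the member lam = 1 is imposed here. *)
Definition extended_frame (R : realType) (S : set (Cplx R)) (u : R -> R)
    (psi : Cplx R) (FF : Cplx R -> Cplx R -> 'M[Cplx R]_3) : Prop :=
  forall lam : Cplx R, `|lam| = 1 ->
  FF 0 lam = 1%:M /\
  forall z, S z ->
  [/\ SU3 (FF z lam),
      rderivable 1 (FF^~ lam) z /\ rderivable 'i (FF^~ lam) z,
      invmx (FF z lam) *m dz (FF^~ lam) z = frame_z u psi lam z &
      invmx (FF z lam) *m dzbar (FF^~ lam) z = frame_zbar u psi lam z].

Definition expmx (R : realType) (A : 'M[Cplx R]_3) : 'M[Cplx R]_3 :=
  lim (series (fun k : nat => (k`!%:R : Cplx R)^-1 *: A ^+ k) @ \oo).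

Definition generating_matrix (R : realType) (S : set (Cplx R))
    (FF : Cplx R -> Cplx R -> 'M[Cplx R]_3) (D : Cplx R -> 'M[Cplx R]_3)
    : Prop :=
  forall lam : Cplx R, `|lam| = 1 -> forall (t : R) z, S z ->
  FF (toC t + z) lam = expmx (toC t *: D lam) *m FF z lam.

Definition gen_form (R : realType) (alpha a b lam : Cplx R) : 'M[Cplx R]_3 :=
  mx3 alpha (- lam * b^*) (lam^-1 * a)
      (lam^-1 * b) (- alpha) (- lam * a^*)
      (- lam * a^*) (lam^-1 * a) 0.

Definition beta_at (R : realType) (u : R -> R) (psi : Cplx R) (y : R) : R :=
  2 * expR (u y) + modulus psi ^+ 2 * expR (- (2 * u y))
  + 4^-1 * (derive1 u y) ^+ 2.

Definition lattice_pt (R : realType) (w1 w2 : Cplx R) (m n : int) : Cplx R :=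
  m%:~R * w1 + n%:~R * w2.

(* Partial sums of
   1/z^2 + sum over the nonzero lattice points l of (1/(z-l)^2 - 1/l^2)
   over the squares |m|, |n| <= N; the series converges absolutely. *)
Definition wp_partial (R : realType) (w1 w2 z : Cplx R) (N : nat) : Cplx R :=
  z ^- 2 + \sum_(j < N.*2.+1) \sum_(k < N.*2.+1 | (j != N :> nat) || (k != N :> nat))
    (let l := lattice_pt w1 w2 (j%:Z - N%:Z) (k%:Z - N%:Z) in
     (z - l) ^- 2 - l ^- 2).

(* P is the Weierstrass elliptic function wp(.; g2, g3): the wp-function of a
   lattice Z w1 + Z w2 that satisfies the differential equation with
   coefficients g2 and g3. The values of P at its poles are irrelevant. *)
Definition weierstrass_p (R : realType) (g2 g3 : Cplx R)
    (P : Cplx R -> Cplx R) : Prop :=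
  exists w1 w2 : Cplx R, complex.Im (w2 / w1) != 0 /\
  forall z, (forall m n : int, z != lattice_pt w1 w2 m n) ->
  [/\ wp_partial w1 w2 z @ \oo --> P z,
      derivable (P : Cplx R -> (Cplx R)^o) z 1 &
      (derive1 (P : Cplx R -> (Cplx R)^o) z) ^+ 2
        = 4 * P z ^+ 3 - g2 * P z - g3].

Definition wcubic (R : realType) (g2 g3 t : R) : R :=
  4 * t ^+ 3 - g2 * t - g3.

Definition omega' (R : realType) (g2 g3 e3 : R) : Cplx R :=
  'i * toC (\int[lebesgue_measure]_(t in `]-oo, e3[)
              (Num.sqrt `|wcubic g2 g3 t|)^-1).

(* Main.v *)
(* For a horizontal lift F the vectors F, F_z, F_zbar are an orthogonal frame,
   and minimality gives F_{z zbar} = - e^u F. Differentiating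
   <F_zz, F_z> = (e^u)_z yields, for W = e^u, the Gauss equation
   W W_yy = - 4 W^3 + (W_y)^2 + 4 |psi|^2, of which beta is a first integral.
   Hence q = beta/3 - 2 W solves q_yy = 6 q^2 - g2/2 with q(0) = e3 and
   q_y(0) = 0.

   About wp only the lattice sum and the first order equation are given. Along
   s |-> - i s it agrees with its complex conjugate, since both have the same
   singularity at 0; so it is real there, and it increases from -oo until its
   derivative first vanishes, at the value e3. The elapsed parameter is the
   integral defining omega. The second order equation, which the first order one
   yields where the derivative of wp is nonzero, extends across the isolated
   zeros; on the horizontal line through omega, wp and q then solve the same
   Cauchy problem. Finally psi = - i a^2 b is read off at t = 0 from
   D = d/dt FF(t). *)
Require Import Defs.
From HB Require Import structures.
From mathcomp Require Import all_boot all_order all_algebra.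
From mathcomp Require Import all_classical all_reals all_analysis.
From mathcomp Require Import complex measurable_realfun zify ring lra.

Set Implicit Arguments.
Unset Strict Implicit.
Unset Printing Implicit Defensive.

Import Order.TTheory GRing.Theory Num.Theory.
Import numFieldNormedType.Exports.

Local Open Scope classical_set_scope.
Local Open Scope ring_scope.

(** * Complex numbers by components *)

(** The first order equation alone cannot carry the argument: at the value [e3] it also admits the
    constant solution, so it is the second order equation that is continued along lines. The set
    where it holds is open and closed in the complement of the lattice: where wp' vanishes, wp is a
    root of the cubic, and since the roots are simple wp'' is nonzero there, so such a zero of wp'
    is isolated. This is where the nonconstancy of [u] enters: a double root would make the profile
    an equilibrium.

    Neither is the lattice assumed invariant under conjugation, nor are [w1], [w2] related to the
    roots; hence the reality of wp on the imaginary axis and the position of the half period both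
    have to be drawn from differential equations. Complex function theory is replaced by quadratic
    remainder bounds summed over the lattice. Poles are avoided by boundedness: on the descent wp
    increases and stays below [e3], on the horizontal line it coincides with a continuous
    function. *)

Section Components.
Variable R : realType.
Implicit Types (x y : R) (z w : Cplx R).

Lemma cplxP z w : complex.Re z = complex.Re w -> complex.Im z = complex.Im w ->
  z = w.
Proof. by case: z w => [a b] [c d] /= -> ->. Qed.

Lemma cReD z w : complex.Re (z + w) = complex.Re z + complex.Re w.
Proof. by case: z w => [a b] [c d]. Qed.
Lemma cImD z w : complex.Im (z + w) = complex.Im z + complex.Im w.
Proof. by case: z w => [a b] [c d]. Qed.
Lemma cReN z : complex.Re (- z) = - complex.Re z.
Proof. by case: z. Qed.
Lemma cImN z : complex.Im (- z) = - complex.Im z.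
Proof. by case: z. Qed.
Lemma cReM z w : complex.Re (z * w) =
  complex.Re z * complex.Re w - complex.Im z * complex.Im w.
Proof. by case: z w => [a b] [c d]. Qed.
Lemma cImM z w : complex.Im (z * w) =
  complex.Re z * complex.Im w + complex.Im z * complex.Re w.
Proof. by case: z w => [a b] [c d]. Qed.
Lemma cReC x : complex.Re (toC x) = x. Proof. by []. Qed.
Lemma cImC x : complex.Im (toC x) = 0. Proof. by []. Qed.
Lemma Cplx_iE : ('i : Cplx R) = ('i%C : R[i]).
Proof. by rewrite complexiE. Qed.
Lemma cRei : complex.Re ('i : Cplx R) = 0. Proof. by rewrite Cplx_iE. Qed.
Lemma cImi : complex.Im ('i : Cplx R) = 1. Proof. by rewrite Cplx_iE. Qed.
Lemma cReJ z : complex.Re z^* = complex.Re z. Proof. by case: z. Qed.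
Lemma cImJ z : complex.Im z^* = - complex.Im z. Proof. by case: z. Qed.
Lemma cRe0 : complex.Re (0 : Cplx R) = 0. Proof. by []. Qed.
Lemma cIm0 : complex.Im (0 : Cplx R) = 0. Proof. by []. Qed.
Lemma cRe1 : complex.Re (1 : Cplx R) = 1. Proof. by []. Qed.
Lemma cIm1 : complex.Im (1 : Cplx R) = 0. Proof. by []. Qed.

Definition compE := (cReD, cImD, cReN, cImN, cReM, cImM, cReC, cImC, cRei, cImi, cReJ, cImJ,
  cRe0, cIm0, cRe1, cIm1).

Lemma toCD x y : toC (x + y) = toC x + toC y.
Proof. by apply: cplxP; rewrite !compE ?addr0. Qed.
Lemma toCN x : toC (- x) = - toC x.
Proof. by apply: cplxP; rewrite !compE ?oppr0. Qed.
Lemma toCB x y : toC (x - y) = toC x - toC y.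
Proof. by rewrite toCD toCN. Qed.
Lemma toCM x y : toC (x * y) = toC x * toC y.
Proof. by apply: cplxP; rewrite !compE; ring. Qed.
Lemma toC0 : toC (0 : R) = 0. Proof. by []. Qed.
Lemma toCX x n : toC (x ^+ n) = toC x ^+ n.
Proof. by elim: n => [//|n IH]; rewrite !exprS toCM IH. Qed.
Lemma toCV x : toC x^-1 = (toC x)^-1.
Proof. exact: (fmorphV (real_complex R : {rmorphism R -> R[i]})). Qed.
Lemma toC_nat n : toC (n%:R : R) = n%:R.
Proof. exact: (rmorph_nat (real_complex R : {rmorphism R -> R[i]})). Qed.
Lemma toCI : injective (@toC R). Proof. by move=> x y []. Qed.
Lemma conjC_toC x : (toC x)^* = toC x.
Proof. by apply: cplxP; rewrite !compE ?oppr0. Qed.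

Lemma mod_norm z : `|z| = toC (modulus z). Proof. by case: z. Qed.
Lemma mod_ge0 z : 0 <= modulus z.
Proof. by case: z => a b; exact: sqrtr_ge0. Qed.
Lemma mod0 : modulus (0 : Cplx R) = 0. Proof. exact: Normc.normc0. Qed.
Lemma mod1 : modulus (1 : Cplx R) = 1. Proof. exact: Normc.normc1. Qed.
Lemma mod_eq0 z : modulus z = 0 -> z = 0. Proof. exact: Normc.eq0_normc. Qed.
Lemma modM z w : modulus (z * w) = modulus z * modulus w.
Proof. exact: Normc.normcM. Qed.
Lemma modV z : modulus z^-1 = (modulus z)^-1.
Proof. exact: Normc.normcV. Qed.
Lemma modD z w : modulus (z + w) <= modulus z + modulus w.
Proof. exact: le_normcD. Qed.
Lemma modN z : modulus (- z) = modulus z. Proof. exact: normcN. Qed.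
Lemma modB z w : modulus (z - w) <= modulus z + modulus w.
Proof. by rewrite -(modN w) modD. Qed.
Lemma modBC z w : modulus (z - w) = modulus (w - z).
Proof. by rewrite -modN opprB. Qed.
Lemma modX z n : modulus (z ^+ n) = modulus z ^+ n.
Proof. by elim: n => [|n IH]; rewrite ?mod1 // !exprS modM IH. Qed.
Lemma sqr_mod z : modulus z ^+ 2 = complex.Re z ^+ 2 + complex.Im z ^+ 2.
Proof. by case: z => a b; rewrite sqr_sqrtr // addr_ge0 // sqr_ge0. Qed.
Lemma mod_toC x : modulus (toC x) = `|x|.
Proof. by rewrite /modulus /= expr0n addr0 sqrtr_sqr. Qed.
Lemma modJ z : modulus z^* = modulus z.
Proof. by case: z => a b; rewrite /modulus /= sqrrN. Qed.
Lemma modi : modulus ('i : Cplx R) = 1.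
Proof. by rewrite Cplx_iE /modulus /= expr0n expr1n add0r sqrtr1. Qed.
Lemma ler_Re_mod z : `|complex.Re z| <= modulus z.
Proof.
rewrite -sqrtr_sqr; case: z => a b /=.
by apply: ler_wsqrtr; rewrite lerDl sqr_ge0.
Qed.
Lemma ler_Im_mod z : `|complex.Im z| <= modulus z.
Proof.
rewrite -sqrtr_sqr; case: z => a b /=.
by apply: ler_wsqrtr; rewrite lerDr sqr_ge0.
Qed.
Lemma cplx_split z : z = toC (complex.Re z) + 'i * toC (complex.Im z).
Proof. by apply: cplxP; rewrite !compE; ring. Qed.
Lemma mod_le_ReIm z : modulus z <= `|complex.Re z| + `|complex.Im z|.
Proof.
rewrite {1}(cplx_split z) (le_trans (modD _ _)) //.
by rewrite modM modi mul1r !mod_toC.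
Qed.
Lemma mod_gt0 z : z != 0 -> 0 < modulus z.
Proof.
by move=> z0; rewrite lt_def mod_ge0 andbT; apply: contra_neq z0 => /mod_eq0.
Qed.
Lemma modB_ge z w : modulus z - modulus w <= modulus (z - w).
Proof. by rewrite lerBlDr -{1}(subrK w z) modD. Qed.
Lemma mulJ z : z * z^* = toC (modulus z ^+ 2).
Proof. by rewrite sqr_mod; apply: cplxP; rewrite !compE; ring. Qed.
Lemma modMn z n : modulus (z *+ n) = modulus z *+ n.
Proof. exact: normcMn. Qed.
Lemma mod_nat n : modulus (n%:R : Cplx R) = n%:R.
Proof. by rewrite modMn mod1. Qed.

End Components.

(** * Real derivatives and a Gronwall estimate *)

Section RealDerivative.
Variable R : realType.
Implicit Types (f g : R -> R) (s l : R).

(** The quotient is multiplied out, so that [h = 0] needs no exception and remainder estimates apply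
    as they stand. *)
Lemma is_deriveP f s l : is_derive s 1 f l <->
  forall e, 0 < e -> exists2 d, 0 < d &
    forall h, `|h| < d -> `|f (s + h) - f s - h * l| <= e * `|h|.
Proof.
split.
  move=> [df dl] e e0.
  have : h^-1 *: ((f \o shift s) (h *: (1:R)) - f s) @[h --> 0^'] --> l.
    by rewrite -dl; exact: df.
  move/cvgrPdist_lt => /(_ e e0).
  rewrite near_withinE => /nbhs_ballP[d /= d0 dP].
  exists d => // h hd; have [->|h0] := eqVneq h 0.
    by rewrite addr0 subrr mul0r subrr normr0 mulr0.
  have := dP h; rewrite /ball /= sub0r normrN => /(_ hd h0).
  rewrite /= scaler1 [s + h]addrC => H.
  have hp : 0 < `|h| by rewrite normr_gt0.
  rewrite -ler_pdivrMr // -normfV -normrM (le_trans _ (ltW H)) //.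
  rewrite distrC le_eqVlt; apply/orP; left; apply/eqP; congr (`|_|).
  by rewrite /GRing.scale /=; field.
move=> H.
have cv : h^-1 *: ((f \o shift s) (h *: (1:R)) - f s) @[h --> 0^'] --> l.
  apply/cvgrPdist_le => e e0; have [d d0 dP] := H e e0.
  rewrite near_withinE; apply/nbhs_ballP; exists d => //= h.
  rewrite /ball /= sub0r normrN => hd h0.
  have hp : 0 < `|h| by rewrite normr_gt0.
  rewrite -(ler_pM2r hp) (le_trans _ (dP h hd)) // -normrM.
  rewrite distrC /= scaler1 [s + h]addrC le_eqVlt; apply/orP; left.
  by apply/eqP; congr (`|_|); rewrite /GRing.scale /=; field.
by apply: DeriveDef; [apply/cvg_ex; exists l|exact: cvg_lim].
Qed.

Lemma is_derive_unique f s l l' : is_derive s 1 f l -> is_derive s 1 f l' ->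
  l = l'.
Proof. by move=> [_ <-] [_ <-]. Qed.

Lemma is_derive_near f g s l d : 0 < d ->
  (forall t, `|t - s| < d -> f t = g t) -> is_derive s 1 f l ->
  is_derive s 1 g l.
Proof.
move=> d0 fg; apply: near_eq_is_derive.
apply/nbhs_ballP; exists d => //= t; rewrite /ball /= distrC.
exact: fg.
Qed.

Lemma is_derive_mul f g s l m : is_derive s 1 f l -> is_derive s 1 g m ->
  is_derive s 1 (fun t => f t * g t) (f s * m + g s * l).
Proof. exact: is_deriveM. Qed.

Lemma is_derive_add f g s l m : is_derive s 1 f l -> is_derive s 1 g m ->
  is_derive s 1 (fun t => f t + g t) (l + m).
Proof. exact: is_deriveD. Qed.

Lemma is_derive_pow f n s l : is_derive s 1 f l ->
  is_derive s 1 (fun t => f t ^+ n.+1) (n.+1%:R * f s ^+ n * l).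
Proof.
move=> H; rewrite (_ : (fun t => _) = f ^+ n.+1); last first.
  by apply/funext => t; rewrite exprfctE.
exact: is_deriveX.
Qed.

Lemma is_derive_cont f s l : is_derive s 1 f l -> {for s, continuous f}.
Proof. by move=> [df _]; apply/differentiable_continuous/derivable1_diffP. Qed.

Lemma is_derive_within f (f' : R -> R) (A : set R) :
  (forall s, A s -> is_derive s 1 f (f' s)) -> {within A, continuous f}.
Proof.
move=> H; apply: continuous_in_subspaceT => s /set_mem /H.
exact: is_derive_cont.
Qed.

Lemma mean_value f (f' : R -> R) a b : a < b ->
  (forall s, a <= s <= b -> is_derive s 1 f (f' s)) ->
  exists2 c, a < c < b & f b - f a = f' c * (b - a).
Proof.
move=> ab H; have [||c] := @MVT R f f' a b ab.
- by move=> x; rewrite in_itv /= => /andP[ax xb]; apply: H; rewrite !ltW.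
- by apply: is_derive_within => s /=; rewrite in_itv /=; exact: H.
- by rewrite in_itv /= => ? ?; exists c.
Qed.

Lemma continuous_eps f s : {for s, continuous f} <->
  forall e, 0 < e -> exists2 d, 0 < d &
    forall t, `|t - s| < d -> `|f t - f s| < e.
Proof.
split=> [/cvgrPdist_lt H e e0|H].
  have /nbhs_ballP[d /= d0 dP] := H e e0; exists d => // t td.
  by rewrite distrC; apply: dP; rewrite /ball /= distrC.
apply/cvgrPdist_lt => e e0; have [d d0 dP] := H e e0.
apply/nbhs_ballP; exists d => //= t.
by rewrite /ball /= distrC => td; rewrite distrC; exact: dP.
Qed.

(** The product of [f] with [expR (- K * s)] does not increase, and [f] tends to 0 at [a]. Nothing
    is asked of [f] at [a] itself, so the lemma also starts at a singular endpoint such as the pole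
    of wp. *)
Lemma gronwall_vanish f (f' : R -> R) a b K : a < b ->
  (forall s, a < s < b -> is_derive s 1 f (f' s)) ->
  (forall s, a < s < b -> 0 <= f s /\ f' s <= K * f s) ->
  (forall e, 0 < e -> exists2 d, 0 < d &
     forall s, a < s < b -> s < a + d -> f s <= e) ->
  forall s, a < s < b -> f s = 0.
Proof.
move=> ab df fK f0 s /andP[sa sb].
have fs0 : 0 <= f s by apply: (fK s _).1; rewrite sa.
apply/eqP; rewrite eq_le fs0 andbT; apply/ler_addgt0Pr => e e0; rewrite add0r.
(* [M] bounds the growth of [f] from [t] to [s], whatever the sign of [K]; the point [t] below is so
   close to [a] that [f t <= e / M]. *)
pose M := expR (`|K| * (s - a)).
have M0 : 0 < M by exact: expR_gt0.
have [d d0 dP] := f0 (e / M) (divr_gt0 e0 M0).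
pose t := a + Num.min d (s - a) / 2.
have md : 0 < Num.min d (s - a) by rewrite lt_min d0 subr_gt0.
have at_ : a < t by rewrite ltrDl divr_gt0.
have tsd : t <= a + (s - a) / 2 /\ t <= a + d / 2.
  by rewrite !lerD2l !ler_pM2r // !ge_min lexx orbT lexx.
have ts : t < s by case: tsd; lra.
have td : t < a + d by case: tsd; lra.
have ft : f t <= e / M by apply: dP => //; rewrite at_ (lt_trans ts sb).
pose g x := f x * expR (- K * x).
have dg x : t <= x <= s ->
  is_derive x 1 g (f x * (expR (- K * x) * - K) + expR (- K * x) * f' x).
  move=> /andP[tx xs].
  have dfx : is_derive x 1 f (f' x).
    by apply: df; rewrite (lt_le_trans at_ tx) (le_lt_trans xs sb).
  apply: is_deriveM.
  have : is_derive x 1 (expR \o (fun x => - K * x)) (expR (- K * x) * - K).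
    apply: is_derive1_comp.
    have := is_deriveZ (- K) (is_derive_id x (1:R)).
    by rewrite /GRing.scale /= mulr1.
  exact.
have [c /andP[tc cs]] := mean_value ts dg.
have := fK c; rewrite (lt_trans at_ tc) (lt_trans cs sb) => /(_ isT)[fc0 f'c].
have E0 : 0 < expR (- K * c) by exact: expR_gt0.
have le : (f c * (expR (- K * c) * - K) + expR (- K * c) * f' c) * (s - t) <= 0.
  apply: mulr_le0_ge0; last by rewrite subr_ge0 ltW.
  have -> : f c * (expR (- K * c) * - K) + expR (- K * c) * f' c =
    expR (- K * c) * (f' c - K * f c) by ring.
  by rewrite pmulr_rle0 // subr_le0.
move=> gE; move: le; rewrite -gE subr_le0 /g => gst.
have Es : 0 < expR (- K * s) by exact: expR_gt0.
have -> : f s = f s * expR (- K * s) * expR (K * s).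
  by rewrite -mulrA -expRD mulNr addNr expR0 mulr1.
apply: (@le_trans _ _ (f t * expR (- K * t) * expR (K * s))).
  by rewrite ler_pM2r ?expR_gt0.
rewrite -mulrA -expRD -ler_pdivlMr ?expR_gt0 //.
have ft0 : 0 <= f t by apply: (fK t _).1; rewrite at_ (lt_trans ts sb).
apply: (le_trans ft); rewrite ler_pM2l // lef_pV2 ?posrE ?expR_gt0 //.
rewrite ler_expR mulNr addrC -mulrBr.
apply: (@le_trans _ _ (`|K| * (s - t))).
  by rewrite ler_wpM2r ?ler_norm // subr_ge0 ltW.
by rewrite ler_wpM2l // lerD2l lerN2 ltW.
Qed.

End RealDerivative.

(** Taken by components over [R]: [Cplx R] is a normed module over itself, and its own derivative
    would involve complex increments. *)
Definition cder (R : realType) (p : R -> Cplx R) (s : R) (l : Cplx R) :=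
  is_derive s 1 (fun t => complex.Re (p t)) (complex.Re l) /\
  is_derive s 1 (fun t => complex.Im (p t)) (complex.Im l).

Section CurveDerivative.
Variable R : realType.
Implicit Types (p q : R -> Cplx R) (f : R -> R) (s : R) (l m : Cplx R).

Lemma cderP p s l : cder p s l <->
  forall e, 0 < e -> exists2 d, 0 < d &
    forall h, `|h| < d -> modulus (p (s + h) - p s - toC h * l) <= e * `|h|.
Proof.
split=> [[/is_deriveP Hr /is_deriveP Hi] e e0|H].
  have e2 : 0 < e / 2 by rewrite divr_gt0.
  have [d1 d10 H1] := Hr _ e2; have [d2 d20 H2] := Hi _ e2.
  exists (Num.min d1 d2); first by rewrite lt_min d10.
  move=> h; rewrite lt_min => /andP[/H1 h1 /H2 h2].
  apply: (le_trans (mod_le_ReIm _)); rewrite !compE !mul0r subr0 addr0.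
  by have := lerD h1 h2; rewrite -mulrDl -splitr.
split; apply/is_deriveP => e e0; have [d d0 dP] := H e e0; exists d => // h hd;
  apply: le_trans (dP h hd).
  by apply: le_trans (ler_Re_mod _); rewrite !compE !mul0r subr0.
by apply: le_trans (ler_Im_mod _); rewrite !compE !mul0r addr0.
Qed.

(** The derivatives of wp along lines and of the matrix exponential are all obtained from such
    remainder bounds. *)
Lemma cder_quadratic p s l C d : 0 < d ->
  (forall h, `|h| < d -> modulus (p (s + h) - p s - toC h * l) <= C * `|h| ^+ 2)
  -> cder p s l.
Proof.
move=> d0 H; apply/cderP => e e0.
pose C' := `|C| + 1.
have C'0 : 0 < C' by rewrite ltr_pwDr.
exists (Num.min d (e / C')); first by rewrite lt_min d0 divr_gt0.
move=> h; rewrite lt_min => /andP[/H hd he]; apply: (le_trans hd).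
rewrite expr2 mulrA ler_wpM2r //.
apply: (@le_trans _ _ (C' * `|h|)); last by rewrite mulrC -ler_pdivlMr // ltW.
by rewrite ler_wpM2r // (le_trans (ler_norm C)) // lerDl.
Qed.

Lemma cder_unique p s l m : cder p s l -> cder p s m -> l = m.
Proof.
by move=> [a b] [c d]; apply: cplxP; [exact: (is_derive_unique a c)|
  exact: (is_derive_unique b d)].
Qed.

Lemma cder_near p q s l d : 0 < d -> (forall t, `|t - s| < d -> p t = q t) ->
  cder p s l -> cder q s l.
Proof.
move=> d0 pq [a b]; split.
  by apply: (is_derive_near d0 _ a) => t td /=; rewrite pq.
by apply: (is_derive_near d0 _ b) => t td /=; rewrite pq.
Qed.

Lemma cderD p q s l m : cder p s l -> cder q s m ->
  cder (fun t => p t + q t) s (l + m).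
Proof.
move=> [a b] [c d]; split.
  rewrite cReD (_ : (fun t => _) = (fun t => complex.Re (p t)) + (fun t => complex.Re (q t))).
    exact: is_deriveD.
  by apply/funext => t; rewrite cReD.
rewrite cImD (_ : (fun t => _) = (fun t => complex.Im (p t)) + (fun t => complex.Im (q t))).
  exact: is_deriveD.
by apply/funext => t; rewrite cImD.
Qed.

Lemma cderN p s l : cder p s l -> cder (fun t => - p t) s (- l).
Proof.
move=> [a b]; split.
  rewrite cReN (_ : (fun t => _) = - (fun t => complex.Re (p t))).
    exact: is_deriveN.
  by apply/funext => t; rewrite cReN.
rewrite cImN (_ : (fun t => _) = - (fun t => complex.Im (p t))).
  exact: is_deriveN.
by apply/funext => t; rewrite cImN.
Qed.

Lemma cderB p q s l m : cder p s l -> cder q s m ->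
  cder (fun t => p t - q t) s (l - m).
Proof. by move=> a b; apply: cderD => //; exact: cderN. Qed.

Lemma cderM p q s l m : cder p s l -> cder q s m ->
  cder (fun t => p t * q t) s (p s * m + l * q s).
Proof.
move=> [a b] [c d]; split.
  rewrite (_ : (fun t => _) =
    (fun t => complex.Re (p t)) * (fun t => complex.Re (q t)) -
    (fun t => complex.Im (p t)) * (fun t => complex.Im (q t))).
    apply: is_derive_eq; rewrite /GRing.scale /= !compE; ring.
  by apply/funext => t; rewrite cReM.
rewrite (_ : (fun t => _) =
    (fun t => complex.Re (p t)) * (fun t => complex.Im (q t)) +
    (fun t => complex.Im (p t)) * (fun t => complex.Re (q t))).
  apply: is_derive_eq; rewrite /GRing.scale /= !compE; ring.
by apply/funext => t; rewrite cImM.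
Qed.

Lemma cder_cst m s : cder (fun=> m) s 0.
Proof. by split; exact: is_derive_cst. Qed.

Lemma cderZ m p s l : cder p s l -> cder (fun t => m * p t) s (m * l).
Proof.
by move=> H; have := cderM (cder_cst m s) H; rewrite mul0r addr0.
Qed.

Lemma cderJ p s l : cder p s l -> cder (fun t => (p t)^*) s l^*.
Proof.
move=> [a b]; split; first by rewrite cReJ; under eq_fun do rewrite cReJ.
rewrite cImJ; under eq_fun do rewrite cImJ; exact: is_deriveN.
Qed.

Lemma cder_toC f s (l : R) : is_derive s 1 f l ->
  cder (fun t => toC (f t)) s (toC l).
Proof. by move=> H; split => //; exact: is_derive_cst. Qed.

Lemma cder_cont p s l : cder p s l -> forall e, 0 < e ->
  exists2 d, 0 < d & forall t, `|t - s| < d -> modulus (p t - p s) < e.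
Proof.
move=> [/is_derive_cont /continuous_eps Hr /is_derive_cont /continuous_eps Hi].
move=> e e0.
have e2 : 0 < e / 2 by rewrite divr_gt0.
have [d1 d10 H1] := Hr _ e2; have [d2 d20 H2] := Hi _ e2.
exists (Num.min d1 d2); first by rewrite lt_min d10.
move=> h; rewrite lt_min => /andP[/H1 h1 /H2 h2].
apply: (le_lt_trans (mod_le_ReIm _)); rewrite !compE.
by have := ltrD h1 h2; rewrite -splitr.
Qed.

Lemma is_derive_mod2 p s l : cder p s l ->
  is_derive s 1 (fun t => modulus (p t) ^+ 2)
    (2 * (complex.Re (p s) * complex.Re l + complex.Im (p s) * complex.Im l)).
Proof.
move=> [a b].
rewrite (_ : (fun t => _) =
    (fun t => complex.Re (p t)) * (fun t => complex.Re (p t)) +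
    (fun t => complex.Im (p t)) * (fun t => complex.Im (p t))).
  by apply: is_derive_eq; rewrite /GRing.scale /=; ring.
by apply/funext => t; rewrite sqr_mod !expr2.
Qed.

Lemma ReIm_mod_le z m :
  complex.Re z * complex.Re m + complex.Im z * complex.Im m
    <= modulus (z : Cplx R) * modulus m.
Proof.
have -> : complex.Re z * complex.Re m + complex.Im z * complex.Im m =
  complex.Re (z * m^*) by rewrite !compE; ring.
by rewrite -(modJ m) -modM (le_trans (ler_norm _)) // ler_Re_mod.
Qed.

End CurveDerivative.

Definition boxsum (V : nmodType) (N : nat) (phi : int -> int -> V) : V :=
  \sum_(j < N.*2.+1) \sum_(k < N.*2.+1) phi (j%:Z - N%:Z) (k%:Z - N%:Z).

(** * Lattice sums and the Weierstrass function *)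

Section BoxSums.

Lemma boxsumD (V : nmodType) N (f g : int -> int -> V) :
  boxsum N (fun m n => f m n + g m n) = boxsum N f + boxsum N g.
Proof.
by rewrite /boxsum -big_split; apply: eq_bigr => j _; rewrite -big_split.
Qed.

Lemma boxsumN (V : zmodType) N (f : int -> int -> V) :
  boxsum N (fun m n => - f m n) = - boxsum N f.
Proof.
by rewrite /boxsum -sumrN; apply: eq_bigr => j _; rewrite -sumrN.
Qed.

Lemma boxsumZ (V : pzRingType) N c (f : int -> int -> V) :
  boxsum N (fun m n => c * f m n) = c * boxsum N f.
Proof.
by rewrite /boxsum big_distrr; apply: eq_bigr => j _; rewrite big_distrr.
Qed.

Lemma box_index (N : nat) (m : int) : (absz m <= N)%N ->
  exists j : 'I_N.*2.+1, m = j%:Z - N%:Z.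
Proof.
move=> mN; have H : (absz (m + N%:Z)%R < N.*2.+1)%N by lia.
by exists (Ordinal H) => /=; lia.
Qed.

Lemma box_index_inj (N : nat) (j k : 'I_N.*2.+1) :
  j%:Z - N%:Z = k%:Z - N%:Z -> j = k.
Proof. by move=> H; apply: val_inj => /=; lia. Qed.

(** The removed point is replaced by 0 and the sum still runs over the full square, so the general
    bounds keep applying to the rest. *)
Lemma boxsum_extract (V : nmodType) N (f : int -> int -> V) m0 n0 :
  (absz m0 <= N)%N -> (absz n0 <= N)%N ->
  boxsum N f = f m0 n0 +
    boxsum N (fun m n => if (m == m0) && (n == n0) then 0 else f m n).
Proof.
move=> /box_index[j0 ->] /box_index[k0 ->].
rewrite /boxsum (bigD1 j0) //= (bigD1 k0) //= [in RHS](bigD1 j0) //=.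
rewrite [in RHS](bigD1 k0) //= !eqxx /= add0r !addrA; congr (_ + _ + _).
  apply: eq_bigr => k kk0; case: ifP => // /eqP /box_index_inj kE.
  by rewrite kE eqxx in kk0.
apply: eq_bigr => j jj0; apply: eq_bigr => k _.
by case: ifP => // /andP[/eqP/box_index_inj jE]; rewrite jE eqxx in jj0.
Qed.

(** The ring between two consecutive squares: two full sides and two sides without their end points,
    so that each corner is counted once. *)
Definition shell (V : nmodType) (N : nat) (phi : int -> int -> V) : V :=
  \sum_(k < N.+1.*2.+1) (phi (- N.+1%:Z) (k%:Z - N.+1%:Z)
                         + phi N.+1%:Z (k%:Z - N.+1%:Z))
  + \sum_(j < N.*2.+1) (phi (j%:Z - N%:Z) (- N.+1%:Z)
                        + phi (j%:Z - N%:Z) N.+1%:Z).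

Lemma boxsumS (V : nmodType) N (f : int -> int -> V) :
  boxsum N.+1 f = boxsum N f + shell N f.
Proof.
have S (F : int -> V) : \sum_(k < N.+1.*2.+1) F (k%:Z - N.+1%:Z) =
    F (- N.+1%:Z) + \sum_(k < N.*2.+1) F (k%:Z - N%:Z) + F N.+1%:Z.
  rewrite doubleS big_ord_recr big_ord_recl /=.
  congr (_ + _ + _); [congr F; lia| |congr F; lia].
  by apply: eq_bigr => k _; congr F; rewrite /bump /=; lia.
rewrite [LHS](S (fun a => \sum_(k < N.+1.*2.+1) f a (k%:Z - N.+1%:Z))) /=.
rewrite (eq_bigr _ (fun (j : 'I__) _ => S (f (j%:Z - N%:Z)))).
rewrite /boxsum /shell !big_split /=.
by rewrite [LHS](AC (1 * 3 * 1) (3 * (1 * 5 * (2 * 4)))).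
Qed.

Lemma boxsum0 (V : nmodType) (f : int -> int -> V) : boxsum 0 f = f 0 0.
Proof. by rewrite /boxsum !big_ord1. Qed.

End BoxSums.

Definition msz (m n : int) : nat := (maxn (absz m) (absz n)).+1.
(** The successor in [msz] keeps the weight meaningful at the origin. The exponent 3 is the least
    integer that makes the weights summable over a plane lattice. *)
Definition wgt (R : realType) (m n : int) : R := (msz m n)%:R ^- 3.

(** Convergence measured by the real number [modulus], the norm of [Cplx R] being itself complex
    valued. *)
Definition cseq (R : realType) (u : nat -> Cplx R) (l : Cplx R) :=
  forall e : R, 0 < e -> exists N0 : nat, forall n : nat, (N0 <= n)%N -> modulus (u n - l) <= e.

Section BoxConvergence.
Variable R : realType.
Implicit Types (f : int -> int -> Cplx R) (w : int -> int -> R).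

Lemma msz_gt0 m n : 0 < (msz m n)%:R :> R.
Proof. by rewrite ltr0n. Qed.

Lemma wgt_gt0 m n : 0 < wgt R m n.
Proof. by rewrite invr_gt0 exprn_gt0 // msz_gt0. Qed.

Lemma boxsum_ge0 w N : (forall m n, 0 <= w m n) -> 0 <= boxsum N w.
Proof. by move=> H; apply: sumr_ge0 => j _; apply: sumr_ge0 => k _. Qed.

Lemma boxsum_ge_term w N m n : (forall m n, 0 <= w m n) ->
  (absz m <= N)%N -> (absz n <= N)%N -> w m n <= boxsum N w.
Proof.
move=> H mN nN; rewrite (boxsum_extract w mN nN) lerDl.
by apply: boxsum_ge0 => i j; case: ifP.
Qed.

Lemma mod_shell f w N : (forall m n, modulus (f m n) <= w m n) ->
  modulus (shell N f) <= shell N w.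
Proof.
move=> H.
have S n (F : 'I_n -> Cplx R) : modulus (\sum_(k < n) F k) <= \sum_(k < n) modulus (F k).
  apply: (big_ind2 (fun (x : Cplx R) y => modulus x <= y)); first by rewrite mod0.
    by move=> x1 x2 y1 y2 h1 h2; apply: le_trans (modD _ _) (lerD h1 h2).
  by [].
apply: (le_trans (modD _ _)); apply: lerD; apply: (le_trans (S _ _));
  by apply: ler_sum => i _; apply: (le_trans (modD _ _)); apply: lerD.
Qed.

(** The ring has 8(N+1) points, each of weight (N+2)^-3. The bound is given in telescoping form, so
    that tails of the double sum follow by adding up. *)
Lemma shell_wgt N : shell N (@wgt R) <= 8 / N.+1%:R - 8 / N.+2%:R.
Proof.
have B m n : (N < maxn (absz m) (absz n))%N -> wgt R m n <= N.+2%:R ^- 3.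
  move=> H; rewrite lef_pV2 ?posrE ?exprn_gt0 ?msz_gt0 //.
  by rewrite lerXn2r ?nnegrE // ler_nat /msz.
have B2 (a b c d : int) : (N < maxn (absz a) (absz b))%N -> (N < maxn (absz c) (absz d))%N ->
    wgt R a b + wgt R c d <= 2 * N.+2%:R ^- 3.
  by move=> /B h1 /B h2; rewrite mulrDl mul1r lerD.
apply: (@le_trans _ _ ((8 * N.+1%:R) * N.+2%:R ^- 3)).
  have -> : 8 * N.+1%:R * N.+2%:R ^- 3 =
     \sum_(k < N.+1.*2.+1) (2 * N.+2%:R ^- 3) + \sum_(k < N.*2.+1) (2 * N.+2%:R ^- 3) :> R.
    set x := N.+2%:R ^- 3; rewrite !sumr_const !card_ord -mulrnDr.
    have -> : (N.+1.*2.+1 + N.*2.+1 = 4 * N.+1)%N by lia.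
    by rewrite -(mulr_natr (2 * x)) natrM; ring.
  by apply: lerD; apply: ler_sum => i _; apply: B2; lia.
have n1 : 0 < N.+1%:R :> R by rewrite ltr0n.
have E : N.+2%:R = N.+1%:R + 1 :> R by rewrite -addn1 natrD.
rewrite E; set x := N.+1%:R in n1 *.
have -> : 8 / x - 8 / (x + 1) = 8 * (x + 1) ^+ 2 / x / (x + 1) ^+ 3.
  by field; lra.
rewrite ler_pM2r ?invr_gt0 ?exprn_gt0 //; last lra.
rewrite ler_pdivlMr //; nra.
Qed.

Lemma boxsum_wgt_tail N M : (N <= M)%N ->
  boxsum M (@wgt R) - boxsum N (@wgt R) <= 8 / N.+1%:R - 8 / M.+1%:R.
Proof.
elim: M => [|M IH]; first by rewrite leqn0 => /eqP ->; rewrite !subrr.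
rewrite leq_eqVlt => /predU1P[->|]; first by rewrite !subrr.
rewrite ltnS => /IH H; rewrite boxsumS.
by rewrite addrAC; apply: le_trans (lerD H (shell_wgt M)) _; rewrite addrA subrK.
Qed.

Lemma boxsum_tail f C N M : (forall m n, modulus (f m n) <= C * wgt R m n) ->
  (N <= M)%N -> modulus (boxsum M f - boxsum N f) <= C * (8 / N.+1%:R).
Proof.
move=> H NM.
have C0 : 0 <= C.
  by have := le_trans (mod_ge0 _) (H 0 0); rewrite pmulr_lge0 // wgt_gt0.
apply: (@le_trans _ _ (C * (boxsum M (@wgt R) - boxsum N (@wgt R)))); last first.
  apply: ler_wpM2l => //; apply: (le_trans (boxsum_wgt_tail NM)).
  by rewrite lerBlDr lerDl divr_ge0.
rewrite mulrBr -!boxsumZ.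
elim: M NM => [|M IH]; first by rewrite leqn0 => /eqP ->; rewrite !subrr mod0.
rewrite leq_eqVlt => /predU1P[->|]; first by rewrite !subrr mod0.
rewrite ltnS => /IH {}IH; rewrite !boxsumS addrAC [in leRHS]addrAC.
exact: (le_trans (modD _ _) (lerD IH (mod_shell _ H))).
Qed.

(** Here 9 = 1 + 8: the origin has weight 1, and the tail bound at 0 gives 8. *)
Lemma boxsum_bound f C N : (forall m n, modulus (f m n) <= C * wgt R m n) ->
  modulus (boxsum N f) <= 9 * C.
Proof.
move=> H; rewrite -(subrK (boxsum 0 f) (boxsum N f)).
apply: (le_trans (modD _ _)).
have := boxsum_tail H (leq0n N); have := H 0 0.
rewrite boxsum0 /wgt /msz /= expr1n invr1 !mulr1 => h1 h2; lra.
Qed.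

Lemma cseq_bound u l C : @cseq R u l -> (forall N, modulus (u N) <= C) ->
  modulus l <= C.
Proof.
move=> ul H; apply/ler_addgt0Pr => e /ul[N /(_ N (leqnn N)) ue].
have -> : l = u N - (u N - l) by rewrite opprB addrC subrK.
exact: (le_trans (modB _ _) (lerD (H N) ue)).
Qed.

Lemma cseqD u v l m : @cseq R u l -> cseq v m -> cseq (fun n => u n + v n) (l + m).
Proof.
move=> ul vm e e0.
have e2 : 0 < e / 2 by rewrite divr_gt0.
have [N1 H1] := ul _ e2; have [N2 H2] := vm _ e2.
exists (maxn N1 N2) => n; rewrite geq_max => /andP[/H1 h1 /H2 h2].
have -> : u n + v n - (l + m) = (u n - l) + (v n - m) by ring.
by apply: (le_trans (modD _ _)); rewrite [e]splitr lerD.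
Qed.

Lemma cseqZ c u l : @cseq R u l -> cseq (fun n => c * u n) (c * l).
Proof.
move=> ul e e0.
have c0 : 0 < modulus c + 1 by rewrite ltr_pwDr // mod_ge0.
have [N1 H1] := ul _ (divr_gt0 e0 c0).
exists N1 => n /H1; rewrite ler_pdivlMr // -mulrBr modM => h.
apply: le_trans h; rewrite mulrC ler_wpM2l ?mod_ge0 //; lra.
Qed.

Lemma cauchy_cseq u :
  (forall e : R, 0 < e -> exists N : nat, forall n : nat, (N <= n)%N -> modulus (u n - u N) <= e) ->
  exists l, @cseq R u l.
Proof.
move=> H.
have K (g : Cplx R -> R) : (forall z z1, `|g z - g z1| <= modulus (z - z1)) ->
    cvg (g (u n) @[n --> \oo]).
  move=> gl; apply/cauchy_cvgP/cauchy_exP => e e0 /=.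
  have [N HN] := H (e / 2) (divr_gt0 e0 (ltr0n _ 2)).
  exists (g (u N)); exists N => // n /= /HN h; rewrite /ball /= distrC.
  apply: le_lt_trans (gl _ _) _; apply: le_lt_trans h _; lra.
have kr (z z1 : Cplx R) : `|complex.Re z - complex.Re z1| <= modulus (z - z1).
  by have := ler_Re_mod (z - z1); rewrite !compE.
have ki (z z1 : Cplx R) : `|complex.Im z - complex.Im z1| <= modulus (z - z1).
  by have := ler_Im_mod (z - z1); rewrite !compE.
have /cvg_ex[/= a /cvgrPdist_le Ha] := K _ kr.
have /cvg_ex[/= b /cvgrPdist_le Hb] := K _ ki.
exists (toC a + 'i * toC b) => e e0.
have e2 : 0 < e / 2 by rewrite divr_gt0.
have [N1 _ H1] := Ha _ e2; have [N2 _ H2] := Hb _ e2.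
exists (maxn N1 N2) => n; rewrite geq_max => /andP[/H1 h1 /H2 h2].
apply: (le_trans (mod_le_ReIm _)); rewrite !compE [e]splitr.
by apply: lerD; rewrite distrC; [move: h1|move: h2];
  rewrite /= !(mul0r, mul1r, mulr0, subr0, addr0, add0r).
Qed.

Lemma boxsum_cvg f C : (forall m n, modulus (f m n) <= C * wgt R m n) ->
  exists l, cseq (fun N => boxsum N f) l.
Proof.
move=> H; apply: cauchy_cseq => e e0.
have C0 : 0 <= C.
  by have := le_trans (mod_ge0 _) (H 0 0); rewrite pmulr_lge0 // wgt_gt0.
pose N := Num.truncn (C * 8 / e).
exists N => n Nn; apply: (le_trans (boxsum_tail H Nn)).
rewrite mulrA ler_pdivrMr ?ltr0n // [e * _]mulrC -ler_pdivrMr //.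
by apply: ltW; apply: truncnS_gt.
Qed.

End BoxConvergence.

(** * Distances to lattice points *)

Section LatticeSums.
Variables (R : realType) (w1 w2 : Cplx R).
Hypothesis w12 : complex.Im (w2 / w1) != 0.
Implicit Types (z h : Cplx R) (m n : int).

Local Notation lat := (lattice_pt w1 w2).

Definition off_lattice z := forall m n, z != lat m n.

Lemma toC_int m : toC (m%:~R : R) = m%:~R :> Cplx R.
Proof. exact: (rmorph_int (real_complex R : {rmorphism R -> R[i]})). Qed.

Lemma mod_int m : modulus (m%:~R : Cplx R) = (absz m)%:R.
Proof. by rewrite -toC_int mod_toC -intr_norm -natr_absz. Qed.

(** With t = w2 / w1, the imaginary part of m + n t is n Im t, which controls [n]; then m = (m + n
    t) - n t controls [m]. *)
Lemma lattice_lower : exists2 c : R, 0 < c &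
  forall m n, c * (maxn (absz m) (absz n))%:R <= modulus (lat m n).
Proof.
have [t tE] : exists t, t = w2 / w1 by exists (w2 / w1).
have tI : complex.Im t != 0 by rewrite tE.
have w10 : w1 != 0 by apply: contraNneq tI => E; rewrite tE E invr0 mulr0.
have m1 : 0 < modulus w1 by exact: mod_gt0.
pose a := `|complex.Im t|; pose b := 1 + modulus t / a.
have a0 : 0 < a by rewrite normr_gt0.
have b0 : 0 < b by rewrite ltr_pwDl // divr_ge0 ?mod_ge0 // ltW.
have key m n : (absz n)%:R * a <= modulus (m%:~R + n%:~R * t : Cplx R).
  apply: le_trans (ler_Im_mod _); rewrite -!toC_int !compE mul0r add0r addr0.
  by rewrite normrM -intr_norm -natr_absz.
have key2 m n : (absz m)%:R <= modulus (m%:~R + n%:~R * t : Cplx R) * b.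
  rewrite -mod_int.
  have -> : m%:~R = (m%:~R + n%:~R * t) - n%:~R * t :> Cplx R by ring.
  apply: (le_trans (modB _ _)); rewrite mulrDr mulr1.
  have -> : m%:~R + n%:~R * t - n%:~R * t + n%:~R * t = m%:~R + n%:~R * t :> Cplx R by ring.
  rewrite lerD2l modM mod_int [modulus t / a]mulrC mulrA.
  by rewrite ler_wpM2r ?mod_ge0 // ler_pdivlMr // key.
exists (modulus w1 * Num.min a b^-1).
  by rewrite mulr_gt0 // lt_min a0 invr_gt0.
move=> m n.
have -> : lat m n = w1 * (m%:~R + n%:~R * t) by rewrite /lattice_pt tE; field.
rewrite modM -mulrA ler_pM2l //.
have [mn|nm] := leqP (absz m) (absz n).
  by apply: le_trans (key m n); rewrite mulrC ler_wpM2l // ge_min lexx.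
apply: (@le_trans _ _ (b^-1 * (absz m)%:R)).
  by rewrite ler_wpM2r // ge_min lexx orbT.
by rewrite mulrC ler_pdivrMr // key2.
Qed.

(** The selector [S] serves two cases: all lattice points when [z] is off the lattice, all but one
    when [z] is a pole. Far points are handled by [lattice_lower], the finitely many near ones by a
    crude constant. *)
Lemma lattice_gap z (S : int -> int -> bool) :
  (forall m n, S m n -> z != lat m n) ->
  exists2 c : R, 0 < c &
    forall m n, S m n -> c * (msz m n)%:R <= modulus (z - lat m n).
Proof.
move=> zS; have [c0 c00 H0] := lattice_lower.
(* Beyond [K] the modulus of [z] is at most half of the lower bound for the lattice point; passing
   from the maximum to [msz] costs another factor 2, hence [c0 / 4]. *)
pose K := (Num.truncn (2 * modulus z / c0)).+1.
pose phi m n : R := if S m n then (msz m n)%:R / modulus (z - lat m n) else 0.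
have phi0 m n : 0 <= phi m n.
  by rewrite /phi; case: ifP => // _; rewrite divr_ge0 // mod_ge0.
(* A sum of nonnegative ratios dominates each of them, so [B^-1] serves all near points at once
   without forming a minimum. *)
pose B := 1 + boxsum K phi.
have B0 : 0 < B by rewrite ltr_pwDl // boxsum_ge0.
exists (Num.min (c0 / 4) B^-1); first by rewrite lt_min divr_gt0 // invr_gt0.
move=> m n Smn; set M := maxn (absz m) (absz n).
have zl : 0 < modulus (z - lat m n) by rewrite mod_gt0 // subr_eq0 zS.
have [KM|MK] := leqP K M.
  apply: (@le_trans _ _ (c0 / 4 * (msz m n)%:R)).
    by rewrite ler_wpM2r // ge_min lexx.
  have h1 : 2 * modulus z / c0 <= M%:R.
    apply: ltW; apply: (lt_le_trans (truncnS_gt _)); rewrite ler_nat //.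
  rewrite ler_pdivrMr // in h1.
  have h2 := H0 m n; rewrite -/M in h2.
  have h3 := modB_ge (lat m n) z; rewrite modBC in h3.
  have h4 : (msz m n)%:R = M%:R + 1 :> R by rewrite /msz -/M -addn1 natrD.
  have h5 : 1 <= M%:R :> R by rewrite ler1n (leq_trans _ KM).
  have h6 : c0 <= c0 * M%:R by rewrite ler_peMr // ltW.
  rewrite h4; nra.
apply: (@le_trans _ _ (B^-1 * (msz m n)%:R)).
  by rewrite ler_wpM2r // ge_min lexx orbT.
rewrite mulrC ler_pdivrMr // mulrC -ler_pdivrMr //.
have -> : (msz m n)%:R / modulus (z - lat m n) = phi m n by rewrite /phi Smn.
apply: (@le_trans _ _ (boxsum K phi)); last by rewrite /B lerDr.
by apply: boxsum_ge_term => //; lia.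
Qed.

(** Since [msz] is at least 1, a displacement smaller than half the gap constant consumes at most
    half of every gap. This uniformity in [h] is what termwise differentiation requires. *)
Lemma lattice_gap_near z (S : int -> int -> bool) :
  (forall m n, S m n -> z != lat m n) ->
  exists2 c : R, 0 < c & forall h m n, modulus h < c -> S m n ->
    modulus (z + h - lat m n)^-1 <= c^-1 / (msz m n)%:R /\ z + h != lat m n.
Proof.
move=> zS; have [c c0 H] := lattice_gap zS.
exists (c / 2) => [|h m n hc Smn]; first by rewrite divr_gt0.
have m0 : 0 < (msz m n)%:R :> R by rewrite ltr0n.
have m1 : 1 <= (msz m n)%:R :> R by rewrite ler1n.
have h1 := H m n Smn.
have h2 : modulus (z - lat m n) - modulus h <= modulus (z + h - lat m n).
  have := modB_ge (z - lat m n) (- h); rewrite modN opprK.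
  by rewrite [z + h - _]addrAC.
have h3 : c / 2 * (msz m n)%:R <= modulus (z + h - lat m n) by nra.
have h4 : 0 < c / 2 * (msz m n)%:R by rewrite mulr_gt0 // divr_gt0.
split; last first.
  by apply: contraTneq (lt_le_trans h4 h3) => ->; rewrite subrr mod0 ltxx.
by rewrite modV -invfM lef_pV2 // posrE (lt_le_trans h4 h3).
Qed.

(** The inverse of 0 is 0, so the excluded index (0, 0) turns into an ordinary term, equal to the
    principal part [z ^- 2]. *)
Lemma wp_partial_boxsum z N : wp_partial w1 w2 z N =
  boxsum N (fun m n => (z - lat m n) ^- 2 - lat m n ^- 2).
Proof.
have l0 : lat 0 0 = 0 by rewrite /lattice_pt !mul0r addr0.
rewrite (@boxsum_extract _ _ _ 0 0) // l0 subr0 expr0n /= invr0 subr0.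
rewrite /wp_partial; congr (_ + _); apply: eq_bigr => j _.
rewrite big_mkcond; apply: eq_bigr => k _; rewrite !subr_eq0.
have E (x : nat) : (x%:Z == N%:Z) = (x == N) by [].
by rewrite !E -negb_and; case: (_ && _).
Qed.

(** The derivative of the general term of the series; [termP2] is the second derivative. *)
Definition termP1 z m n : Cplx R := -2 * (z - lat m n)^-1 ^+ 3.
Definition termP2 z m n : Cplx R := 6 * (z - lat m n)^-1 ^+ 4.

Lemma powers_bound (A M : R) (a b : R) j k : 1 <= M -> 0 <= a <= A / M ->
  0 <= b <= A / M -> (2 < j + k)%N -> a ^+ j * b ^+ k <= A ^+ (j + k) * M ^- 3.
Proof.
move=> M1 /andP[a0 aA] /andP[b0 bA] jk.
have M0 : 0 < M by lra.
have A0 : 0 <= A by move: (le_trans a0 aA); rewrite pmulr_lge0 // invr_gt0.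
apply: (@le_trans _ _ ((A / M) ^+ j * (A / M) ^+ k)).
  by apply: ler_pM; rewrite ?exprn_ge0 // lerXn2r // nnegrE ?divr_ge0 // ltW.
rewrite -exprD expr_div_n ler_wpM2l ?exprn_ge0 //.
by rewrite lef_pV2 ?posrE ?exprn_gt0 // ler_weXn2l.
Qed.

End LatticeSums.

Section Taylor.
Variable R : realType.
Implicit Types (x h a b : Cplx R).

(** The remainder is factored into a power of [h] and monomials in the two inverses of total degree
    greater than 2, which is exactly what [mod_powers_bound] makes summable. Exponents 1 are written
    out to fit that lemma; the next two identities have the same purpose. *)
Lemma inv2_taylor x h : x != 0 -> x + h != 0 ->
  (x + h) ^- 2 - x ^- 2 - h * (-2 * x^-1 ^+ 3) =
  h ^+ 2 * (2 * (x^-1 ^+ 3 * (x + h)^-1 ^+ 1) + x^-1 ^+ 2 * (x + h)^-1 ^+ 2).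
Proof. by move=> x0 xh0; field; rewrite xh0. Qed.

Lemma inv3_taylor x h : x != 0 -> x + h != 0 ->
  -2 * (x + h)^-1 ^+ 3 - -2 * x^-1 ^+ 3 - h * (6 * x^-1 ^+ 4) =
  h ^+ 2 * (- 2 * (x^-1 ^+ 2 * (x + h)^-1 ^+ 3)
  + - 4 * (x^-1 ^+ 3 * (x + h)^-1 ^+ 2) + - 6 * (x^-1 ^+ 4 * (x + h)^-1 ^+ 1)).
Proof. by move=> x0 xh0; field; rewrite xh0. Qed.

Lemma inv4_taylor x h : x != 0 -> x + h != 0 ->
  6 * (x + h)^-1 ^+ 4 - 6 * x^-1 ^+ 4 =
  h * (- 6 * (x^-1 ^+ 4 * (x + h)^-1 ^+ 1) + - 6 * (x^-1 ^+ 3 * (x + h)^-1 ^+ 2)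
  + (- 6 * (x^-1 ^+ 2 * (x + h)^-1 ^+ 3) + - 6 * (x^-1 ^+ 1 * (x + h)^-1 ^+ 4))).
Proof. by move=> x0 xh0; field; rewrite xh0. Qed.

Lemma mod_scaled_bound c (k : nat) a (B : R) : modulus c = k%:R -> modulus a <= B ->
  modulus (c * a) <= k%:R * B.
Proof. by move=> ck aB; rewrite modM ck ler_wpM2l. Qed.

Lemma mod_Nnat (k : nat) : modulus (- k%:R : Cplx R) = k%:R.
Proof. by rewrite modN mod_nat. Qed.

Lemma mod_powers_bound (A : R) a b m n j k : modulus a <= A / (msz m n)%:R ->
  modulus b <= A / (msz m n)%:R -> (2 < j + k)%N ->
  modulus (a ^+ j * b ^+ k) <= A ^+ (j + k) * wgt R m n.
Proof.
move=> aA bA jk; rewrite modM !modX.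
by apply: powers_bound; rewrite ?mod_ge0 // ler1n.
Qed.

End Taylor.

(** * Termwise differentiation of the lattice sum *)

Section WeierstrassLocal.
Variables (R : realType) (w1 w2 : Cplx R).
Hypothesis w12 : complex.Im (w2 / w1) != 0.
Implicit Types (z h : Cplx R) (m n : int).
Local Notation lat := (lattice_pt w1 w2).
Local Notation off := (off_lattice w1 w2).

Lemma termP1_cvg z : off z -> exists l, cseq (fun N => boxsum N (termP1 w1 w2 z)) l.
Proof.
move=> zoff.
have [c c0 H] := lattice_gap_near w12 (S := fun _ _ => true) (fun m n _ => zoff m n).
apply: (@boxsum_cvg _ _ (2%:R * c^-1 ^+ (3 + 0))) => m n.
have [] := H 0 m n _ isT; rewrite ?mod0 // addr0 => h1 _.
rewrite -mulrA; apply: mod_scaled_bound; first exact: mod_Nnat.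
by rewrite -[_ ^+ 3]mulr1; exact: (mod_powers_bound (j := 3) (k := 0) h1 h1).
Qed.

Lemma termP2_cvg z : off z -> exists l, cseq (fun N => boxsum N (termP2 w1 w2 z)) l.
Proof.
move=> zoff.
have [c c0 H] := lattice_gap_near w12 (S := fun _ _ => true) (fun m n _ => zoff m n).
apply: (@boxsum_cvg _ _ (6%:R * c^-1 ^+ (4 + 0))) => m n.
have [] := H 0 m n _ isT; rewrite ?mod0 // addr0 => h1 _.
rewrite -mulrA; apply: mod_scaled_bound; first exact: mod_nat.
by rewrite -[_ ^+ 4]mulr1; exact: (mod_powers_bound (j := 4) (k := 0) h1 h1).
Qed.

Lemma box_diff_bound (f1 f2 : int -> int -> Cplx R) (l1 l2 : Cplx R) h B :
  cseq (fun N => boxsum N f1) l1 -> cseq (fun N => boxsum N f2) l2 ->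
  (forall m n, modulus (f2 m n - f1 m n) <= B * wgt R m n) ->
  modulus (l2 - l1) <= 9 * B.
Proof.
move=> H1 H2 H.
have := cseqD H2 (cseqZ (-1) H1); rewrite mulN1r => /cseq_bound; apply=> N.
rewrite mulN1r -boxsumN -boxsumD.
exact: boxsum_bound H.
Qed.

Lemma box_taylor_bound (f1 f2 f3 : int -> int -> Cplx R) (l1 l2 l3 : Cplx R) h B :
  cseq (fun N => boxsum N f1) l1 -> cseq (fun N => boxsum N f2) l2 ->
  cseq (fun N => boxsum N f3) l3 ->
  (forall m n, modulus (f2 m n - f1 m n - h * f3 m n) <= B * wgt R m n) ->
  modulus (l2 - l1 - h * l3) <= 9 * B.
Proof.
move=> H1 H2 H3 H.
have := cseqD H2 (cseqZ (-1) (cseqD H1 (cseqZ h H3))).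
rewrite mulN1r opprD addrA => /cseq_bound; apply=> N.
rewrite mulN1r opprD addrA -boxsumZ -!boxsumN -!boxsumD.
exact: boxsum_bound H.
Qed.

(** Each term has a Taylor remainder bounded by a power of [modulus h] times a multiple of [wgt],
    uniformly in the lattice point; summation then gives the remainder of the whole series, with no
    theorem on uniform convergence. *)
Lemma weierstrass_regular (P P1 P2 : Cplx R -> Cplx R) :
  (forall z, off z -> cseq (wp_partial w1 w2 z) (P z)) ->
  (forall z, off z -> cseq (fun N => boxsum N (termP1 w1 w2 z)) (P1 z)) ->
  (forall z, off z -> cseq (fun N => boxsum N (termP2 w1 w2 z)) (P2 z)) ->
  forall z, off z -> exists r C : R, 0 < r /\ forall h, modulus h < r ->
   [/\ off (z + h),
      modulus (P (z + h) - P z - h * P1 z) <= C * modulus h ^+ 2,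
      modulus (P1 (z + h) - P1 z - h * P2 z) <= C * modulus h ^+ 2 &
      modulus (P2 (z + h) - P2 z) <= C * modulus h].
Proof.
move=> HP HP1 HP2 z zoff.
have [c c0 H] := lattice_gap_near w12 (S := fun _ _ => true) (fun m n _ => zoff m n).
(* The factor 9 comes from [boxsum_bound]; 24 is the largest sum of numerical coefficients in the
   three Taylor identities, whose monomials have degree 4 or 5. *)
pose A := c^-1; pose C := 9 * (24 * (A ^+ 4 + A ^+ 5)).
have A4 : 0 <= A ^+ 4 by rewrite exprn_ge0 // invr_ge0 ltW.
have A5 : 0 <= A ^+ 5 by rewrite exprn_ge0 // invr_ge0 ltW.
exists c, C; split=> // h hc.
have zh : off (z + h) by move=> m n; have [] := H h m n hc isT.
have h0 : 0 <= modulus h by exact: mod_ge0.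
have h2 : 0 <= modulus h ^+ 2 by exact: exprn_ge0.
have Ha m n : modulus (z - lat m n)^-1 <= A / (msz m n)%:R.
  by have [] := H 0 m n _ isT; rewrite ?mod0 // addr0.
have Hb m n : modulus (z - lat m n + h)^-1 <= A / (msz m n)%:R.
  by have [] := H h m n hc isT; rewrite [z - _ + h]addrAC.
have z1 m n : z - lat m n != 0 by rewrite subr_eq0.
have z2 m n : z - lat m n + h != 0 by rewrite addrAC subr_eq0.
have zE m n : z + h - lat m n = z - lat m n + h by rewrite addrAC.
have W m n : 0 < wgt R m n by exact: wgt_gt0.
have pb j k m n : (2 < j + k)%N -> modulus ((z - lat m n)^-1 ^+ j * (z - lat m n + h)^-1 ^+ k)
   <= A ^+ (j + k) * wgt R m n by exact: mod_powers_bound.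
have cP x : off x -> cseq (fun N => boxsum N (fun m n => (x - lat m n) ^- 2 - lat m n ^- 2)) (P x).
  move=> xo e e0; have [N0 H0] := HP x xo e e0; exists N0 => N /H0.
  by rewrite wp_partial_boxsum.
split=> //.
- rewrite (_ : C * _ = 9 * (modulus h ^+ 2 * (24 * (A ^+ 4 + A ^+ 5)))); last by rewrite /C; ring.
  apply: (box_taylor_bound (cP _ zoff) (cP _ zh) (HP1 _ zoff)) => m n.
  have -> : (z + h - lat m n) ^- 2 - lat m n ^- 2 - ((z - lat m n) ^- 2 - lat m n ^- 2)
    - h * termP1 w1 w2 z m n =
    (z - lat m n + h) ^- 2 - (z - lat m n) ^- 2 - h * (-2 * (z - lat m n)^-1 ^+ 3).
    by rewrite zE /termP1; ring.
  rewrite inv2_taylor // modM modX -mulrA ler_wpM2l //.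
  apply: (le_trans (modD _ _)).
  have b1 := mod_scaled_bound (mod_nat R 2) (pb 3 1 m n isT).
  have b2 := pb 2 2 m n isT.
  have := W m n; move: b1 b2; rewrite /addn /=; nra.
- rewrite (_ : C * _ = 9 * (modulus h ^+ 2 * (24 * (A ^+ 4 + A ^+ 5)))); last by rewrite /C; ring.
  apply: (box_taylor_bound (HP1 _ zoff) (HP1 _ zh) (HP2 _ zoff)) => m n.
  rewrite /termP1 /termP2 zE inv3_taylor // modM modX -mulrA ler_wpM2l //.
  apply: (le_trans (modD _ _)); apply: (le_trans (lerD (modD _ _) (lexx _))).
  have b1 := mod_scaled_bound (mod_Nnat R 2) (pb 2 3 m n isT).
  have b2 := mod_scaled_bound (mod_Nnat R 4) (pb 3 2 m n isT).
  have b3 := mod_scaled_bound (mod_Nnat R 6) (pb 4 1 m n isT).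
  have := W m n; move: b1 b2 b3; rewrite /addn /=; nra.
- rewrite (_ : C * _ = 9 * (modulus h * (24 * (A ^+ 4 + A ^+ 5)))); last by rewrite /C; ring.
  apply: (@box_diff_bound _ _ _ _ h _ (HP2 _ zoff) (HP2 _ zh)) => m n.
  rewrite /termP2 zE inv4_taylor // modM -mulrA ler_wpM2l //.
  apply: (le_trans (modD _ _)); apply: (le_trans (lerD (modD _ _) (modD _ _))).
  have b1 := mod_scaled_bound (mod_Nnat R 6) (pb 4 1 m n isT).
  have b2 := mod_scaled_bound (mod_Nnat R 6) (pb 3 2 m n isT).
  have b3 := mod_scaled_bound (mod_Nnat R 6) (pb 2 3 m n isT).
  have b4 := mod_scaled_bound (mod_Nnat R 6) (pb 1 4 m n isT).
  have := W m n; move: b1 b2 b3 b4; rewrite /addn /=; nra.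
Qed.

End WeierstrassLocal.

Lemma cseq_bound_ev (R : realType) (u : nat -> Cplx R) l (C : R) N0 : cseq u l ->
  (forall N, (N0 <= N)%N -> modulus (u N) <= C) -> modulus l <= C.
Proof.
move=> ul H; apply/ler_addgt0Pr => e /ul[N ue].
have -> : l = u (maxn N N0) - (u (maxn N N0) - l) by rewrite opprB addrC subrK.
by apply: (le_trans (modB _ _)); apply: lerD; rewrite ?H ?ue // (leq_maxl, leq_maxr).
Qed.

Lemma cseq_cst (R : realType) (l : Cplx R) : cseq (fun=> l) l.
Proof. by move=> e e0; exists 0%N => n _; rewrite subrr mod0 ltW. Qed.

(** * Behaviour at the lattice points *)

Section WeierstrassPoles.
Variables (R : realType) (w1 w2 : Cplx R).
Hypothesis w12 : complex.Im (w2 / w1) != 0.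
Implicit Types (z h : Cplx R) (m n : int).
Local Notation lat := (lattice_pt w1 w2).
Local Notation off := (off_lattice w1 w2).

Lemma lattice_pt00 : lat 0 0 = 0.
Proof. by rewrite /lattice_pt !mul0r addr0. Qed.

Lemma lattice_inj m n m' n' : ~~ ((m == m') && (n == n')) -> lat m' n' != lat m n.
Proof.
move=> mn; have [c c0 H] := lattice_lower w12.
have : 0 < (maxn (absz (m' - m)) (absz (n' - n)))%:R :> R.
  by rewrite ltr0n; move: mn; rewrite negb_and => /orP[] /eqP; lia.
move=> M0; have := lt_le_trans (mulr_gt0 c0 M0) (H (m' - m) (n' - n)).
apply: contraTneq => E.
have -> : lat (m' - m) (n' - n) = lat m' n' - lat m n.
  by rewrite /lattice_pt !intrB; ring.
by rewrite E subrr mod0 ltxx.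
Qed.

Lemma near_lattice_off m0 n0 : exists2 r : R, 0 < r &
  forall h, h != 0 -> modulus h < r -> off (lat m0 n0 + h).
Proof.
have [c c0 H] := lattice_gap_near w12 (S := fun m n => ~~ ((m == m0) && (n == n0)))
  (fun m n => @lattice_inj m n m0 n0).
exists c => // h h0 hc m n.
have [/andP[/eqP-> /eqP->]|mn] := boolP ((m == m0) && (n == n0)).
  by rewrite -subr_eq0 addrAC subrr add0r.
by have [] := H h m n hc mn.
Qed.

Lemma lattice_inv_bound : exists2 A : R, 0 < A &
  forall m n, modulus (lat m n)^-1 <= A / (msz m n)%:R.
Proof.
have [|c c0 H] := lattice_gap_near (z := 0) w12 (S := fun m n => ~~ ((m == 0) && (n == 0))).
  by move=> m n mn; rewrite -lattice_pt00 lattice_inj.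
exists c^-1; first by rewrite invr_gt0.
move=> m n.
have [/andP[/eqP-> /eqP->]|mn] := boolP ((m == 0) && (n == 0)).
  by rewrite lattice_pt00 invr0 mod0 divr_ge0 // invr_ge0 ltW.
have [] := H 0 m n _ mn; rewrite ?mod0 // addr0 sub0r => h _.
by rewrite -modN -invrN.
Qed.

(** The term of the pole itself contributes [h ^- 2 - z ^- 2]; all other terms stay bounded near it
    and decay like the third power of the size. *)
Lemma weierstrass_pole (P : Cplx R -> Cplx R) m0 n0 :
  (forall z, off z -> cseq (wp_partial w1 w2 z) (P z)) ->
  exists r C : R, 0 < r /\ forall h, h != 0 -> modulus h < r ->
     modulus (P (lat m0 n0 + h) - h ^- 2) <= C.
Proof.
move=> HP; set z := lat m0 n0.
have [c c0 H] := lattice_gap_near w12 (S := fun m n => ~~ ((m == m0) && (n == n0)))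
  (fun m n => @lattice_inj m n m0 n0).
have [r r0 Hr] := near_lattice_off m0 n0.
have [A0 A00 HA0] := lattice_inv_bound.
pose A := c^-1 + A0.
have cV : 0 < c^-1 by rewrite invr_gt0.
have A_ge0 : 0 < A by rewrite addr_gt0.
pose C1 := (modulus z + c) * (2 * A ^+ 3) + A ^+ 2.
have C10 : 0 <= (modulus z + c) * (2 * A ^+ 3).
  by rewrite mulr_ge0 ?addr_ge0 ?mod_ge0 ?mulr_ge0 ?exprn_ge0 // ltW.
exists (Num.min c r), (9 * C1 + modulus (z ^- 2)).
split=> [|h h0]; first by rewrite lt_min c0.
rewrite lt_min => /andP[hc hr].
have /HP zh := Hr h h0 hr.
have := cseqD zh (cseq_cst (- h ^- 2)).
move=> HC; apply: (cseq_bound_ev (N0 := maxn (absz m0) (absz n0)) HC) => N.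
rewrite geq_max => /andP[mN nN].
rewrite wp_partial_boxsum (boxsum_extract _ mN nN).
rewrite -/z [z + h]addrC addrK.
set phi := (fun m n => if _ then _ else _).
have -> : h ^- 2 - z ^- 2 + boxsum N phi + - h ^- 2 = boxsum N phi - z ^- 2 by ring.
apply: (le_trans (modB _ _)); rewrite lerD2r; apply: boxsum_bound => m n.
rewrite /phi; have W := wgt_gt0 R m n.
have C1_0 : 0 <= C1 by rewrite addr_ge0 // exprn_ge0 // ltW.
case: ifPn => mn; first by rewrite mod0 mulr_ge0 // ltW.
have [] := H h m n hc mn; rewrite -/z [z + h]addrC => ha hz.
have Mgt0 : 0 < (msz m n)%:R :> R by rewrite ltr0n.
have Ha : modulus (h + z - lat m n)^-1 <= A / (msz m n)%:R.
  by apply: (le_trans ha); rewrite ler_pM2r ?invr_gt0 // lerDl ltW.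
have Hb : modulus (lat m n)^-1 <= A / (msz m n)%:R.
  by apply: (le_trans (HA0 m n)); rewrite ler_pM2r ?invr_gt0 // lerDr ltW.
(* At a pole other than the origin the index (0, 0) is still present. Its subtracted part is 0 by
   convention and it has no cubic decay, but it is a single term of weight 1. *)
have [/andP[/eqP m_ /eqP n_]|mn0] := boolP ((m == 0) && (n == 0)).
  move: Ha; rewrite m_ n_ lattice_pt00 expr0n /= invr0 !subr0 /wgt /msz /= expr1n !invr1 !mulr1.
  move=> Ha; rewrite -exprVn modX.
  apply: (@le_trans _ _ (A ^+ 2)); last by rewrite lerDr.
  by rewrite lerXn2r // nnegrE ?mod_ge0 // ltW.
have l0 : lat m n != 0 by rewrite eq_sym -lattice_pt00 lattice_inj.
have hzl : h + z - lat m n != 0 by rewrite subr_eq0.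
set a := (h + z - lat m n)^-1 in Ha; set b := (lat m n)^-1 in Hb.
(* The difference of two inverse squares gains one order: the factor h + z stays bounded and the
   inverses have total degree 3. *)
have -> : (h + z - lat m n) ^- 2 - lat m n ^- 2 =
  (h + z) * (a ^+ 2 * b ^+ 1 + - 1%:R * (a ^+ 1 * b ^+ 2)).
  by rewrite /a /b; field; rewrite l0 hzl.
have b1 := mod_powers_bound (j := 2) (k := 1) Ha Hb isT.
have b2 := mod_scaled_bound (mod_Nnat R 1) (mod_powers_bound (j := 1) (k := 2) Ha Hb isT).
apply: (@le_trans _ _ ((modulus z + c) * (2 * A ^+ 3) * wgt R m n)); last first.
  by rewrite ler_pM2r // lerDl exprn_ge0 // ltW.
rewrite modM -mulrA; apply: ler_pM; rewrite ?mod_ge0 //.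
  by rewrite addrC (le_trans (modD _ _)) // lerD2l ltW.
apply: (le_trans (modD _ _)); move: b1 b2; rewrite /addn /= mul1r; lra.
Qed.

(** The derivative is needed at the pole 0 only, where it gives the direction in which the descent
    along the imaginary axis starts. *)
Lemma weierstrass_pole1 (P1 : Cplx R -> Cplx R) :
  (forall z, off z -> cseq (fun N => boxsum N (termP1 w1 w2 z)) (P1 z)) ->
  exists r C : R, 0 < r /\ forall h, h != 0 -> modulus h < r ->
     modulus (P1 h + 2 * h^-1 ^+ 3) <= C.
Proof.
move=> HP.
have [c c0 H] := lattice_gap_near w12 (S := fun m n => ~~ ((m == 0) && (n == 0)))
  (fun m n => @lattice_inj m n 0 0).
have [r r0 Hr] := near_lattice_off 0 0.
have c3 : 0 <= c^-1 ^+ 3 by rewrite exprn_ge0 // invr_ge0 ltW.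
exists (Num.min c r), (9 * (2 * c^-1 ^+ 3)).
split=> [|h h0]; first by rewrite lt_min c0.
rewrite lt_min => /andP[hc hr].
have := Hr h h0 hr; rewrite lattice_pt00 add0r => /HP zh.
have := cseqD zh (cseq_cst (2 * h^-1 ^+ 3)).
move=> HC; apply: (cseq_bound HC) => N.
rewrite (boxsum_extract (m0 := 0) (n0 := 0) (termP1 w1 w2 h)) // {1}/termP1 lattice_pt00 subr0.
rewrite mulNr addrAC addNr add0r; apply: boxsum_bound => m n.
have W := wgt_gt0 R m n.
case: ifPn => mn; first by rewrite mod0 mulr_ge0 ?(ltW W) // mulr_ge0.
have [] := H h m n hc mn; rewrite lattice_pt00 add0r => ha hz.
rewrite -mulrA; apply: mod_scaled_bound; first exact: mod_Nnat.
by rewrite -[_ ^+ 3]mulr1; exact: (mod_powers_bound (j := 3) (k := 0) ha ha).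
Qed.

End WeierstrassPoles.

(* P1 and P2 are the first two derivatives of P, and off is the complement of
   the period lattice. *)
Record wp_data (R : realType) (g2 g3 : R) (P P1 P2 : Cplx R -> Cplx R)
    (off : Cplx R -> Prop) : Prop := WpData {
  wp_regular : forall z, off z -> exists r C : R, 0 < r /\
    forall h, modulus h < r ->
     [/\ off (z + h),
      modulus (P (z + h) - P z - h * P1 z) <= C * modulus h ^+ 2,
      modulus (P1 (z + h) - P1 z - h * P2 z) <= C * modulus h ^+ 2 &
      modulus (P2 (z + h) - P2 z) <= C * modulus h];
  wp_eqn : forall z, off z ->
    P1 z ^+ 2 = 4 * P z ^+ 3 - toC g2 * P z - toC g3;
  wp_pole : forall z, ~ off z -> exists r C : R, 0 < r /\
    forall h, h != 0 -> modulus h < r ->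
      off (z + h) /\ modulus (P (z + h) - h ^- 2) <= C;
  wp_pole0 : ~ off 0;
  wp_pole1 : exists r C : R, 0 < r /\ forall h, h != 0 -> modulus h < r ->
     modulus (P1 h + 2 * h^-1 ^+ 3) <= C }.

Section WpData.
Variable R : realType.

Lemma cvg_cseq (u : nat -> Cplx R) (l : Cplx R) : u @ \oo --> l -> cseq u l.
Proof.
move=> /cvgrPdist_le H e e0.
have e0' : 0 < toC e by rewrite ltcR.
have [N _ HN] := H _ e0'; exists N => n /HN /=.
by rewrite mod_norm lecR modBC.
Qed.

(** Identifies the sum [P1] with the complex derivative in which the differential equation of
    [weierstrass_p] is stated. *)
Lemma derive1_Cplx (P : Cplx R -> Cplx R) (z l : Cplx R) (r C : R) : 0 < r ->
  (forall h, modulus h < r ->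
     modulus (P (z + h) - P z - h * l) <= C * modulus h ^+ 2) ->
  derive1 (P : Cplx R -> (Cplx R)^o) z = l.
Proof.
move=> r0 H; rewrite derive1E; apply: cvg_lim => //.
apply/cvgrPdist_le => e e0.
have eR : e = toC (complex.Re e).
  by apply: cplxP => //; rewrite cImC (ger0_Im (ltW e0)).
rewrite eR in e0 *; move: (complex.Re e) e0 => {eR}e; rewrite ltcR => e0.
pose d := Num.min r (e / (`|C| + 1)).
have C1 : 0 < `|C| + 1 by rewrite ltr_pwDr.
have d0 : 0 < d by rewrite lt_min r0 divr_gt0.
rewrite near_withinE; apply/nbhs_ballP; exists (toC d) => /=; first by rewrite ltcR.
move=> h; rewrite /ball /= sub0r normrN mod_norm ltcR lt_min => /andP[hr he] h0.
rewrite mod_norm lecR.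
rewrite /GRing.scale /= mulr1 [h + z]addrC.
have mh := mod_gt0 h0.
have -> : l - h^-1 * (P (z + h) - P z) = - (h^-1 * (P (z + h) - P z - h * l)).
  by field.
rewrite modN modM modV mulrC ler_pdivrMr //; apply: (le_trans (H h hr)).
rewrite expr2 mulrA ler_pM2r //.
rewrite ltr_pdivlMr // in he; apply: ltW; apply: le_lt_trans he.
rewrite mulrC ler_pM2l // (le_trans (ler_norm _)) // lerDl //.
Qed.

(** [P1] and [P2] are limits of the differentiated series, chosen pointwise; at lattice points their
    values are arbitrary. *)
Lemma weierstrass_p_data (g2 g3 : R) (P : Cplx R -> Cplx R) :
  weierstrass_p (toC g2) (toC g3) P ->
  exists P1 P2 off, wp_data g2 g3 P P1 P2 off.
Proof.
move=> [w1 [w2 [w12 HP]]]; pose off := off_lattice w1 w2.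
have cP z : off z -> cseq (wp_partial w1 w2 z) (P z).
  by move=> /HP[/cvg_cseq].
have /choice[P1 HP1] : forall z, exists l, off z -> cseq (fun N => boxsum N (termP1 w1 w2 z)) l.
  move=> z; have [/(termP1_cvg w12)[l]|] := pselect (off z); first by exists l.
  by exists 0.
have /choice[P2 HP2] : forall z, exists l, off z -> cseq (fun N => boxsum N (termP2 w1 w2 z)) l.
  move=> z; have [/(termP2_cvg w12)[l]|] := pselect (off z); first by exists l.
  by exists 0.
exists P1, P2, off; have reg := weierstrass_regular w12 cP HP1 HP2.
split=> //.
- move=> z zo; have [_ _ <-] := HP z zo; congr (_ ^+ 2).
  have [r [C [r0 H]]] := reg z zo.
  by symmetry; apply: (@derive1_Cplx _ _ _ r C r0) => h /H[].
- move=> z; rewrite /off /off_lattice => /existsNP[m /existsNP[n /negP]].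
  rewrite negbK => /eqP ->.
  have [r r0 Hr] := near_lattice_off w12 m n.
  have [r' [C [r'0 H]]] := weierstrass_pole w12 m n cP.
  exists (Num.min r r'), C; split; first by rewrite lt_min r0.
  by move=> h h0; rewrite lt_min => /andP[/(Hr _ h0) ho /(H _ h0)].
- by move=> /(_ 0 0); rewrite lattice_pt00 eqxx.
- exact: (@weierstrass_pole1 R w1 w2 w12 P1 HP1).
Qed.

End WpData.

(** * Real second order equations along lines *)

Section RealInduction.
Variable R : realType.
Implicit Types (Q : R -> Prop) (a b s t : R).

(** The point is the infimum of the failures. Whether [Q] fails there is left open: each use decides
    this by continuity or by openness. *)
Lemma first_failure Q a : (exists2 t, a < t & ~ Q t) ->
  (exists2 d, 0 < d & forall t, a < t < a + d -> Q t) ->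
  exists2 s, a < s & (forall t, a < t < s -> Q t) /\
    (forall d, 0 < d -> exists2 t, s <= t < s + d & ~ Q t).
Proof.
move=> [t0 at0 nQ] [d d0 Qd].
pose Z := [set t | a < t /\ ~ Q t].
have Z0 : Z !=set0 by exists t0.
have lbZ : lbound Z (a + d).
  move=> t [at_ nQt]; rewrite leNgt; apply/negP => td; apply: nQt; apply: Qd.
  by rewrite at_.
have hi : has_inf Z by split => //; exists (a + d).
exists (inf Z).
  by apply: (lt_le_trans (y := a + d)); [rewrite ltrDl|apply: lb_le_inf].
split.
  move=> t /andP[at_ tZ]; apply: contrapT => nQt.
  have : inf Z <= t by apply: ge_inf; [exists (a + d)|split].
  by rewrite leNgt tZ.
move=> e e0; have [t [at_ nQt] te] := inf_adherent e0 hi.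
exists t => //; rewrite te andbT; apply: ge_inf; last by split.
by exists (a + d).
Qed.

(** Connectedness of a half-open interval. The hypothesis yields [Q] at [s] as well as to the right
    of it, so a single step covers both the closed and the open part of the argument. *)
Lemma real_induction Q a b :
  (forall s, a <= s < b -> (forall t, a <= t < s -> Q t) ->
     exists2 d, 0 < d & forall t, s <= t < s + d -> t < b -> Q t) ->
  forall t, a <= t < b -> Q t.
Proof.
move=> H t0 /andP[at0 t0b]; apply: contrapT => nQ.
have ab : a < b by exact: le_lt_trans t0b.
pose Q' t := a <= t < b -> Q t.
have nQ' : ~ Q' t0 by move=> /(_ _)/nQ; apply; rewrite at0.
(* [Q'] holds vacuously to the left of [a], which supplies the initial interval that [first_failure]
   asks for. *)
have [||s as_ [Hs Hn]] := @first_failure Q' (a - 1).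
- by exists t0 => //; lra.
- by exists 1 => // t /andP[h1 h2] /andP[h3 h4]; lra.
have [sa|sa] := ltP s a.
  have /Hn[t /andP[h1 h2]] : 0 < a - s by rewrite subr_gt0.
  by apply => /andP[h3 h4]; lra.
have st0 : s <= t0.
  by rewrite leNgt; apply/negP => t0s; apply: nQ'; apply: Hs; rewrite t0s; lra.
have [||d d0 Hd] := H s; first by rewrite sa (le_lt_trans st0).
  by move=> t /andP[h1 h2]; apply: (Hs t) => //; rewrite ?h1 ?h2 ?andbT /=; lra.
have [t /andP[h1 h2]] := Hn d d0; apply => /andP[h3 h4].
by apply: Hd => //; rewrite h1.
Qed.

End RealInduction.

Section SecondOrderUniqueness.
Variable R : realType.
Implicit Types (p q : R -> Cplx R) (a b s t : R).

Lemma cder_zero_left p s l a : cder p s l -> a < s ->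
  (forall t, a <= t < s -> p t = 0) -> p s = 0.
Proof.
move=> /cder_cont H as_ p0; apply/mod_eq0/eqP; rewrite eq_le mod_ge0 andbT.
apply/ler_addgt0Pr => e /H[d d0 Hd]; rewrite add0r.
pose t := Num.max a (s - d / 2).
have ts : t < s by rewrite gt_max as_ /=; lra.
have at_ : a <= t by rewrite le_max lexx.
have sdt : s - d / 2 <= t by rewrite le_max lexx orbT.
have := Hd t; rewrite p0 ?at_ // sub0r modN => H'; apply/ltW/H'.
by rewrite ltr_norml; lra.
Qed.

(** Gronwall for the squared distance of the pairs (p, p1) and (q, q1), propagated by
    [real_induction]. The right-hand sides differ by 6 sg (p + q)(p - q), so a local bound of p + q
    is all that is needed. The sign [sg] is the square of the direction of the line: -1 on vertical,
    1 on horizontal lines. *)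
Lemma ode2_unique p p1 q q1 (sg k : Cplx R) a b :
  (forall s, a <= s < b -> cder p s (p1 s) /\
     cder p1 s (sg * (6 * p s ^+ 2 - k))) ->
  (forall s, a <= s < b -> cder q s (q1 s) /\
     cder q1 s (sg * (6 * q s ^+ 2 - k))) ->
  p a = q a -> p1 a = q1 a ->
  forall s, a <= s < b -> p s = q s /\ p1 s = q1 s.
Proof.
move=> Hp Hq pqa pqa1; apply: real_induction => s sab Hs.
have [/Hp[dp dp1] /Hq[dq dq1]] : a <= s < b /\ a <= s < b by [].
have /andP[as_ sb] := sab.
have [d0 d10] : p s - q s = 0 /\ p1 s - q1 s = 0.
  move: as_; rewrite le_eqVlt => /predU1P[<-|as_].
    by rewrite pqa pqa1 !subrr.
  split.
    apply: (cder_zero_left (cderB dp dq) as_) => t /Hs[-> _]; exact: subrr.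
  apply: (cder_zero_left (cderB dp1 dq1) as_) => t /Hs[_ ->]; exact: subrr.
(* Continuity keeps p + q within distance 1 of its value at [s]. *)
pose B := modulus (p s + q s) + 1.
have [r r0 Hr] := cder_cont (cderD dp dq) ltr01.
pose d := Num.min r (b - s).
have dr : d <= r by rewrite ge_min lexx.
have db : d <= b - s by rewrite ge_min lexx orbT.
have d_gt0 : 0 < d by rewrite lt_min r0 subr_gt0.
have bnd t : s < t < s + d -> modulus (p t + q t) <= B.
  move=> st; have /Hr h : `|t - s| < r by rewrite ltr_norml; lra.
  rewrite -(subrK (p s + q s) (p t + q t)) (le_trans (modD _ _)) //.
  by rewrite addrC lerD2l ltW.
pose f t := modulus (p t - q t) ^+ 2 + modulus (p1 t - q1 t) ^+ 2.
pose f' t := 2 * (complex.Re (p t - q t) * complex.Re (p1 t - q1 t) +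
                  complex.Im (p t - q t) * complex.Im (p1 t - q1 t)) +
  2 * (complex.Re (p1 t - q1 t) * complex.Re (sg * (6 * p t ^+ 2 - k) - sg * (6 * q t ^+ 2 - k)) +
       complex.Im (p1 t - q1 t) * complex.Im (sg * (6 * p t ^+ 2 - k) - sg * (6 * q t ^+ 2 - k))).
have df t : a <= t < b -> is_derive t 1 f (f' t).
  move=> tab; have [tp tp1] := Hp t tab; have [tq tq1] := Hq t tab.
  have h1 := is_derive_mod2 (cderB tp tq).
  have h2 := is_derive_mod2 (cderB tp1 tq1).
  exact: is_deriveD.
have B0 : 0 <= B by rewrite addr_ge0 ?mod_ge0.
have sg0 := mod_ge0 sg.
have f0 : f s = 0 by rewrite /f d0 d10 mod0 expr0n addr0.
have H : forall t, s < t < s + d -> f t = 0.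
  apply: (@gronwall_vanish _ f f' s (s + d) (1 + 6 * modulus sg * B)).
  - by rewrite ltrDl.
  - by move=> t /andP[st td]; apply: df; rewrite (le_trans as_ (ltW st)); lra.
  - move=> t std; split; first by rewrite addr_ge0 // exprn_ge0 // mod_ge0.
    have Hb := bnd t std.
    have h1 := ReIm_mod_le (p t - q t) (p1 t - q1 t).
    have h2 := ReIm_mod_le (p1 t - q1 t) (sg * (6 * p t ^+ 2 - k) - sg * (6 * q t ^+ 2 - k)).
    have E : modulus (sg * (6 * p t ^+ 2 - k) - sg * (6 * q t ^+ 2 - k)) =
      6 * modulus sg * modulus (p t + q t) * modulus (p t - q t).
      rewrite -[6 in RHS]mod_nat -!modM; congr modulus; ring.
    rewrite E in h2; rewrite /f' /f; move: h1 h2.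
    set X := _ + _; set Y := _ + _.
    set x := modulus (p t - q t); set y := modulus (p1 t - q1 t) => h1 h2.
    have x0 : 0 <= x by exact: mod_ge0.
    have y0 : 0 <= y by exact: mod_ge0.
    have xy : 2 * (x * y) <= x ^+ 2 + y ^+ 2 by have := sqr_ge0 (x - y); nra.
    have h3 : y * (6 * modulus sg * modulus (p t + q t) * x) <= (6 * modulus sg * B) * (x * y).
      rewrite (_ : y * _ = (6 * modulus sg * x * y) * modulus (p t + q t)); last by ring.
      rewrite (_ : _ * B * _ = (6 * modulus sg * x * y) * B); last by ring.
      by apply: ler_wpM2l => //; rewrite !mulr_ge0.
    have c0 : 0 <= 6 * modulus sg * B by rewrite !mulr_ge0.
    have h4 : (6 * modulus sg * B) * (2 * (x * y)) <= (6 * modulus sg * B) * (x ^+ 2 + y ^+ 2).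
      by apply: ler_wpM2l.
    rewrite mulrDl mul1r; lra.
  - move=> e e0; have /continuous_eps/(_ e e0)[r' r'0 H] := is_derive_cont (df s sab).
    exists r' => // t /andP[st _] tr.
    have /H : `|t - s| < r' by rewrite ltr_norml; lra.
    by rewrite f0 subr0 => h; apply: ltW (le_lt_trans (ler_norm _) h).
exists d => // t /andP[]; rewrite le_eqVlt => /predU1P[<- _ _|st td tb].
  by split; apply/eqP; rewrite -subr_eq0; apply/eqP.
have /eqP : f t = 0 by apply: H; rewrite st td.
rewrite /f paddr_eq0 ?exprn_ge0 ?mod_ge0 // !sqrf_eq0 => /andP[/eqP/mod_eq0 h1 /eqP/mod_eq0 h2].
by split; apply/eqP; rewrite -subr_eq0; apply/eqP.
Qed.

End SecondOrderUniqueness.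

(** * The Weierstrass function along straight lines *)

Section WpCurves.
Variables (R : realType) (g2 g3 : R) (P P1 P2 : Cplx R -> Cplx R)
  (off : Cplx R -> Prop).
Hypothesis D : wp_data g2 g3 P P1 P2 off.
Implicit Types (z v h : Cplx R) (s t : R).

Lemma line_step z v s t : z + toC (s + t) * v = z + toC s * v + toC t * v.
Proof. by rewrite toCD mulrDl addrA. Qed.

Lemma line_small v (r : R) : 0 < r ->
  exists2 d : R, 0 < d & forall t, `|t| < d -> modulus (toC t * v) < r.
Proof.
move=> r0; have v1 : 0 < modulus v + 1 by rewrite ltr_pwDr // mod_ge0.
exists (r / (modulus v + 1)); first by rewrite divr_gt0.
move=> t; rewrite ltr_pdivlMr // modM mod_toC; apply: le_lt_trans.
by rewrite ler_wpM2l // lerDl.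
Qed.

Lemma off_line z v s : off (z + toC s * v) -> exists2 d : R, 0 < d &
  forall t, `|t - s| < d -> off (z + toC t * v).
Proof.
move=> /(wp_regular D)[r [C [r0 H]]].
have [d d0 Hd] := line_small v r0; exists d => // t /Hd/H[].
by rewrite -line_step (addrC s) subrK.
Qed.

Lemma cder_line (F F1 : Cplx R -> Cplx R) z v s (r C : R) : 0 < r ->
  (forall h, modulus h < r -> modulus (F (z + toC s * v + h) - F (z + toC s * v)
      - h * F1 (z + toC s * v)) <= C * modulus h ^+ 2) ->
  cder (fun t => F (z + toC t * v)) s (v * F1 (z + toC s * v)).
Proof.
move=> r0 H; have [d d0 Hd] := line_small v r0.
apply: (@cder_quadratic _ _ _ _ (C * modulus v ^+ 2) d) => // t /Hd/H H'.
rewrite line_step mulrA; apply: (le_trans H').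
by rewrite modM mod_toC le_eqVlt; apply/orP; left; apply/eqP; ring.
Qed.

Lemma cder_P z v s : off (z + toC s * v) ->
  cder (fun t => P (z + toC t * v)) s (v * P1 (z + toC s * v)).
Proof.
move=> /(wp_regular D)[r [C [r0 H]]].
by apply: (@cder_line P P1 z v s r C) => // h /H[].
Qed.

Lemma cder_P1 z v s : off (z + toC s * v) ->
  cder (fun t => P1 (z + toC t * v)) s (v * P2 (z + toC s * v)).
Proof.
move=> /(wp_regular D)[r [C [r0 H]]].
by apply: (@cder_line P1 P2 z v s r C) => // h /H[].
Qed.

(** Measures the failure of wp'' = 6 wp^2 - g2 / 2. *)
Definition defect z := P2 z - (6 * P z ^+ 2 - toC (g2 / 2)).

(** Differentiating the first order equation along a real direction gives 2 wp' times the defect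
    equal to 0. *)
Lemma defect_nonzero z : off z -> P1 z != 0 -> defect z = 0.
Proof.
move=> zo P10.
have zE : z + toC 0 * 1 = z by rewrite toC0 mul0r addr0.
have zo' : off (z + toC 0 * 1) by rewrite zE.
have c := cder_P zo'; have c1 := cder_P1 zo'; rewrite !mul1r in c c1.
have [d d0 Hd] := off_line zo'.
have L := cderM c1 c1.
have L' := cderB (cderB (cderZ 4 (cderM c (cderM c c))) (cderZ (toC g2) c)) (cder_cst (toC g3) 0).
pose p t := P (z + toC t * 1).
have Heq t : `|t - 0| < d -> 4 * (p t * (p t * p t)) - toC g2 * p t - toC g3 =
    P1 (z + toC t * 1) * P1 (z + toC t * 1).
  by move=> /Hd/(wp_eqn D); rewrite expr2 => ->; rewrite /p; ring.
have L2 := cder_near d0 Heq L'.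
have := cder_unique L L2; rewrite zE subr0 => H.
have H2 : 2 * P1 z * defect z = 0.
  have -> : 2 * P1 z * defect z =
      (P1 z * P2 z + P2 z * P1 z) - P1 z * (12 * P z ^+ 2 - toC g2).
    by rewrite /defect toCM toCV toC_nat; field.
  by rewrite H; ring.
move/eqP: H2; rewrite !mulf_eq0 (negbTE P10) orbF => /orP[|/eqP //].
by rewrite pnatr_eq0.
Qed.

Lemma defect_cont z : off z -> forall e : R, 0 < e -> exists2 d : R, 0 < d &
  forall h, modulus h < d -> modulus (defect (z + h) - defect z) <= e.
Proof.
move=> /(wp_regular D)[r [C [r0 H]]] e e0.
pose M := modulus (P z); pose K := `|C| + modulus (P1 z).
have K0 : 0 <= K by rewrite addr_ge0 ?mod_ge0.
have M0 : 0 <= M by exact: mod_ge0.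
pose L := `|C| + 6 * K * (K + 2 * M) + 1.
have L0 : 0 < L by rewrite ltr_pwDr // addr_ge0 // !mulr_ge0 // addr_ge0 // mulr_ge0.
exists (Num.min (Num.min r 1) (e / L)); first by rewrite !lt_min r0 ltr01 divr_gt0.
move=> h; rewrite !lt_min => /andP[/andP[hr h1] he].
have [_ hP _ hP2] := H h hr.
have h0 := mod_ge0 h.
have C0 : C <= `|C| by exact: ler_norm.
have dP : modulus (P (z + h) - P z) <= K * modulus h.
  rewrite -(subrK (h * P1 z) (P (z + h) - P z)); apply: (le_trans (modD _ _)).
  rewrite modM mulrDl [_ * modulus (P1 z)]mulrC; apply: lerD => //.
  apply: (le_trans hP); rewrite expr2 mulrA; apply: ler_wpM2r => //.
  apply: (@le_trans _ _ (`|C| * modulus h)); first exact: ler_wpM2r.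
  by rewrite ler_piMr // ltW.
have sP : modulus (P (z + h) + P z) <= K + 2 * M.
  have -> : P (z + h) + P z = P (z + h) - P z + 2 * P z by ring.
  apply: (le_trans (modD _ _)); rewrite modM mod_nat lerD2r.
  by apply: (le_trans dP); rewrite ler_piMr // ltW.
have -> : defect (z + h) - defect z =
  (P2 (z + h) - P2 z) - 6 * ((P (z + h) - P z) * (P (z + h) + P z)).
  by rewrite /defect; ring.
apply: (le_trans (modB _ _)); rewrite !modM mod_nat.
have h3 : modulus (P (z + h) - P z) * modulus (P (z + h) + P z) <= K * modulus h * (K + 2 * M).
  by apply: ler_pM; rewrite ?mod_ge0.
have h4 : C * modulus h <= `|C| * modulus h by exact: ler_wpM2r.
rewrite ltr_pdivlMr // /L in he; nra.
Qed.

Lemma defect_closed z : off z ->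
  (forall d : R, 0 < d -> exists2 h, modulus h < d & defect (z + h) = 0) ->
  defect z = 0.
Proof.
move=> zo H; apply/mod_eq0/eqP; rewrite eq_le mod_ge0 andbT.
apply/ler_addgt0Pr => e /(defect_cont zo)[d d0 Hd]; rewrite add0r.
by have [h /Hd hd E] := H d d0; rewrite E sub0r modN in hd.
Qed.

End WpCurves.

Section CubicRoots.
Variables (R : realType) (g2 g3 e1 e2 e3 : R).
Hypothesis Hc : forall t, wcubic g2 g3 t = 4 * (t - e1) * (t - e2) * (t - e3).

(** The leading coefficients agree, so the values at 0, 1 and -1 determine the other
    coefficients. *)
Lemma cubic_coefs : [/\ e1 + e2 + e3 = 0, g2 = -4 * (e1 * e2 + e1 * e3 + e2 * e3)
  & g3 = 4 * e1 * e2 * e3].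
Proof.
have h0 := Hc 0; have h1 := Hc 1; have h2 := Hc (-1); rewrite /wcubic in h0 h1 h2.
have s0 : e1 + e2 + e3 = 0 by lra.
by split => //; lra.
Qed.

Lemma cubic_C (z : Cplx R) : 4 * z ^+ 3 - toC g2 * z - toC g3 =
  4 * (z - toC e1) * (z - toC e2) * (z - toC e3).
Proof.
have [s0 -> ->] := cubic_coefs.
have -> : e1 = - (e2 + e3) by lra.
have E4 : toC 4 = 4 :> Cplx R := toC_nat R 4.
by rewrite !(E4, toCM, toCN) !toCD; ring.
Qed.

Lemma wcubic_deriv t : 6 * t ^+ 2 - g2 / 2 =
  2 * ((t - e1) * (t - e2) + (t - e1) * (t - e3) + (t - e2) * (t - e3)).
Proof.
have [s0 -> _] := cubic_coefs.
have -> : e1 = - (e2 + e3) by lra.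
by field.
Qed.

End CubicRoots.

(** * Propagation of the second order equation *)

Section Propagation.
Variables (R : realType) (g2 g3 e1 e2 e3 : R) (P P1 P2 : Cplx R -> Cplx R)
  (off : Cplx R -> Prop).
Hypothesis D : wp_data g2 g3 P P1 P2 off.
Hypothesis Hc : forall t, wcubic g2 g3 t = 4 * (t - e1) * (t - e2) * (t - e3).
Hypothesis (e32 : e3 < e2) (e21 : e2 < e1).
Implicit Types (z v h : Cplx R) (s t : R).
Local Notation defect := (defect g2 P P2).

Lemma P1_zero z : off z -> P1 z = 0 ->
  [\/ P z = toC e1, P z = toC e2 | P z = toC e3].
Proof.
move=> /(wp_eqn D) H P10; move: H; rewrite P10 expr0n /= (cubic_C Hc) => /esym/eqP.
rewrite !mulf_eq0 pnatr_eq0 !subr_eq0 /=.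
by move=> /orP[/orP[/eqP->|/eqP->]|/eqP->]; [apply: Or31|apply: Or32|apply: Or33].
Qed.

(** When the defect vanishes, wp'' is half the derivative of the cubic at wp, and wp is a root since
    wp' = 0; simple roots make it nonzero. *)
Lemma P2_nonzero z : off z -> P1 z = 0 -> defect z = 0 -> P2 z != 0.
Proof.
move=> zo P10 /eqP; rewrite subr_eq0 => /eqP ->.
have K (e : R) : 6 * toC e ^+ 2 - toC (g2 / 2) = toC (6 * e ^+ 2 - g2 / 2).
  by rewrite toCB [toC (6 * _)]toCM toCX (toC_nat R 6).
have N (x : R) : x != 0 -> toC x != 0 by apply: contra_neq => /toCI.
have e31 := lt_trans e32 e21.
have h1 : 0 < (e1 - e2) * (e1 - e3) by rewrite mulr_gt0 ?subr_gt0.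
have h2 : 0 < (e1 - e2) * (e2 - e3) by rewrite mulr_gt0 ?subr_gt0.
have h3 : 0 < (e1 - e3) * (e2 - e3) by rewrite mulr_gt0 ?subr_gt0.
by have [] := P1_zero zo P10 => ->; rewrite K; apply: N; rewrite (wcubic_deriv Hc);
  [apply/lt0r_neq0; lra|apply/ltr0_neq0; lra|apply/lt0r_neq0; lra].
Qed.

(** If wp' is nonzero at [z] it stays so nearby. Otherwise wp'' is nonzero at [z], so [z] is an
    isolated zero of wp'. In both cases [defect_nonzero] applies at all nearby points other than
    [z]. *)
Lemma defect_open z : off z -> defect z = 0 -> exists2 d : R, 0 < d &
  forall h, modulus h < d -> off (z + h) /\ defect (z + h) = 0.
Proof.
move=> zo dz; have [r [C [r0 H]]] := wp_regular D zo.
have [P10|P10] := eqVneq (P1 z) 0.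
  have := P2_nonzero zo P10 dz => /mod_gt0 p2.
  have c0 : 0 < `|C| + 1 by rewrite ltr_pwDr.
  exists (Num.min r (modulus (P2 z) / (`|C| + 1))); first by rewrite lt_min r0 divr_gt0.
  move=> h; rewrite lt_min => /andP[/H[zho _ hP1 _] hC]; split=> //.
  have [->|h0] := eqVneq h 0; first by rewrite addr0.
  apply: (defect_nonzero D) => //; apply/eqP => E.
  move: hP1; rewrite E P10 subr0 sub0r modN modM => hP1.
  have mh := mod_gt0 h0.
  have : modulus (P2 z) <= C * modulus h.
    by rewrite -(ler_pM2l mh) (le_trans hP1) // expr2 mulrCA.
  rewrite ltr_pdivlMr // in hC; have := ler_norm C; nra.
have p1 := mod_gt0 P10.
pose K := modulus (P2 z) + `|C| + 1.
have K0 : 0 < K by rewrite ltr_pwDr // addr_ge0 ?mod_ge0.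
exists (Num.min (Num.min r 1) (modulus (P1 z) / K)).
  by rewrite !lt_min r0 ltr01 divr_gt0.
move=> h; rewrite !lt_min => /andP[/andP[/H[zho _ hP1 _] h1] hK]; split=> //.
apply: (defect_nonzero D) => //; apply/eqP => E.
have : modulus (P1 z) <= modulus h * modulus (P2 z) + C * modulus h ^+ 2.
  have -> : P1 z = - (P1 (z + h) - P1 z - h * P2 z) - h * P2 z.
    by rewrite E; ring.
  by rewrite -opprD modN (le_trans (modD _ _)) // modM addrC lerD2l.
rewrite ltr_pdivlMr // /K in hK.
have mh := mod_ge0 h.
have : C * modulus h ^+ 2 <= `|C| * modulus h.
  apply: (@le_trans _ _ (`|C| * modulus h ^+ 2)).
    by rewrite ler_wpM2r ?exprn_ge0 // ler_norm.
  by rewrite ler_wpM2l // expr2 ler_piMr // ltW.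
lra.
Qed.

(** Carries the equation across zeros of wp', where the first order equation gives no
    information. *)
Lemma defect_line z v a b : (forall t, a <= t < b -> off (z + toC t * v)) ->
  defect (z + toC a * v) = 0 ->
  forall t, a <= t < b -> defect (z + toC t * v) = 0.
Proof.
move=> Ho d0; apply: real_induction => s sab Hs.
have so := Ho s sab.
have ds : defect (z + toC s * v) = 0.
  have /andP[] := sab; rewrite le_eqVlt => /predU1P[<- //|as_ sb].
  apply: (defect_closed D so) => d /(line_small v)[r r0 Hr].
  pose t := Num.max a (s - r / 2).
  have ts : t < s by rewrite gt_max as_ /=; lra.
  have at_ : a <= t by rewrite le_max lexx.
  have sdt : s - r / 2 <= t by rewrite le_max lexx orbT.
  exists (toC (t - s) * v); first by apply: Hr; rewrite ltr_norml; lra.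
  by rewrite -line_step (addrC s) subrK Hs // at_.
have [d dd0 Hd] := defect_open so ds.
have [r r0 Hr] := line_small v dd0.
exists r => // t /andP[st tr] tb.
have /Hr/Hd[_] : `|t - s| < r by rewrite ltr_norml; lra.
by rewrite -line_step (addrC s) subrK.
Qed.

End Propagation.

Section SingularBound.
Variable R : realType.

(* Linearization of p'^2 = -(4p^3 - g2 p - g3) at the real part of a solution
   p = x + i y with p ~ - r^2, r = 1/s: the imaginary part satisfies
   y' = - (3/s + O(s)) y, so that s^3 y is constant up to a bounded factor. *)
Lemma singular_bound (r x y x1 y1 g2 C : R) : 1 <= r -> C <= r ->
  `|x + r ^+ 2| <= C -> `|y| <= C -> `|x1 - 2 * r ^+ 3| <= C ->
  2 * x1 * y1 = - (4 * (3 * x ^+ 2 * y - y ^+ 3) - g2 * y) ->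
  3 * r * y ^+ 2 + y * y1 <= (30 * C + 4 * C ^+ 2 + `|g2|) * y ^+ 2.
Proof.
move=> r1 Cr hx hy hx1 E.
have C0 : 0 <= C by apply: le_trans hy.
have r2 : 1 <= r ^+ 2 by rewrite expr_ge1 //; lra.
have rr3 : r <= r ^+ 3 by rewrite ler_eXnr.
have x1r : r ^+ 3 <= x1 by move: hx1; rewrite ler_norml; lra.
have r23 : r ^+ 2 <= r ^+ 3 by rewrite ler_weXn2l.
have r3 : 1 <= r ^+ 3 by lra.
pose K := 30 * C + 4 * C ^+ 2 + `|g2|.
have K0 : 0 <= K by rewrite !addr_ge0 ?mulr_ge0 ?exprn_ge0.
have N : 6 * x1 * r - 12 * x ^+ 2 + 4 * y ^+ 2 + g2 <= K * r ^+ 2.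
  pose xi := x + r ^+ 2; pose et := x1 - 2 * r ^+ 3.
  have -> : 6 * x1 * r - 12 * x ^+ 2 + 4 * y ^+ 2 + g2 =
    6 * (et * r) + 24 * (xi * r ^+ 2) - 12 * xi ^+ 2 + 4 * y ^+ 2 + g2.
    by rewrite /xi /et; ring.
  have etC : et <= C := le_trans (ler_norm _) hx1.
  have xiC : xi <= C := le_trans (ler_norm _) hx.
  have r0 : 0 <= r by lra.
  have a1 : et * r <= C * r ^+ 2.
    apply: (le_trans (ler_wpM2r r0 etC)).
    by rewrite ler_wpM2l // expr2 ler_peMr.
  have a2 : xi * r ^+ 2 <= C * r ^+ 2 by apply: ler_wpM2r xiC; lra.
  have a3 : y ^+ 2 <= C ^+ 2 by rewrite -real_normK ?num_real // lerXn2r ?nnegrE.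
  have a4 : C ^+ 2 <= C ^+ 2 * r ^+ 2 by rewrite ler_peMr ?exprn_ge0.
  have a5 : g2 <= `|g2| * r ^+ 2.
    by apply: (le_trans (ler_norm _)); rewrite ler_peMr.
  have a6 := sqr_ge0 xi.
  rewrite /K; lra.
have x10 : 0 < 2 * x1 by lra.
rewrite -(ler_pM2l x10).
have -> : 2 * x1 * (3 * r * y ^+ 2 + y * y1) =
  y ^+ 2 * (6 * x1 * r - 12 * x ^+ 2 + 4 * y ^+ 2 + g2).
  have -> : 2 * x1 * (3 * r * y ^+ 2 + y * y1) = 6 * x1 * r * y ^+ 2 + y * (2 * x1 * y1) by ring.
  by rewrite E; ring.
rewrite (_ : 2 * x1 * _ = y ^+ 2 * (2 * x1 * K)); last by rewrite /K; ring.
rewrite ler_wpM2l ?sqr_ge0 // (le_trans N) //.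
rewrite mulrC ler_wpM2r //; lra.
Qed.

End SingularBound.

(** * The descent from the pole along the imaginary axis *)

Section VerticalPath.
Variables (R : realType) (g2 g3 e1 e2 e3 : R) (P P1 P2 : Cplx R -> Cplx R)
  (off : Cplx R -> Prop).
Hypothesis D : wp_data g2 g3 P P1 P2 off.
Hypothesis Hc : forall t, wcubic g2 g3 t = 4 * (t - e1) * (t - e2) * (t - e3).
Hypothesis (e32 : e3 < e2) (e21 : e2 < e1).
Implicit Types (z v h : Cplx R) (s t : R).
Local Notation defect := (defect g2 P P2).

(** The ray points downwards because the theorem evaluates wp at y - omega'. The leading 0 keeps the
    shape [z + toC s * v] of the lemmas on lines. *)
Local Notation gam s := (0 + toC s * (- 'i : Cplx R)).
Local Notation p := (fun s : R => P (gam s)).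
Local Notation p1 := (fun s : R => - 'i * P1 (gam s)).
Local Notation x := (fun s : R => complex.Re (P (gam s))).
Local Notation x1 := (fun s : R => complex.Re (- 'i * P1 (gam s))).

Lemma sqr_i : ('i : Cplx R) ^+ 2 = -1.
Proof. exact: sqrCi. Qed.

Lemma vert_eqn s : off (gam s) ->
  (p1 s) ^+ 2 = - (4 * (p s) ^+ 3 - toC g2 * (p s) - toC g3).
Proof.
move=> /(wp_eqn D) <-; rewrite exprMn sqrrN sqr_i; ring.
Qed.

Lemma vert_near0 : exists r C : R, [/\ 0 < r, 0 <= C & forall s, 0 < s < r ->
  [/\ off (gam s), modulus (p s + toC (s^-1 ^+ 2)) <= C &
      modulus (p1 s - toC (2 * s^-1 ^+ 3)) <= C]].
Proof.
have [r [C [r0 H]]] := wp_pole D (wp_pole0 D).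
have [r' [C' [r'0 H']]] := wp_pole1 D.
exists (Num.min r r'), (`|C| + `|C'|); split=> [||s]; first by rewrite lt_min r0.
  by rewrite addr_ge0.
rewrite lt_min => /andP[s0 /andP[sr sr']].
pose h : Cplx R := toC s * - 'i.
have sC : toC s != 0 by apply: contraTneq s0 => /toCI ->; rewrite ltxx.
have i0 : ('i : Cplx R) != 0 by exact: neq0Ci.
have h0 : h != 0 by rewrite mulf_neq0 // oppr_eq0.
have mh : modulus h = s by rewrite modM modN modi mulr1 mod_toC gtr0_norm.
have hr : modulus h < r by rewrite mh.
have [ho hP] := H h h0 hr.
have := H' h h0; rewrite mh => /(_ sr') hP1.
split=> //.
  have -> : P (gam s) + toC (s^-1 ^+ 2) = P (gam s) - h ^- 2.
    rewrite toCX toCV /h exprMn sqrrN sqr_i mulrN1 invrN opprK exprVn //.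
  by rewrite (le_trans hP) // (le_trans (ler_norm _)) // lerDl.
have E2 : toC 2 = 2 :> Cplx R := toC_nat R 2.
have -> : - 'i * P1 (gam s) - toC (2 * s^-1 ^+ 3) =
   - 'i * (P1 (0 + h) + 2 * h^-1 ^+ 3).
  rewrite mulrDr; congr (_ + _); rewrite toCM E2 toCX toCV.
  have -> : h^-1 = 'i * (toC s)^-1.
    apply: (mulfI h0); rewrite divff // /h.
    rewrite (_ : _ * _ = - 'i ^+ 2 * (toC s / toC s)); last by ring.
    by rewrite sqr_i opprK mul1r divff.
  have i3 : 'i ^+ 3 = - 'i :> Cplx R by rewrite exprSr sqr_i mulN1r.
  rewrite exprMn i3 (_ : - 'i * _ = 'i ^+ 2 * (2 * (toC s)^-1 ^+ 3)); last by ring.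
  by rewrite sqr_i mulN1r.
rewrite modM modN modi mul1r add0r (le_trans hP1) //.
by rewrite (le_trans (ler_norm _)) // lerDr.
Qed.

Lemma vert_derive s : off (gam s) -> cder p s (p1 s) /\
  (defect (gam s) = 0 -> cder p1 s (-1 * (6 * (p s) ^+ 2 - toC (g2 / 2)))).
Proof.
move=> so; split; first exact: (cder_P D so).
move=> /eqP; rewrite subr_eq0 => /eqP E.
have := cderZ (- 'i) (cder_P1 D so); rewrite E mulrA -expr2 sqrrN sqr_i; exact.
Qed.

(** The imaginary part of the first order equation. It is linear in the derivative of the imaginary
    part, and the real constant [g3] drops out. *)
Lemma vert_eqn_ReIm s : off (gam s) ->
  2 * x1 s * complex.Im (p1 s) =
    - (4 * (3 * (x s) ^+ 2 * complex.Im (p s) - complex.Im (p s) ^+ 3)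
       - g2 * complex.Im (p s)).
Proof.
move=> /vert_eqn H; have := congr1 (@complex.Im R) H.
have E4 : (4 : Cplx R) = toC 4 by rewrite toC_nat.
rewrite E4 !expr2 !(exprS _ 2) !expr2.
move: (P (gam s)) (- 'i * P1 (gam s)) => q q1; rewrite !compE => {}H.
transitivity (complex.Re q1 * complex.Im q1 + complex.Im q1 * complex.Re q1); first by ring.
by rewrite H; ring.
Qed.

Lemma vert_real0 : exists d C : R, 0 < d /\ forall s, 0 < s < d ->
  [/\ off (gam s), complex.Im (p s) = 0, complex.Im (p1 s) = 0, 0 < x1 s &
      x s < e3 /\ x s <= C - s^-1 ^+ 2].
Proof.
have [r [C [r0 C0 H]]] := vert_near0.
have L0 : 0 < C + `|e3| + 1 by rewrite ltr_pwDr // addr_ge0.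
have L1 : 1 <= C + `|e3| + 1 by rewrite lerDr addr_ge0.
(* The second bound makes 1 / s large enough for the hypotheses of [singular_bound] and for the real
   part to lie below [e3]. *)
pose d := Num.min r (C + `|e3| + 1)^-1.
have d0 : 0 < d by rewrite lt_min r0 invr_gt0.
have Hs s : 0 < s < d -> 0 < s < r /\ C + `|e3| + 1 <= s^-1.
  rewrite lt_min => /andP[s0 /andP[-> sL]]; rewrite s0; split=> //.
  by rewrite -[leLHS]invrK lef_pV2 ?posrE ?invr_gt0 // ltW.
have F s : 0 < s < d -> [/\ 1 <= s^-1, C <= s^-1, `|x s + s^-1 ^+ 2| <= C,
   `|complex.Im (p s)| <= C & `|x1 s - 2 * s^-1 ^+ 3| <= C].
  move=> /Hs[sr sL]; have [so h1 h2] := H s sr; have e0 := normr_ge0 e3.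
  split; [lra|lra| | |].
  - by apply: le_trans h1; apply: le_trans (ler_Re_mod _); rewrite cReD.
  - by apply: le_trans h1; apply: le_trans (ler_Im_mod _); rewrite cImD addr0.
  - by apply: le_trans h2; apply: le_trans (ler_Re_mod _); rewrite cReD cReN.
have off_s s : 0 < s < d -> off (gam s) by move=> /Hs[/H[]].
pose y s := complex.Im (p s); pose y1 s := complex.Im (p1 s).
(* The square of s^3 y. By [singular_bound] it satisfies f' <= 2 K f, and it tends to 0 with [s]
   because [y] stays bounded. *)
pose f s := s ^+ 6 * y s ^+ 2.
pose f' s := s ^+ 6 * (2 * y s * y1 s) + y s ^+ 2 * (6 * s ^+ 5).
pose K := 30 * C + 4 * C ^+ 2 + `|g2|.
have y0 s : 0 < s < d -> y s = 0.
  move=> sd; have s0 : 0 < s by case/andP: sd.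
  suff /eqP : f s = 0.
    by rewrite mulf_eq0 !expf_eq0 /= (gt_eqF s0) => /eqP.
  move: s sd {s0}; apply: (@gronwall_vanish _ f f' 0 d (2 * K)) => //.
  - move=> s sd; have [[_ dy] _] := vert_derive (off_s s sd).
    have d6 := is_derive_pow 5 (is_derive_id s 1).
    have dy2 := is_derive_pow 1 dy.
    apply: (is_derive_eq (is_derive_mul d6 dy2)).
    by rewrite /f' mulr1 expr1.
  - move=> s sd; have /andP[s0 _] := sd; split.
      by rewrite mulr_ge0 // ?sqr_ge0 // exprn_ge0 // ltW.
    have [a1 a2 a3 a4 a5] := F s sd.
    have := singular_bound a1 a2 a3 a4 a5 (vert_eqn_ReIm (off_s s sd)).
    rewrite -/(y s) -/(y1 s) => B.
    have -> : f' s = 2 * s ^+ 6 * (3 * s^-1 * y s ^+ 2 + y s * y1 s).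
      by rewrite /f'; field; rewrite gt_eqF.
    have -> : 2 * K * f s = 2 * s ^+ 6 * (K * y s ^+ 2) by rewrite /f; ring.
    by rewrite ler_wpM2l // mulr_ge0 // exprn_ge0 // ltW.
  - move=> e e0; have C1 : 0 < C ^+ 2 + 1 by rewrite ltr_pwDr // exprn_ge0.
    exists (e / (C ^+ 2 + 1)); first by rewrite divr_gt0.
    move=> s sd; rewrite add0r ltr_pdivlMr // => se.
    have /andP[s0 _] := sd; have [a1 _ _ a4 _] := F s sd.
    have s1 : s <= 1 by rewrite -[s]invrK invf_le1 // (lt_le_trans _ a1).
    have s6 : s ^+ 6 <= s by rewrite -[leRHS]expr1 ler_wiXn2l // ltW.
    have h6 : 0 <= s ^+ 6 by rewrite exprn_ge0 // ltW.
    have yC : y s ^+ 2 <= C ^+ 2 by rewrite -real_normK ?num_real // lerXn2r ?nnegrE.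
    apply: (@le_trans _ _ (s * C ^+ 2)); last by nra.
    by apply: ler_pM => //; exact: sqr_ge0.
exists d, C; split=> // s sd.
have [a1 a2 a3 a4 a5] := F s sd; have [_ sL] := Hs s sd.
have so := off_s s sd.
have [[_ dy] _] := vert_derive so.
have /andP[s0 sd'] := sd.
have y10 : y1 s = 0.
  have m0 : 0 < Num.min s (d - s) by rewrite lt_min s0 subr_gt0.
  have Heq t : `|t - s| < Num.min s (d - s) -> y t = (fun=> 0) t.
    rewrite lt_min ltr_norml => /andP[/andP[h1 _]]; rewrite ltr_norml => /andP[_ h2].
    by apply: y0; lra.
  exact: (is_derive_unique (is_derive_near m0 Heq dy) (is_derive_cst _ _ _)).
have e0 := ler_norm e3; have e0' := ler_norm (- e3); rewrite normrN in e0'.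
have r2 : s^-1 <= s^-1 ^+ 2 by rewrite ler_eXnr.
have r3 : s^-1 <= s^-1 ^+ 3 by rewrite ler_eXnr.
move: a3 a5; rewrite !ler_norml => a3 a5.
by split=> //; [exact: y0|lra|split; lra].
Qed.

End VerticalPath.

Lemma ivt_hit (R : realType) (f f' : R -> R) (a b v : R) : a <= b ->
  (forall s, a <= s <= b -> is_derive s 1 f (f' s)) -> f a <= v <= f b ->
  exists2 c, a <= c <= b & f c = v.
Proof.
move=> ab df /andP[fav vfb].
have cf : {within `[a, b], continuous f}.
  by apply: is_derive_within => s /=; rewrite in_itv /=; exact: df.
have [|c] := IVT (v := v) ab cf; first by rewrite ge_min fav le_max vfb orbT.
by rewrite in_itv /=; exists c.
Qed.

Lemma le_left_limit (R : realType) (f : R -> R) (s l a B : R) :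
  is_derive s 1 f l -> a < s -> (forall t, a < t < s -> f t <= B) -> f s <= B.
Proof.
move=> /is_derive_cont/continuous_eps H as_ fB.
apply/ler_addgt0Pr => e /H[d d0 Hd].
pose t := Num.max ((a + s) / 2) (s - d / 2).
have ts : t < s by rewrite gt_max; apply/andP; split; lra.
have at_ : (a + s) / 2 <= t by rewrite le_max lexx.
have sdt : s - d / 2 <= t by rewrite le_max lexx orbT.
have : `|f t - f s| < e by apply: Hd; rewrite ltr_norml; lra.
have := fB t; rewrite ts andbT => /(_ ltac:(lra)).
rewrite ltr_norml; lra.
Qed.

(** * The half period *)

Section HalfPeriod.
Variables (R : realType) (g2 g3 e1 e2 e3 : R) (P P1 P2 : Cplx R -> Cplx R)
  (off : Cplx R -> Prop).
Hypothesis D : wp_data g2 g3 P P1 P2 off.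
Hypothesis Hc : forall t, wcubic g2 g3 t = 4 * (t - e1) * (t - e2) * (t - e3).
Hypothesis (e32 : e3 < e2) (e21 : e2 < e1).
Implicit Types (z v h : Cplx R) (s t : R).
Local Notation defect := (defect g2 P P2).

Local Notation gam s := (0 + toC s * (- 'i : Cplx R)).
Local Notation p := (fun s : R => P (gam s)).
Local Notation p1 := (fun s : R => - 'i * P1 (gam s)).
Local Notation x := (fun s : R => complex.Re (P (gam s))).
Local Notation x1 := (fun s : R => complex.Re (- 'i * P1 (gam s))).

Lemma real_of_Im0 (z : Cplx R) : complex.Im z = 0 -> z = toC (complex.Re z).
Proof. by move=> h; apply: cplxP => //; rewrite cImC. Qed.

Lemma conj_rhs (q : Cplx R) (k : R) :
  (-1 * (6 * q ^+ 2 - toC k))^* = -1 * (6 * q^* ^+ 2 - toC k).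
Proof.
by rewrite !mulN1r -(toC_nat R 6) !expr2; apply: cplxP; rewrite !compE; ring.
Qed.

Lemma wcubic_real z : toC (wcubic g2 g3 (complex.Re z)) =
  4 * toC (complex.Re z) ^+ 3 - toC g2 * toC (complex.Re z) - toC g3.
Proof.
by rewrite /wcubic !toCB (toCM g2) (toCM 4) toCX (toC_nat R 4).
Qed.

(** As [x1] is positive, wp' does not vanish and the second order equation holds without
    propagation. The curve and its conjugate solve it with equal data at a small [a], so the curve
    is real. It stays below [e3], since [x1 ^+ 2] is minus the cubic and would vanish on reaching
    that value. *)
Lemma vert_segment b : (forall s, 0 < s < b -> off (gam s) /\ 0 < x1 s) ->
  forall s, 0 < s < b -> [/\ defect (gam s) = 0, complex.Im (p s) = 0,
    complex.Im (p1 s) = 0, x s < e3 &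
    x1 s ^+ 2 = - wcubic g2 g3 (x s) /\
    is_derive s 1 x1 (- (6 * x s ^+ 2 - g2 / 2))].
Proof.
move=> H s sb; have /andP[s0 sb'] := sb.
have def t : 0 < t < b -> defect (gam t) = 0.
  move=> /H[ot x1t]; apply: (defect_nonzero D) => //.
  by apply: contraTneq x1t => ->; rewrite mulr0 ltxx.
have [d [C [d0 Hd]]] := vert_real0 e3 D.
pose a := Num.min (d / 2) (s / 2).
have a0 : 0 < a by rewrite lt_min !divr_gt0.
have as_ : a < s by rewrite gt_min; apply/orP; right; lra.
have ad : a < d by rewrite gt_min; apply/orP; left; lra.
have [oa pa pa1 _ [xa _]] : [/\ off (gam a), complex.Im (p a) = 0,
  complex.Im (p1 a) = 0, 0 < x1 a & x a < e3 /\ x a <= C - a^-1 ^+ 2].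
  by apply: Hd; rewrite a0.
have Dp t : a <= t < b -> cder p t (p1 t) /\
    cder p1 t (-1 * (6 * (p t) ^+ 2 - toC (g2 / 2))).
  move=> /andP[at_ tb]; have t0b : 0 < t < b by rewrite (lt_le_trans a0 at_).
  by have [] := vert_derive D (H t t0b).1 => h1 h2; split => //; apply/h2/def.
pose pj t := (p t)^*; pose pj1 t := (p1 t)^*.
have Dpj t : a <= t < b -> cder pj t (pj1 t) /\
    cder pj1 t (-1 * (6 * pj t ^+ 2 - toC (g2 / 2))).
  move=> /Dp[h1 h2]; split; first exact: cderJ.
  by have := cderJ h2; rewrite conj_rhs.
have real0 (z : Cplx R) : z = z^* <-> complex.Im z = 0.
  split=> [/(congr1 (@complex.Im R))|h]; first by rewrite cImJ; lra.
  by apply: cplxP; rewrite !compE // h oppr0.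
have [pE p1E] : p s = pj s /\ p1 s = pj1 s.
  have spb : a <= s < b by rewrite (ltW as_).
  by apply: (ode2_unique Dp Dpj _ _ spb); apply/real0.
have ps := (real0 _).1 pE; have ps1 := (real0 _).1 p1E.
have so := (H s sb).1.
have pR := real_of_Im0 ps; have p1R := real_of_Im0 ps1.
have sq t : complex.Im (p t) = 0 -> complex.Im (p1 t) = 0 -> off (gam t) ->
    x1 t ^+ 2 = - wcubic g2 g3 (x t).
  move=> /real_of_Im0 h1 /real_of_Im0 h2 /(vert_eqn D).
  move=> E; apply: toCI; rewrite toCX toCN wcubic_real -h1 -h2; exact: E.
have im0 t : a <= t < b -> complex.Im (p t) = 0 /\ complex.Im (p1 t) = 0.
  move=> atb.
  have [h1 h2] : p t = pj t /\ p1 t = pj1 t.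
    by apply: (ode2_unique Dp Dpj _ _ atb); apply/real0.
  by split; apply/real0.
split=> //; first exact: def.
  rewrite ltNge; apply/negP => xs.
  have [||c /andP[ac cs] xc] := @ivt_hit _ x x1 a s e3 (ltW as_).
  - by move=> t /andP[h1 h2]; have [[dxt _] _] : cder p t (p1 t) /\ cder p1 t (-1 * (6 * (p t) ^+ 2 - toC (g2 / 2))) by apply: Dp; rewrite h1 (le_lt_trans h2).
  - by rewrite (ltW xa).
  have c0b : 0 < c < b by rewrite (lt_le_trans a0 ac) (le_lt_trans cs).
  have [oc x1c] := H c c0b.
  have [i1 i2] : complex.Im (p c) = 0 /\ complex.Im (p1 c) = 0.
    by apply: im0; rewrite ac (le_lt_trans cs).
  have := sq c i1 i2 oc; rewrite /= in xc; rewrite xc Hc subrr mulr0 oppr0 => /eqP.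
  by rewrite expf_eq0 /= => /eqP x10; move: x1c; rewrite x10 ltxx.
split; first exact: sq.
have sab : a <= s < b by rewrite (ltW as_).
have [_ [dx1 _]] := Dp s sab.
apply: (is_derive_eq dx1); rewrite pR.
have -> : -1 * (6 * toC (x s) ^+ 2 - toC (g2 / 2)) = toC (- (6 * x s ^+ 2 - g2 / 2)).
  by rewrite toCN toCB [toC (6 * _)]toCM toCX (toC_nat R 6) mulN1r.
by [].
Qed.


(** Near a pole wp is [h ^- 2] up to a bounded term, so a line on which wp stays bounded cannot run
    into one. *)
Lemma pole_bounded z v (s0 a M : R) : a < s0 -> ~ off (z + toC s0 * v) -> modulus v = 1 ->
  (forall s, a < s < s0 -> modulus (P (z + toC s * v)) <= M) -> False.
Proof.
move=> as0 /(wp_pole D)[r [C [r0 H]]] v1 HM.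
pose L := `|C| + `|M| + 1.
have L0 : 0 < L by rewrite ltr_pwDr // addr_ge0.
have L1 : 1 <= L by rewrite lerDr addr_ge0.
pose t := Num.min (Num.min (r / 2) ((s0 - a) / 2)) L^-1.
have t0 : 0 < t by rewrite !lt_min !divr_gt0 ?invr_gt0 ?subr_gt0.
have tr : t <= r / 2 by rewrite !ge_min lexx.
have ta : t <= (s0 - a) / 2 by rewrite !ge_min lexx orbT.
have tL : t <= L^-1 by rewrite !ge_min lexx !orbT.
pose h := toC (- t) * v.
have mh : modulus h = t by rewrite modM v1 mulr1 mod_toC normrN gtr0_norm.
have h0 : h != 0 by apply: contraTneq t0 => E; rewrite -mh E mod0 ltxx.
have [|_] := H h h0; first by rewrite mh; lra.
rewrite /h -line_step; set w := P _ => hC.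
have wM : modulus w <= M by apply: HM; lra.
have E : modulus (h ^- 2) = t^-1 ^+ 2 by rewrite modV modX mh exprVn.
have tV : L <= t^-1 by rewrite -[L]invrK lef_pV2 ?posrE ?invr_gt0.
have t2 : t^-1 <= t^-1 ^+ 2 by rewrite ler_eXnr // (le_trans L1).
have := modB_ge (h ^- 2) w; rewrite modBC E.
have := ler_norm C; have := ler_norm M; rewrite /L in tV; lra.
Qed.

(** [s0] is the first parameter at which the curve meets a pole or [x1] ceases to be positive. It
    exists because [x1] decreases at least at a fixed rate; the pole is excluded by boundedness; and
    of the three roots only [e3] is compatible with values below [e3] before. *)
Lemma half_period : exists s0 : R, [/\ 0 < s0, off (gam s0) /\ P (gam s0) = toC e3,
   P1 (gam s0) = 0, defect (gam s0) = 0 &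
   forall s, 0 < s < s0 -> [/\ off (gam s), 0 < x1 s, x s < e3 &
      x1 s ^+ 2 = - wcubic g2 g3 (x s)]].
Proof.
have [d [C [d0 Hd]]] := vert_real0 e3 D.
pose Q s := off (gam s) /\ 0 < x1 s.
have e31 : e3 < e1 := lt_trans e32 e21.
(* A lower bound of 6 x^2 - g2 / 2 for x < e3: each of the three products in [wcubic_deriv] is
   nonnegative there, and the one kept is least at [e3]. *)
pose k := 2 * ((e1 - e3) * (e2 - e3)).
have k0 : 0 < k by rewrite !mulr_gt0 ?subr_gt0.
have dk s : x s < e3 -> - (6 * x s ^+ 2 - g2 / 2) <= - k.
  rewrite lerN2 (wcubic_deriv Hc) /k => xe.
  have h1 := e32; have h2 := e31; nra.
have Qd t : 0 < t < 0 + d -> Q t by rewrite add0r => /Hd[].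
have [t t0 nQ] : exists2 t, 0 < t & ~ Q t.
  apply: contrapT => nQ.
  have HQ s : 0 < s -> Q s by move=> s0; apply: contrapT => nQs; apply: nQ; exists s.
  (* After this time the decrease, at rate at least [k], exceeds the value of [x1] at [a]. *)
  pose a := 1 : R; pose b := a + (`|x1 a| / k + 1).
  have ab : a < b by rewrite ltrDl ltr_pwDr // divr_ge0 // ltW.
  have a1 : a = 1 by [].
  have HS s : 0 < s < b + 1 -> off (gam s) /\ 0 < x1 s by case/andP => /HQ.
  have [|c /andP[ac cb]] := @mean_value _ x1 (fun s => - (6 * x s ^+ 2 - g2 / 2)) a b ab.
    by move=> s sab; have [|_ _ _ _ [_ //]] := vert_segment HS (s := s); lra.
  have [|_ _ _ /dk xc _] := vert_segment HS (s := c); first lra.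
  have [|_ x1b] := HS b; first lra.
  move=> E; have h1 : x1 b - x1 a <= - k * (b - a) by rewrite E ler_wpM2r // subr_ge0 ltW.
  have h2 : k * (b - a) = `|x1 a| + k by rewrite /b; field; rewrite gt_eqF.
  have := ler_norm (x1 a); lra.
have [||s0 s00 [Hs Hn]] := @first_failure _ Q 0; [by exists t|by exists d|].
exists s0.
have HV := vert_segment Hs.
pose a := Num.min (d / 2) (s0 / 2).
have a0 : 0 < a by rewrite lt_min !divr_gt0.
have as_ : a < s0 by rewrite gt_min; apply/orP; right; lra.
have off0 : off (gam s0).
  apply: contrapT => no; apply: (@pole_bounded _ _ s0 a (`|x a| + `|e3|) as_ no).
    by rewrite modN modi.
  move=> s /andP[as1 ss0]; have s0s : 0 < s < s0 by lra.
  have [_ i1 _ xe _] := HV s s0s.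
  rewrite (real_of_Im0 i1) mod_toC.
  have [|c /andP[ac cs]] := @mean_value _ x x1 a s as1.
    move=> u /andP[au us]; have [|uo _] := Hs u; first lra.
    by have [[]] := vert_derive D uo.
  move=> E; have [|_ x1c] := Hs c; first lra.
  have : 0 <= x1 c * (s - a) by apply: mulr_ge0; [exact: ltW|rewrite subr_ge0 ltW].
  have := ler_norm e3; have := ler_norm (- e3); have := ler_norm (- x a).
  have := normr_ge0 (x a).
  by move: E xe; rewrite /= !normrN ler_norml; lra.
have [[dp dpi] _] := vert_derive D off0.
have dp1 := cderZ (- 'i) (cder_P1 D off0).
have [pim p1im] : complex.Im (p s0) = 0 /\ complex.Im (p1 s0) = 0.
  have z0 (f : R -> R) (l : R) : is_derive s0 1 f l -> (forall t, 0 < t < s0 -> f t = 0) -> f s0 = 0.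
    move=> df f0; apply/eqP; rewrite eq_le; apply/andP; split.
      by apply: (le_left_limit df s00) => u /f0 ->.
    rewrite -oppr_le0; apply: (le_left_limit (is_deriveN df) s00) => u /f0 H.
    by rewrite -[(- f) u]/(- f u) H oppr0.
  split.
    by apply: (z0 _ _ dpi) => u /HV[].
  by apply: (z0 _ _ dp1.2) => u /HV[].
have x10 : x1 s0 = 0.
  apply/eqP; rewrite eq_le; apply/andP; split; last first.
    rewrite -oppr_le0; apply: (le_left_limit (is_deriveN dp1.1) s00) => u /Hs[_ H].
    by rewrite -[(- _) u]/(- x1 u) oppr_le0 ltW.
  (* A positive value at [s0] would persist to the right together with [off], against [Hn]. *)
  rewrite leNgt; apply/negP => x1p.
  have [d1 d10 H1] := off_line D off0.
  have /continuous_eps/(_ _ x1p)[d2 d20 H2] := is_derive_cont dp1.1.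
  have [|u /andP[su ud]] := Hn (Num.min d1 d2); first by rewrite lt_min d10.
  have h1 : `|u - s0| < Num.min d1 d2 by rewrite ger0_norm ?subr_ge0 // ltrBlDl.
  move: h1; rewrite lt_min => /andP[/H1 h1 /H2]; rewrite ltr_norml => /andP[h2 _].
  by apply; split => //; move: h2; rewrite ltrBrDr addNr.
have p10 : p1 s0 = 0 by rewrite [LHS](real_of_Im0 p1im) x10.
have P10 : P1 (gam s0) = 0.
  by move/eqP: p10; rewrite mulf_eq0 oppr_eq0 (negbTE (@neq0Ci _)) /= => /eqP.
have xe3 : x s0 <= e3 by apply: (le_left_limit dp s00) => u /HV[_ _ _ /ltW].
split=> //.
- split=> //; have [] := P1_zero D Hc off0 P10 => // E; move: xe3; rewrite E cReC => h;
    have h1 := e32; have h2 := e21; exfalso; lra.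
(* Since wp' vanishes at [s0], the second order equation is obtained there as a limit from smaller
   parameters. *)
- apply: (defect_closed D off0) => r r0.
  have [r' r'0 Hr] := line_small (- 'i) r0.
  pose u := Num.max (s0 / 2) (s0 - r' / 2).
  have us : u < s0 by rewrite gt_max; apply/andP; split; lra.
  have u0 : s0 / 2 <= u by rewrite le_max lexx.
  have u1 : s0 - r' / 2 <= u by rewrite le_max lexx orbT.
  exists (toC (u - s0) * (- 'i)); first by apply: Hr; rewrite ltr_norml; lra.
  rewrite -line_step (addrC s0) subrK.
  by have [|] := HV u; first lra.
- by move=> s sb; have [? ?] := Hs s sb; have [_ _ _ ? []] := HV s sb.
Qed.

End HalfPeriod.

(** * The period integral as a travel time *)

Section TravelTime.
Variables (R : realType) (x x1 g : R -> R) (s0 e : R).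
Implicit Types (s t M v : R).
Hypotheses (s00 : 0 < s0) (dx : forall s, 0 < s < s0 -> is_derive s 1 x (x1 s)).
Hypothesis x1c : forall s, 0 < s < s0 -> {for s, continuous x1}.
Hypothesis gc : forall t, t < e -> {for t, continuous g}.
Hypothesis g0 : forall t, 0 <= g t.
Hypothesis x1gt0 : forall s, 0 < s < s0 -> [/\ 0 < x1 s, x s < e & g (x s) = (x1 s)^-1].
Hypothesis xlow : forall M, exists2 s, 0 < s < s0 & x s <= M.
Hypothesis xhigh : forall v, v < e -> exists2 s, 0 < s < s0 & v <= x s.

Lemma travel_incr s t : 0 < s < s0 -> 0 < t < s0 -> s < t -> x s < x t.
Proof.
move=> /andP[s_ _] /andP[_ t_] st.
have [|c /andP[sc ct] E] := @mean_value _ x x1 s t st.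
  by move=> u /andP[su ut]; apply: dx; rewrite (lt_le_trans s_ su) (le_lt_trans ut t_).
have [|h _ _] := x1gt0 (s := c); first by rewrite (lt_trans s_ sc) (lt_trans ct t_).
by rewrite -subr_gt0 E mulr_gt0 // subr_gt0.
Qed.

Lemma travel_derive1 s : 0 < s < s0 -> derive1 x s = x1 s.
Proof. by move=> /dx[_ H]; rewrite derive1E. Qed.

Lemma travel_derive1_cvg s : 0 < s < s0 -> derive1 x t @[t --> s] --> x1 s.
Proof.
move=> /[dup] ss /andP[h1 h2].
apply: cvg_trans (x1c ss); apply: near_eq_cvg.
apply/nbhs_ballP; exists (Num.min s (s0 - s)) => /=.
  by rewrite lt_min h1 subr_gt0.
move=> t; rewrite /ball /= lt_min ltr_norml => /andP[/andP[_ h3]].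
rewrite ltr_norml => /andP[h4 _]; rewrite travel_derive1 //; lra.
Qed.

(** After substitution the integrand is g (x s) x'(s) = 1. *)
Lemma travel_segment a b : 0 < a -> a < b -> b < s0 ->
  (\int[lebesgue_measure]_(t in `[x a, x b]) (g t)%:E = (b - a)%:E)%E.
Proof.
move=> a0 ab bs.
have I t : a <= t <= b -> 0 < t < s0 by move=> /andP[h1 h2]; lra.
have Io t : t \in `]a, b[ -> 0 < t < s0.
  by rewrite in_itv /= => /andP[h1 h2]; lra.
have Ia : 0 < a < s0 by lra.
have Ib : 0 < b < s0 by lra.
rewrite integration_by_substitution_increasing; first last.
- apply: continuous_in_subspaceT => t /set_mem /=; rewrite in_itv /= => /andP[_ h].
  by apply: gc; apply: le_lt_trans h _; have [] := x1gt0 Ib.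
- split.
  + by move=> t /Io/dx[].
  + by apply: cvg_at_right_filter; exact: (is_derive_cont (dx Ia)).
  + by apply: cvg_at_left_filter; exact: (is_derive_cont (dx Ib)).
- by apply/cvg_ex; exists (x1 b); apply: cvg_at_left_filter; exact: travel_derive1_cvg.
- by apply/cvg_ex; exists (x1 a); apply: cvg_at_right_filter; exact: travel_derive1_cvg.
- move=> t /Io ts; rewrite /prop_for /continuous_at travel_derive1 //.
  exact: travel_derive1_cvg.
- move=> s t; rewrite !in_itv /= => /I h1 /I h2; exact: travel_incr.
- exact: ltW.
transitivity (\int[lebesgue_measure]_(t in `[a, b]) (cst 1%:E t : \bar R))%E.
  apply: eq_integral => t /set_mem /=; rewrite in_itv /= => /I ts.
  have [h1 _ h2] := x1gt0 ts.
  by congr (_%:E); rewrite -[LHS]/(g (x t) * derive1 x t) travel_derive1 // h2 mulVf // gt_eqF.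
rewrite integral_cst //= mul1e lebesgue_measure_itv /= lte_fin ab.
by rewrite -EFinB.
Qed.

(** The interval is unbounded and [g] is controlled only to the left of [e], so the substitution is
    made on compact pieces; monotone convergence then exhausts the interval. *)
Lemma travel_time :
  (\int[lebesgue_measure]_(t in `]-oo, e[) (g t)%:E = s0%:E)%E.
Proof.
(* The offset 3 keeps [a n] at most s0 / 3, so that [a n < b n] already for n = 0. *)
pose a n : R := s0 / n.+3%:R; pose b n := s0 - a n.
have a0 n : 0 < a n by rewrite divr_gt0.
have a3 n : a n <= s0 / 3.
  by rewrite ler_wpM2l ?(ltW s00) // lef_pV2 ?posrE // ler_nat.
have ab n : a n < b n.
  have h1 := a3 n; have h2 := s00; rewrite /b; lra.
have bs n : b n < s0 by rewrite /b; have := a0 n; lra.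
have Ia n : 0 < a n < s0 by rewrite a0 (lt_trans (ab n)).
have Ib n : 0 < b n < s0 by rewrite bs (lt_trans (a0 n)).
have amono n m : (n <= m)%N -> a m <= a n.
  by move=> nm; rewrite ler_wpM2l ?(ltW s00) // lef_pV2 ?posrE // ler_nat !ltnS.
have xmono s t : 0 < s < s0 -> 0 < t < s0 -> s <= t -> x s <= x t.
  move=> hs ht; rewrite le_eqVlt => /predU1P[-> //|st]; apply: ltW.
  exact: travel_incr.
pose F n : set R := [set` `[x (a n), x (b n)]].
have FU : \bigcup_n F n = [set` `]-oo, e[].
  apply/seteqP; split=> t.
    move=> [n _]; rewrite /F /= !in_itv /= => /andP[_ h]; apply: le_lt_trans h _.
    by have [] := x1gt0 (Ib n).
  rewrite /= in_itv /= => te.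
  have [s1 s1s h1] := xlow t; have [s2 s2s h2] := xhigh te.
  pose N := Num.truncn (s0 / Num.min s1 (s0 - s2)).
  have m0 : 0 < Num.min s1 (s0 - s2).
    by rewrite lt_min; move: s1s s2s => /andP[-> _] /andP[_]; rewrite subr_gt0.
  have aN : a N <= Num.min s1 (s0 - s2).
    rewrite ler_pdivrMr // mulrC -ler_pdivrMr //.
    apply: (le_trans (ltW (truncnS_gt _))); rewrite ler_nat -/N; lia.
  move: aN; rewrite le_min => /andP[aN1 aN2].
  exists N => //; rewrite /F /= in_itv /=; apply/andP; split.
    by apply: le_trans h1; apply: xmono.
  by apply: (le_trans h2); apply: xmono => //; rewrite /b; lra.
have Fsub n : F n `<=` [set` `]-oo, e[] by rewrite -FU; exact: bigcup_sup.
have mg : measurable_fun [set` `]-oo, e[] g.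
  apply: open_continuous_measurable_fun.
    exact: interval_open.
  by move=> t /set_mem /=; rewrite in_itv /= => te; exact: gc.
have H : (\int[lebesgue_measure]_(t in F i) (g t)%:E @[i --> \oo] -->
   \int[lebesgue_measure]_(t in \bigcup_i F i) (g t)%:E)%E.
  apply: ge0_nondecreasing_set_cvg_integral.
  - move=> n m nm; rewrite subsetEset /F => t /=; rewrite !in_itv /= => /andP[h1 h2].
    have am := amono n m nm.
    rewrite (le_trans _ h1) ?(le_trans h2) //; apply: xmono => //; rewrite /b; lra.
  - by move=> n; exact: measurable_itv.
  - by move=> n; apply/measurable_EFinP; apply: measurable_funS (Fsub n) mg; exact: measurable_itv.
  - by move=> n t _; rewrite lee_fin.
rewrite FU in H.
apply: (cvg_unique _ H) => //.
rewrite (_ : (fun i => _) = (fun n => (b n - a n)%:E)); last first.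
  by apply/funext => n; exact: travel_segment.
have -> : s0 = s0 - 2 * (s0 * 0) by ring.
apply: cvg_EFin; first by near=> n.
rewrite (_ : _ \o _ = (fun n => s0 - 2 * (s0 * (n.+3%:R)^-1))); last first.
  by apply/funext => n /=; rewrite /b /a; ring.
apply: cvgB; first exact: cvg_cst.
apply: cvgMr; apply: cvgMr.
have := @cvg_harmonic R; rewrite -(cvg_shiftn 2).
by apply: cvg_trans; apply: near_eq_cvg; near=> n; rewrite /harmonic /= addn2.
Unshelve. all: by end_near.
Qed.

End TravelTime.

Section WpSolution.
Variables (R : realType) (g2 g3 e1 e2 e3 : R) (P P1 P2 : Cplx R -> Cplx R)
  (off : Cplx R -> Prop).
Hypothesis D : wp_data g2 g3 P P1 P2 off.
Hypothesis Hc : forall t, wcubic g2 g3 t = 4 * (t - e1) * (t - e2) * (t - e3).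
Hypothesis (e32 : e3 < e2) (e21 : e2 < e1).
Implicit Types (z v h : Cplx R) (s t : R).
Local Notation defect := (defect g2 P P2).
Local Notation gam s := (0 + toC s * (- 'i : Cplx R)).

Lemma wcubic_continuous (t : R) : {for t, continuous (wcubic g2 g3)}.
Proof.
have h := is_derive_pow 2 (is_derive_id t (1:R)).
have h1 := is_derive_mul (is_derive_cst (4:R) t (1:R)) h.
have h2 := is_derive_mul (is_derive_cst (- g2) t (1:R)) (is_derive_id t (1:R)).
have h3 := is_derive_add (is_derive_add h1 h2) (is_derive_cst (- g3) t (1:R)).
rewrite (_ : wcubic g2 g3 = fun s => 4 * s ^+ 3 + (- g2) * s + (- g3)).
  exact: is_derive_cont h3.
by apply/funext => s; rewrite /wcubic mulNr.
Qed.

(** On the descent x' is the positive square root of minus the cubic, so the integrand is 1 / x'.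
    The pole at 0 provides arbitrarily low values of [x], continuity at [s0] values close to
    [e3]. *)
Lemma period_integral s0 : 0 < s0 -> off (gam s0) -> P (gam s0) = toC e3 ->
  (forall s, 0 < s < s0 -> [/\ off (gam s), 0 < complex.Re (- 'i * P1 (gam s)),
     complex.Re (P (gam s)) < e3 &
     complex.Re (- 'i * P1 (gam s)) ^+ 2 = - wcubic g2 g3 (complex.Re (P (gam s)))]) ->
  omega' g2 g3 e3 = 'i * toC s0.
Proof.
move=> s00 o0 Pe H; rewrite /omega' /Rintegral.
set g := fun t => (Num.sqrt `|wcubic g2 g3 t|)^-1.
pose x s := complex.Re (P (gam s)); pose x1 s := complex.Re (- 'i * P1 (gam s)).
suff -> : (\int[lebesgue_measure]_(t in `]-oo, e3[) (g t)%:E = s0%:E)%E by [].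
apply: (@travel_time _ x x1 g s0 e3 s00).
- by move=> s /H[/(vert_derive D)[[]]].
- move=> s /H[so _ _ _].
  exact: (is_derive_cont (cderZ (- 'i) (cder_P1 D so)).1).
- move=> t te3; have w0 : wcubic g2 g3 t != 0.
    rewrite Hc !mulf_eq0 pnatr_eq0 /= !subr_eq0 !(lt_eqF te3).
    by rewrite (lt_eqF (lt_trans te3 e32)) (lt_eqF (lt_trans (lt_trans te3 e32) e21)).
  apply: continuousV; first by rewrite sqrtr_eq0 -ltNge normr_gt0.
  apply: continuous_comp; last exact: sqrt_continuous.
  by apply: continuous_comp; [exact: wcubic_continuous|exact: norm_continuous].
- by move=> t; rewrite invr_ge0 sqrtr_ge0.
- move=> s /H[_ h1 h2 h3]; split => //; rewrite /g.
  by rewrite -normrN -h3 ger0_norm ?sqr_ge0 // sqrtr_sqr gtr0_norm.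
- move=> M; have [d [C [d0 Hd]]] := vert_real0 e3 D.
  pose L := `|C| + `|M| + 1.
  have L0 : 0 < L by rewrite ltr_pwDr // addr_ge0.
  have L1 : 1 <= L by rewrite lerDr addr_ge0.
  pose s := Num.min (Num.min (d / 2) (s0 / 2)) L^-1.
  have s_0 : 0 < s by rewrite !lt_min !divr_gt0 ?invr_gt0.
  have sd : s <= d / 2 by rewrite !ge_min lexx.
  have ss0 : s <= s0 / 2 by rewrite !ge_min lexx orbT.
  have sL : s <= L^-1 by rewrite !ge_min lexx !orbT.
  exists s; first by apply/andP; split => //; lra.
  have [|_ _ _ _ [_ h]] := Hd s; first by apply/andP; split => //; lra.
  apply: (le_trans h).
  have tV : L <= s^-1 by rewrite -[L]invrK lef_pV2 ?posrE ?invr_gt0.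
  have t2 : s^-1 <= s^-1 ^+ 2 by rewrite ler_eXnr // (le_trans L1).
  have := ler_norm C; have := ler_norm (- M); rewrite normrN /L in tV *; lra.
- move=> v ve; have [[dx _] _] := vert_derive D o0.
  have ve0 : 0 < e3 - v by rewrite subr_gt0.
  have /continuous_eps/(_ _ ve0)[d d0 Hd] := is_derive_cont dx.
  pose s := Num.max (s0 / 2) (s0 - d / 2).
  have us : s < s0 by rewrite gt_max; apply/andP; split; lra.
  have u0 : s0 / 2 <= s by rewrite le_max lexx.
  have u1 : s0 - d / 2 <= s by rewrite le_max lexx orbT.
  exists s; first by apply/andP; split => //; lra.
  have : `|s - s0| < d by rewrite ltr_norml; lra.
  move=> /Hd; rewrite Pe cReC ltr_norml /x => /andP[h _]; lra.
Qed.

(** Uniqueness gives wp = q as long as no pole has been met, and a first pole would be approached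
    with the bounded values of [q]; hence there is none. Here [v] is 1 or -1. *)
Lemma horizontal_ray z0 v b (q q1 : R -> R) : off z0 -> P z0 = toC e3 -> P1 z0 = 0 ->
  defect z0 = 0 -> v * v = 1 -> modulus v = 1 ->
  (forall t, 0 <= t < b -> is_derive t 1 q (q1 t) /\
     is_derive t 1 q1 (6 * q t ^+ 2 - g2 / 2)) ->
  q 0 = e3 -> q1 0 = 0 ->
  forall t, 0 <= t < b -> P (z0 + toC t * v) = toC (q t).
Proof.
move=> oz Pz P1z dz vv v1 Hq q0 q10.
have z0E : z0 + toC 0 * v = z0 by rewrite toC0 mul0r addr0.
have seg c : c <= b -> (forall t, 0 <= t < c -> off (z0 + toC t * v)) ->
    forall t, 0 <= t < c -> P (z0 + toC t * v) = toC (q t).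
  move=> cb Ho t tc.
  have Dp s : 0 <= s < c -> cder (fun t => P (z0 + toC t * v)) s (v * P1 (z0 + toC s * v)) /\
      cder (fun t => v * P1 (z0 + toC t * v)) s
        (1 * (6 * P (z0 + toC s * v) ^+ 2 - toC (g2 / 2))).
    move=> sc; split; first exact: (cder_P D (Ho s sc)).
    have dz2 : defect (z0 + toC 0 * v) = 0 by rewrite toC0 mul0r addr0.
    have /eqP := defect_line D Hc e32 e21 Ho dz2 sc.
    rewrite subr_eq0 => /eqP E.
    by have := cderZ v (cder_P1 D (Ho s sc)); rewrite E mulrA vv.
  have Dq s : 0 <= s < c -> cder (fun t => toC (q t)) s (toC (q1 s)) /\
      cder (fun t => toC (q1 t)) s (1 * (6 * toC (q s) ^+ 2 - toC (g2 / 2))).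
    move=> /andP[h1 h2]; have [|h3 h4] := Hq s; first by rewrite h1 (lt_le_trans h2).
    split; first exact: cder_toC.
    have := cder_toC h4; rewrite toCB [toC (6 * _)]toCM toCX (toC_nat R 6) mul1r.
    exact.
  have pq0 : P (z0 + toC 0 * v) = toC (q 0) by rewrite z0E q0.
  have pq1 : v * P1 (z0 + toC 0 * v) = toC (q1 0) by rewrite z0E q10 P1z mulr0.
  by have [] := ode2_unique Dp Dq pq0 pq1 tc.
apply: (seg b (lexx b)) => t tb; apply: contrapT => no.
have /andP[t0 tb'] := tb.
have [d d0 Hd] : exists2 d : R, 0 < d & forall t, `|t - 0| < d -> off (z0 + toC t * v).
  by apply: (off_line D); rewrite z0E.
have t0' : 0 < t.
  by rewrite lt_def t0 andbT; apply/eqP => E; apply: no; rewrite E z0E.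
have [||s0 s00 [Hs Hn]] := @first_failure _ (fun t => off (z0 + toC t * v)) 0.
- by exists t.
- by exists d => // s /andP[h1 h2]; apply: Hd; rewrite subr0 gtr0_norm //; lra.
have s0t : s0 <= t.
  by rewrite leNgt; apply/negP => ts; apply: no; apply: Hs; rewrite t0'.
have no0 : ~ off (z0 + toC s0 * v).
  move=> /(off_line D)[r r0 Hr]; have [u /andP[h1 h2]] := Hn r r0; apply.
  by apply: Hr; rewrite ger0_norm ?subr_ge0 // ltrBlDl.
have Ho s : 0 <= s < s0 -> off (z0 + toC s * v).
  move=> /andP[]; rewrite le_eqVlt => /predU1P[<- _|h1 h2]; first by rewrite z0E.
  by apply: Hs; rewrite h1.
have [|dq _] := Hq s0; first by rewrite (ltW s00) (le_lt_trans s0t).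
have /continuous_eps/(_ _ ltr01)[r r0 Hr] := is_derive_cont dq.
pose a := Num.max (s0 / 2) (s0 - r / 2).
have as0 : a < s0 by rewrite gt_max; apply/andP; split; lra.
have a0 : s0 / 2 <= a by rewrite le_max lexx.
have ar : s0 - r / 2 <= a by rewrite le_max lexx orbT.
apply: (pole_bounded D (M := `|q s0| + 1) as0 no0 v1) => s /andP[h1 h2].
rewrite (seg s0 _ Ho); [|lra|by apply/andP; split; lra].
rewrite mod_toC; have : `|s - s0| < r by rewrite ltr_norml; lra.
move=> /Hr h3; rewrite -(subrK (q s0) (q s)) (le_trans (ler_normD _ _)) //.
by rewrite addrC lerD2l ltW.
Qed.

End WpSolution.

(** The strip may be unbounded, whereas the statements on rays run up to a real bound. *)
Lemma ereal_gap_right (R : realType) (y : R) (hi : \bar R) : (y%:E < hi)%E ->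
  exists2 b, y < b & forall t, t < b -> (t%:E < hi)%E.
Proof.
case: hi => [h| |] //; rewrite ?lte_fin => yh.
  by exists h => // t; rewrite lte_fin.
by exists (y + 1) => [|t _]; rewrite ?ltrDl ?ltry.
Qed.

Lemma ereal_gap_left (R : realType) (y : R) (lo : \bar R) : (lo < y%:E)%E ->
  exists2 b, b < y & forall t, b < t -> (lo < t%:E)%E.
Proof.
case: lo => [h| |] //; rewrite ?lte_fin => yh.
  by exists h => // t; rewrite lte_fin.
by exists (y - 1) => [|t _]; rewrite ?ltrBlDr ?ltrDl ?ltNyr.
Qed.

(** Negative [y] are treated by reversal, with direction -1 and [q (- t)]; both rays start at -
    omega'. *)
Lemma weierstrass_solution (R : realType) (lo hi : \bar R) (g2 g3 e1 e2 e3 : R)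
    (P : Cplx R -> Cplx R) (q q1 : R -> R) :
  (lo < 0)%E -> (0 < hi)%E ->
  (forall t, wcubic g2 g3 t = 4 * (t - e1) * (t - e2) * (t - e3)) ->
  e3 < e2 -> e2 < e1 -> weierstrass_p (toC g2) (toC g3) P ->
  (forall y : R, (lo < y%:E < hi)%E -> is_derive y 1 q (q1 y) /\
     is_derive y 1 q1 (6 * q y ^+ 2 - g2 / 2)) ->
  q 0 = e3 -> q1 0 = 0 ->
  forall y : R, (lo < y%:E < hi)%E -> P (toC y - omega' g2 g3 e3) = toC (q y).
Proof.
move=> lo0 hi0 Hc e32 e21 /weierstrass_p_data[P1 [P2 [off D]]] Hq q0 q10 y.
move=> /andP[loy yhi].
have [s0 [s00 [s0o Pe] P10 d0 H]] := half_period D Hc e32 e21.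
rewrite (period_integral D Hc e32 e21 s00 s0o Pe H).
set z0 := (0 + toC s0 * (- 'i : Cplx R)) in s0o Pe P10 d0.
have [y_ge0|y_lt0] := leP 0 y.
  have [b yb Hb] := ereal_gap_right yhi.
  have -> : toC y - 'i * toC s0 = z0 + toC y * 1 by rewrite /z0; ring.
  apply: (horizontal_ray D Hc e32 e21 (b := b) (q1 := q1)); rewrite ?mulr1 ?mod1 ?y_ge0 //.
  move=> t /andP[t0 tb]; apply: Hq; rewrite Hb // andbT.
  by apply: (lt_le_trans lo0); rewrite lee_fin.
have [b b_y Hb] := ereal_gap_left loy.
have -> : toC y - 'i * toC s0 = z0 + toC (- y) * (-1) by rewrite /z0 toCN; ring.
have opp s : is_derive s (1:R) (fun t : R => - t) (-1).
  exact: is_deriveNid.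
have Hray := @horizontal_ray _ _ _ _ _ _ _ _ _ _ D Hc e32 e21 z0 (-1) (- b)
  (fun t => q (- t)) (fun t => - q1 (- t)) s0o Pe P10 d0.
rewrite Hray ?opprK ?mulrNN ?mulr1 ?modN ?mod1 ?oppr0 ?q10 ?oppr0 //; last first.
  by apply/andP; split; lra.
move=> t /andP[t0 tb].
have [|h1 h2] := Hq (- t).
  rewrite Hb; last by lra.
  by apply: (le_lt_trans _ hi0); rewrite lee_fin oppr_le0.
split.
  have := @is_derive1_comp _ q (fun t : R => - t) t _ _ h1 (opp t).
  by rewrite mulrN1.
have := is_deriveN (@is_derive1_comp _ q1 (fun t : R => - t) t _ _ h2 (opp t)).
by rewrite mulrN1 opprK.
Qed.

(** * The matrix exponential and the generating matrix *)

Section MatrixNorm.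
Variables (R : realType) (m n : nat).
Implicit Types M : 'M[Cplx R]_(m.+1, n.+1).

Lemma entry_le_norm M i j : `|M i j| <= `|M|.
Proof.
have -> : `|M| = mx_norm M by [].
rewrite mx_normE -[leLHS]nngE num_le.
exact: (le_bigmax _ _ (i, j)).
Qed.

Lemma norm_le_entries M (e : R) : 0 <= e -> (forall i j, modulus (M i j) <= e) ->
  `|M| <= toC e.
Proof.
move=> e0 H; have [->|M0] := eqVneq M 0.
  by rewrite normr0 -toC0 lecR.
have [|[i j] E] := @mx_norm_neq0 _ _ _ M.
  by apply: contra_neq M0; exact: mx_norm_eq0.
have -> : `|M| = mx_norm M by [].
by rewrite E mod_norm lecR.
Qed.

End MatrixNorm.

Section RealLimits.
Variable R : realType.

Lemma Cplx_posP (e : Cplx R) : 0 < e -> exists2 e' : R, 0 < e' & e = toC e'.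
Proof.
move=> e0; have eR : e = toC (complex.Re e).
  by apply: cplxP => //; rewrite cImC (ger0_Im (ltW e0)).
by exists (complex.Re e) => //; move: e0; rewrite eR ltcR.
Qed.

Lemma dnbhs0P (V : normedModType (Cplx R)) (q : R -> V) (l : V) :
  q t @[t --> 0^'] --> l <->
  forall e : R, 0 < e -> exists2 d : R, 0 < d &
    forall t, t != 0 -> `|t| < d -> `|q t - l| <= toC e.
Proof.
split=> [/cvgrPdist_le H e e0|H].
  have e0' : 0 < toC e by rewrite ltcR.
  have := H _ e0'; rewrite near_withinE => /nbhs_ballP[d /= d0 Hd].
  exists d => // t t0 td; rewrite distrC; apply: Hd => //.
  by rewrite /ball /= sub0r normrN.
apply/cvgrPdist_le => e /Cplx_posP[e' e'0 ->].
have [d d0 Hd] := H e' e'0.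
rewrite near_withinE; apply/nbhs_ballP; exists d => //= t.
by rewrite /ball /= sub0r normrN distrC => td t0; apply: Hd.
Qed.

(** Reduces derivatives of vectors and matrices to real calculus in each entry. *)
Lemma rquot_mxP m n (v z : Cplx R) (g : Cplx R -> 'M[Cplx R]_(m.+1, n.+1)) (l : 'M[Cplx R]_(m.+1, n.+1)) :
  rquot v g z t @[t --> 0^'] --> l <->
  forall i j, cder (fun t => g (z + toC t * v) i j) 0 (l i j).
Proof.
have E t i j : t != 0 -> modulus ((rquot v g z t - l) i j) * `|t| =
    modulus (g (z + toC (0 + t) * v) i j - g (z + toC 0 * v) i j - toC t * l i j).
  move=> t0; have tC : toC t != 0 by apply: contra_neq t0 => /toCI.
  rewrite -mod_toC -modM; congr modulus.
  by rewrite /rquot !mxE add0r toC0 mul0r addr0; field.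
split=> [/dnbhs0P H i j|H].
  apply/cderP => e /H[d d0 Hd]; exists d => // t td.
  have [->|t0] := eqVneq t 0.
    by rewrite addr0 toC0 !mul0r subrr subr0 mod0 normr0 mulr0.
  rewrite -E // ler_wpM2r //.
  have := le_trans (entry_le_norm _ i j) (Hd t t0 td).
  by rewrite mod_norm lecR.
apply/dnbhs0P => e e0.
have [d Hd] : exists d : R, forall i j, 0 < d /\
    forall t, t != 0 -> `|t| < d -> modulus ((rquot v g z t - l) i j) <= e.
  have /choice[dd Hdd] : forall ij : 'I_m.+1 * 'I_n.+1, exists d : R, 0 < d /\
     forall t, t != 0 -> `|t| < d -> modulus ((rquot v g z t - l) ij.1 ij.2) <= e.
    move=> [i j]; have /cderP/(_ _ e0)[d d0 Hd] := H i j; exists d; split=> // t t0 td.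
    by rewrite -(ler_pM2r (x := `|t|)) ?normr_gt0 // E //; exact: Hd.
  exists (\big[Num.min/1]_ij dd ij) => i j; split.
    by apply: lt_bigmin => // ij _; have [] := Hdd ij.
  move=> t t0 td; have [_] := Hdd (i, j); apply => //.
  exact: (lt_le_trans td (bigmin_le _ _ _)).
exists d; first by have [] := Hd ord0 ord0.
by move=> t t0 td; apply: norm_le_entries (ltW e0) _ => i j; have [_] := Hd i j; apply.
Qed.

Lemma rderive_mx m n (v z : Cplx R) (g : Cplx R -> 'M[Cplx R]_(m.+1, n.+1)) (l : 'M[Cplx R]_(m.+1, n.+1)) :
  (forall i j, cder (fun t => g (z + toC t * v) i j) 0 (l i j)) ->
  rderive v g z = l.
Proof. by move=> /rquot_mxP H; apply: cvg_lim. Qed.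

End RealLimits.

Section MatrixExponential.
Variable R : realType.
Implicit Types A D : 'M[Cplx R]_3.

Definition entry_sum D : R := \sum_(ij : 'I_3 * 'I_3) modulus (D ij.1 ij.2).

Lemma mod_sum (I : finType) (F : I -> Cplx R) :
  modulus (\sum_i F i) <= \sum_i modulus (F i).
Proof.
apply: (big_ind2 (fun (x : Cplx R) y => modulus x <= y)); first by rewrite mod0.
  by move=> x1 x2 y1 y2 h1 h2; apply: le_trans (modD _ _) (lerD h1 h2).
by [].
Qed.

Lemma entry_sum_ge0 D : 0 <= entry_sum D.
Proof. by apply: sumr_ge0 => ij _; exact: mod_ge0. Qed.

Lemma expr_entry_bound D k i j : modulus ((D ^+ k) i j) <= entry_sum D ^+ k.
Proof.
elim: k i j => [|k IH] i j.
  by rewrite !expr0 mxE; case: eqP => _; rewrite ?mod1 ?mod0.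
rewrite !exprS mxE; apply: (le_trans (mod_sum _)).
apply: (@le_trans _ _ (\sum_l modulus (D i l) * entry_sum D ^+ k)).
  by apply: ler_sum => l _; rewrite modM ler_wpM2l ?mod_ge0.
rewrite -mulr_suml ler_wpM2r ?exprn_ge0 ?entry_sum_ge0 //.
rewrite /entry_sum -(pair_big xpredT xpredT (fun i l => modulus (D i l))) /=.
rewrite [leRHS](bigD1 i) //= lerDl sumr_ge0 // => l _; apply: sumr_ge0 => l' _.
exact: mod_ge0.
Qed.

Definition exp_partial A n : 'M[Cplx R]_3 :=
  \sum_(k < n) (k`!%:R : Cplx R)^-1 *: A ^+ k.

Lemma exp_partial_diff A m n i j : (m <= n)%N ->
  modulus ((exp_partial A n - exp_partial A m) i j) <=
  series (exp_coeff (entry_sum A)) n - series (exp_coeff (entry_sum A)) m.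
Proof.
elim: n => [|n IH]; first by rewrite leqn0 => /eqP ->; rewrite !subrr mxE mod0.
rewrite leq_eqVlt => /predU1P[->|]; first by rewrite !subrr mxE mod0.
rewrite ltnS => /IH {}IH; rewrite /exp_partial big_ord_recr /= -/(exp_partial A n).
rewrite seriesSr addrAC [in leRHS]addrAC mxE (le_trans (modD _ _)) // lerD //.
rewrite mxE modM modV mod_nat /exp_coeff /= mulrC ler_wpM2r ?invr_ge0 //.
exact: expr_entry_bound.
Qed.

(** The scalar exponential series of [entry_sum A] majorizes every entry, which yields both the
    convergence and the remainder. *)
Lemma expmx_entry A m i j :
  exp_partial A n @[n --> \oo] --> expmx A /\
  modulus ((expmx A - exp_partial A m) i j) <=
    expR (entry_sum A) - series (exp_coeff (entry_sum A)) m.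
Proof.
set a := entry_sum A.
have ca : cvgn (series (exp_coeff a)) by exact: is_cvg_series_exp_coeff.
have nd : nondecreasing_seq (series (exp_coeff a)).
  apply: nondecreasing_series => k _ _.
  by rewrite /exp_coeff /= divr_ge0 // exprn_ge0 // entry_sum_ge0.
have le_exp n : series (exp_coeff a) n <= expR a by exact: nondecreasing_cvgn_le.
have /choice[L HL] : forall ij : 'I_3 * 'I_3, exists l,
    cseq (fun n => exp_partial A n ij.1 ij.2) l.
  move=> [i' j']; apply: cauchy_cseq => e e0.
  have /cvgrPdist_le/(_ e e0)[N _ HN] := ca.
  exists N => n Nn.
  have := exp_partial_diff A i' j' Nn; rewrite !mxE => /le_trans; apply.
  have := HN N (leqnn N); rewrite /= -/(expR a) ger0_norm ?subr_ge0 //.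
  by apply: le_trans; rewrite lerD2r.
pose M : 'M[Cplx R]_3 := \matrix_(i, j) L (i, j).
have bnd k i' j' : modulus ((M - exp_partial A k) i' j') <= expR a - series (exp_coeff a) k.
  have HL' : cseq (fun n => exp_partial A n i' j' - exp_partial A k i' j') (L (i', j') - exp_partial A k i' j').
    exact: cseqD (HL (i', j')) (cseq_cst _).
  rewrite !mxE; apply: (cseq_bound_ev (N0 := k) HL') => n kn.
  have := exp_partial_diff A i' j' kn; rewrite !mxE => /le_trans; apply.
  by rewrite lerD2r.
have cM : exp_partial A n @[n --> \oo] --> M.
  apply/cvgrPdist_le => e /Cplx_posP[e' e'0 ->].
  have /cvgrPdist_le/(_ e' e'0)[N _ HN] := ca.
  exists N => // n /= /HN h; apply: norm_le_entries (ltW e'0) _ => i' j'.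
  apply: (le_trans (bnd n i' j')); apply: le_trans h.
  by rewrite -/(expR a) ler_norm.
have E : expmx A = M.
  rewrite /expmx; apply: cvg_lim => //; apply: cvg_trans cM; apply: near_eq_cvg.
  by apply: nearW => n; rewrite /exp_partial /series /= big_mkord.
by rewrite E.
Qed.

(** The remainder after two terms is at most e^x - 1 - x with x = [entry_sum (toC t *: D)], which is
    of second order in [t]. *)
Lemma expmx_derive D i j : cder (fun t => expmx (toC t *: D) i j) 0 (D i j).
Proof.
pose a := entry_sum D; have a0 : 0 <= a by exact: entry_sum_ge0.
have es t : entry_sum (toC t *: D) = `|t| * a.
  by rewrite /entry_sum mulr_sumr; apply: eq_bigr => ij _; rewrite mxE modM mod_toC.
have E0 : expmx (0 : 'M[Cplx R]_3) = 1.
  apply: cvg_lim => //; apply: (@cvg_trans _ ((fun=> 1 : 'M[Cplx R]_3) @ \oo)); last exact: cvg_cst.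
  apply: near_eq_cvg; exists 1%N => // n /= n0; rewrite /series /= big_mkord.
  case: n n0 => // n _; rewrite big_ord_recl /= expr0 fact0 invr1 scale1r big1 ?addr0 //.
  by move=> k _; rewrite exprS mul0r scaler0.
have P2 t : exp_partial (toC t *: D) 2 = 1 + toC t *: D.
  by rewrite /exp_partial !big_ord_recl big_ord0 /= addr0 expr0 expr1 /bump /= !invr1 !scale1r.
pose C := a ^+ 2 * expR a.
apply: (@cder_quadratic _ _ _ _ C 1) => // t t1.
rewrite add0r toC0 scale0r E0.
have [_] := expmx_entry (toC t *: D) 2 i j; rewrite P2 es.
set X := _ - _; have -> : X i j = expmx (toC t *: D) i j - (1 : 'M[Cplx R]_3) i j - toC t * D i j.
  by rewrite /X !mxE opprD addrA.
move=> /le_trans; apply.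
have h0 : 0 <= `|t| * a by rewrite mulr_ge0.
have h1 : `|t| * a <= a by rewrite ler_piMl // ltW.
suff : forall x : R, 0 <= x -> expR x - series (exp_coeff x) 2 <= x ^+ 2 * expR x.
  move=> /(_ _ h0) /le_trans; apply.
  rewrite exprMn /C [leRHS]mulrC -mulrA ler_wpM2l ?exprn_ge0 //.
  by rewrite ler_wpM2l ?exprn_ge0 // ler_expR.
move=> x x0.
have -> : series (exp_coeff x) 2 = 1 + x.
  by rewrite /series /= !big_nat_recr //= big_geq // /exp_coeff /= add0r expr0 expr1 !divr1.
(* Multiplied by [expR x] this gives e^x - 1 <= x e^x; used twice, it bounds e^x - 1 - x by x^2
   e^x. *)
have : 1 - x <= expR (- x) by have := expR_ge1Dx (- x).
have e0 : 0 < expR x by exact: expR_gt0.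
rewrite -(ler_pM2r e0) -expRD addNr expR0 => h.
have h2 : 1 + x <= expR x by exact: expR_ge1Dx.
have h3 : x * (expR x - 1) <= x * (x * expR x) by rewrite ler_wpM2l //; lra.
by rewrite expr2 -mulrA; lra.
Qed.

End MatrixExponential.

Lemma dz_dzbar_dx (R : realType) (V : normedModType (Cplx R)) (g : Cplx R -> V) z :
  dz g z + dzbar g z = dx g z.
Proof.
rewrite /dz /dzbar -scalerDr addrACA addNr addr0.
have -> : dx g z + dx g z = (1 + 1 : Cplx R) *: dx g z by rewrite scalerDl scale1r.
by rewrite scalerA mulVf ?scale1r // (pnatr_eq0 _ 2).
Qed.

(** [D 1] is the x-derivative of the frame at 0, hence the sum of the two frame matrices. The value
    lam = 1 suffices because [a] and [b] do not depend on lam. *)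
Lemma generating_matrix_hopf (R : realType) (S : set (Cplx R)) (u : R -> R)
    (psi : Cplx R) (FF : Cplx R -> Cplx R -> 'M[Cplx R]_3)
    (D : Cplx R -> 'M[Cplx R]_3) (alpha a b : Cplx R) :
  S 0 -> extended_frame S u psi FF -> generating_matrix S FF D ->
  (forall lam : Cplx R, `|lam| = 1 -> D lam = gen_form alpha a b lam) ->
  psi = - 'i * a ^+ 2 * b.
Proof.
move=> S0 HFF HD Hform.
have n1 : `|1 : Cplx R| = 1 by rewrite normr1.
have [F0 /(_ 0 S0)[_ _]] := HFF 1 n1; rewrite F0 invmx1 !mul1mx => Hz Hzb.
have Hx : dx (FF^~ 1) 0 = D 1.
  apply: rderive_mx => i j.
  rewrite (_ : (fun t => _) = (fun t => expmx (toC t *: D 1) i j)).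
    exact: expmx_derive.
  apply/funext => t.
  by have := HD 1 n1 t 0 S0; rewrite F0 mulmx1 addr0 add0r mulr1 => ->.
have := dz_dzbar_dx (FF^~ 1) 0; rewrite Hz Hzb Hx (Hform 1 n1) => E.
pose o0 : 'I_3 := ord0; pose o1 : 'I_3 := lift ord0 ord0; pose o2 : 'I_3 := ord_max.
(* These two entries come from [frame_z] alone: a = i e^(u/2) and b = - i psi e^(- u). *)
have := congr1 (fun M : 'M[Cplx R]_3 => M o0 o2) E.
have := congr1 (fun M : 'M[Cplx R]_3 => M o1 o0) E.
rewrite !mxE /= !invr1 !mul1r !mulr1 !addr0 => <- <-.
set eh := toC (expR _); set em := toC (expR _).
have ee : eh ^+ 2 * em = 1.
  rewrite -toCX -toCM -expRM_natl -expRD (_ : _ + _ = 0) ?expR0 //.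
  by rewrite -mulr_natl; field.
rewrite exprMn (sqr_i R).
rewrite (_ : _ * _ = - 'i ^+ 2 * (-1) * (-1) * psi * (eh ^+ 2 * em)); last by ring.
by rewrite (sqr_i R) ee; ring.
Qed.

(** * Symmetry of mixed partial derivatives *)

Section Schwarz.
Variable R : realType.

(** The second difference over a small square is evaluated by mean values in both orders. *)
Lemma schwarz_real (f fx fy fxy fyx : R -> R -> R) (d : R) : 0 < d ->
  (forall a b : R, `|a| < d -> `|b| < d ->
     [/\ is_derive a 1 (f^~ b) (fx a b), is_derive b 1 (f a) (fy a b),
         is_derive b 1 (fx a) (fxy a b) & is_derive a 1 (fy^~ b) (fyx a b)]) ->
  (forall e : R, 0 < e -> exists2 r : R, 0 < r & forall a b : R, `|a| < r -> `|b| < r ->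
     `|fxy a b - fxy 0 0| <= e /\ `|fyx a b - fyx 0 0| <= e) ->
  fxy 0 0 = fyx 0 0.
Proof.
move=> d0 H C; apply/eqP; rewrite -subr_eq0 -normr_eq0 eq_le normr_ge0 andbT.
apply/ler_addgt0Pr => e e0; rewrite add0r.
have e2 : 0 < e / 2 by rewrite divr_gt0.
have [r r0 Hr] := C _ e2.
pose h := Num.min d r / 2.
have m0 : 0 < Num.min d r by rewrite lt_min d0.
have h0 : 0 < h by rewrite divr_gt0.
have hd : h < d by have : Num.min d r <= d by [rewrite ge_min lexx]; rewrite /h; lra.
have hr : h < r by have : Num.min d r <= r by [rewrite ge_min lexx orbT]; rewrite /h; lra.
have I t : 0 <= t <= h -> `|t| < d by move=> /andP[t0 th]; rewrite ger0_norm //; lra.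
have Ir t : 0 < t < h -> `|t| < r by move=> /andP[t0 th]; rewrite gtr0_norm //; lra.
have I0 : `|0 : R| < d by rewrite normr0.
have Ih : `|h| < d by rewrite gtr0_norm.
pose De := f h h - f h 0 - (f 0 h - f 0 0).
have [|xi xih Exi] := @mean_value _ (fun a => f a h - f a 0)
   (fun a => fx a h - fx a 0) 0 h h0.
  move=> s sh; have [h1 _ _ _] := H s h (I s sh) Ih.
  by have [h2 _ _ _] := H s 0 (I s sh) I0; exact: is_deriveB.
have xid : `|xi| < d by apply: I; move: xih => /andP[? ?]; rewrite !ltW.
have [|et eth Eet] := @mean_value _ (fx xi) (fxy xi) 0 h h0.
  by move=> s sh; have [_ _ h1 _] := H xi s xid (I s sh).
have [|et' eth' Eet'] := @mean_value _ (fun b => f h b - f 0 b)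
   (fun b => fy h b - fy 0 b) 0 h h0.
  move=> s sh; have [_ h1 _ _] := H h s Ih (I s sh).
  by have [_ h2 _ _] := H 0 s I0 (I s sh); exact: is_deriveB.
have etd' : `|et'| < d by apply: I; move: eth' => /andP[? ?]; rewrite !ltW.
have [|xi' xih' Exi'] := @mean_value _ (fy^~ et') (fyx^~ et') 0 h h0.
  by move=> s sh; have [_ _ _ h1] := H s et' (I s sh) etd'.
have E1 : De = fxy xi et * (h * h).
  by rewrite /De; move: Exi; rewrite Eet !subr0 => ->; ring.
have E2 : De = fyx xi' et' * (h * h).
  move: Eet'; rewrite Exi' !subr0 /De => E; rewrite mulrA -E; ring.
have hh : h * h != 0 by rewrite mulf_neq0 // gt_eqF.
have E3 : fxy xi et = fyx xi' et' by apply: (mulIf hh); rewrite -E1 -E2.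
have [h1 _] := Hr xi et (Ir _ xih) (Ir _ eth).
have [_ h2] := Hr xi' et' (Ir _ xih') (Ir _ eth').
have -> : fxy 0 0 - fyx 0 0 = (fyx xi' et' - fyx 0 0) - (fxy xi et - fxy 0 0).
  by rewrite E3; ring.
by rewrite (le_trans (ler_normB _ _)) // [e]splitr addrC lerD.
Qed.

Definition pd (v : Cplx R) (f : Cplx R -> Cplx R) (z l : Cplx R) :=
  cder (fun t => f (z + toC t * v)) 0 l.

Lemma pd_shift v f (z l : Cplx R) (s : R) : pd v f (z + toC s * v) l ->
  cder (fun t => f (z + toC t * v)) s l.
Proof.
move=> /cderP H; apply/cderP => e /H[d d0 Hd]; exists d => // h /Hd.
by rewrite add0r toC0 mul0r addr0 (toCD s h) mulrDl addrA.
Qed.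

Lemma cder_Re p s (l : Cplx R) : cder p s l ->
  is_derive s 1 (fun t => complex.Re (p t)) (complex.Re l).
Proof. by case. Qed.

Lemma cder_Im p s (l : Cplx R) : cder p s l ->
  is_derive s 1 (fun t => complex.Im (p t)) (complex.Im l).
Proof. by case. Qed.

Lemma schwarz (f fx fy fxy fyx : Cplx R -> Cplx R) (z : Cplx R) (d : R) : 0 < d ->
  (forall w, modulus (w - z) < d -> [/\ pd 1 f w (fx w), pd 'i f w (fy w),
      pd 'i fx w (fxy w) & pd 1 fy w (fyx w)]) ->
  (forall e : R, 0 < e -> exists2 r : R, 0 < r & forall w, modulus (w - z) < r ->
     modulus (fxy w - fxy z) <= e /\ modulus (fyx w - fyx z) <= e) ->
  fxy z = fyx z.
Proof.
move=> d0 H C.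
pose pt (a b : R) : Cplx R := z + toC a * 1 + toC b * 'i.
have ptE a b : pt a b = z + toC b * 'i + toC a * 1 by rewrite /pt addrAC.
have pt00 : pt 0 0 = z by rewrite /pt !toC0 !mul0r !addr0.
have near (r : R) a b : `|a| < r / 2 -> `|b| < r / 2 -> modulus (pt a b - z) < r.
  move=> h1 h2; have -> : pt a b - z = toC a * 1 + toC b * 'i by rewrite /pt; ring.
  rewrite (le_lt_trans (modD _ _)) //.
  by rewrite !modM mod1 modi !mulr1 !mod_toC; lra.
have d2 : 0 < d / 2 by rewrite divr_gt0.
have K (g : Cplx R -> R) : (forall p s l, cder p s l -> is_derive s 1 (fun t => g (p t)) (g l)) ->
    (forall x y : Cplx R, `|g x - g y| <= modulus (x - y)) -> g (fxy z) = g (fyx z).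
  move=> gd gl; rewrite -pt00.
  apply: (@schwarz_real (fun a b => g (f (pt a b))) (fun a b => g (fx (pt a b)))
    (fun a b => g (fy (pt a b))) (fun a b => g (fxy (pt a b))) (fun a b => g (fyx (pt a b))) _ d2).
    move=> a b ad bd; have [h1 h2 h3 h4] := H _ (near d a b ad bd).
    split.
    - move: h1; rewrite [X in pd _ _ X _]ptE => /pd_shift/gd.
      by under eq_fun do rewrite -ptE.
    - exact: (gd _ _ _ (pd_shift h2)).
    - exact: (gd _ _ _ (pd_shift h3)).
    - move: h4; rewrite [X in pd _ _ X _]ptE => /pd_shift/gd.
      by under eq_fun do rewrite -ptE.
  move=> e /C[r r0 Hr]; exists (r / 2); first by rewrite divr_gt0.
  move=> a b ha hb; have [h1 h2] := Hr _ (near r a b ha hb); rewrite pt00.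
  by split; apply: (le_trans (gl _ _)).
apply: cplxP; apply: K.
- exact: cder_Re.
- by move=> x y; have := ler_Re_mod (x - y); rewrite !compE.
- exact: cder_Im.
- by move=> x y; have := ler_Im_mod (x - y); rewrite !compE.
Qed.

End Schwarz.

Section Hermitian.
Variable R : realType.
Implicit Types (X Y Z : 'cV[Cplx R]_3) (c : Cplx R).

Lemma hdotDl X Y Z : hdot (X + Y) Z = hdot X Z + hdot Y Z.
Proof. by rewrite /hdot -big_split; apply: eq_bigr => k _; rewrite mxE mulrDl. Qed.

Lemma hdotZl c X Y : hdot (c *: X) Y = c * hdot X Y.
Proof. by rewrite /hdot big_distrr; apply: eq_bigr => k _; rewrite mxE /= mulrA. Qed.

Lemma hdotC X Y : hdot Y X = (hdot X Y)^*.
Proof.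
rewrite /hdot rmorph_sum; apply: eq_bigr => k _.
by rewrite rmorphM /= conjCK mulrC.
Qed.

Lemma hdotDr X Y Z : hdot X (Y + Z) = hdot X Y + hdot X Z.
Proof. by rewrite hdotC hdotDl rmorphD /= -!hdotC. Qed.

Lemma hdotZr c X Y : hdot X (c *: Y) = c^* * hdot X Y.
Proof. by rewrite hdotC hdotZl rmorphM /= -hdotC. Qed.

Lemma hdotNl X Y : hdot (- X) Y = - hdot X Y.
Proof. by rewrite -scaleN1r hdotZl mulN1r. Qed.

Lemma hdotNr X Y : hdot X (- Y) = - hdot X Y.
Proof. by rewrite hdotC hdotNl rmorphN /= -hdotC. Qed.

Lemma hdotBl X Y Z : hdot (X - Y) Z = hdot X Z - hdot Y Z.
Proof. by rewrite hdotDl hdotNl. Qed.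

Lemma hdotBr X Y Z : hdot X (Y - Z) = hdot X Y - hdot X Z.
Proof. by rewrite hdotDr hdotNr. Qed.

Lemma Im_hdot X : complex.Im (hdot X X) = 0.
Proof. by have := congr1 (@complex.Im R) (hdotC X X); rewrite cImJ; lra. Qed.

(** The conjugated frame is a square matrix with a right inverse built from the frame itself; it is
    therefore invertible, and it annihilates [X]. *)
Lemma orthogonal_frame_eq0 (e : 'I_3 -> 'cV[Cplx R]_3) (n : 'I_3 -> Cplx R) X :
  (forall i j, hdot (e i) (e j) = if i == j then n i else 0) ->
  (forall i, n i != 0) -> (forall i, hdot X (e i) = 0) -> X = 0.
Proof.
move=> He n0 HX.
pose M : 'M[Cplx R]_3 := \matrix_(i, k) (e i k 0)^*.
pose N : 'M[Cplx R]_3 := \matrix_(k, j) ((n j)^-1 * e j k 0).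
have MN : M *m N = 1%:M.
  apply/matrixP => i j; rewrite mxE.
  have -> : \sum_k M i k * N k j = (n j)^-1 * hdot (e j) (e i).
    by rewrite /hdot big_distrr; apply: eq_bigr => k _; rewrite !mxE /= mulrCA; congr (_ * _); rewrite mulrC.
  rewrite He mxE; have [_|_] := eqVneq i j; first by rewrite mulVf.
  by rewrite mulr0.
have [Mu _] := mulmx1_unit MN.
have MX : M *m X = 0.
  apply/matrixP => i j; rewrite !mxE -[RHS](HX i) /hdot.
  by apply: eq_bigr => k _; rewrite !mxE ord1 mulrC.
by rewrite -[X]mul1mx -(mulVmx Mu) -mulmxA MX mulmx0.
Qed.

End Hermitian.

(** * Horizontal lifts and the Gauss equation *)

Section LineDerivatives.
Variable R : realType.
Implicit Types (X Y : Cplx R -> 'cV[Cplx R]_3) (l m : 'cV[Cplx R]_3)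
  (v z c : Cplx R) (f : Cplx R -> Cplx R).

Definition isrd v X z l := rquot v X z t @[t --> 0^'] --> l.

Lemma isrdP v X z l : isrd v X z l <->
  forall i, cder (fun t => X (z + toC t * v) i 0) 0 (l i 0).
Proof.
split=> [/rquot_mxP H i|H]; first exact: H.
by apply/rquot_mxP => i j; rewrite (ord1 j).
Qed.

Lemma isrd_val v X z l : isrd v X z l -> rderive v X z = l.
Proof. by move=> H; apply: cvg_lim. Qed.

Lemma isrd_rderivable v X z l : isrd v X z l -> rderivable v X z.
Proof. by move=> H; apply/cvg_ex; exists l. Qed.

Lemma at0 z v : z + toC 0 * v = z.
Proof. by rewrite toC0 mul0r addr0. Qed.

Lemma pd_cst v z c : pd v (fun=> c) z 0.
Proof. exact: cder_cst. Qed.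

Lemma isrd_comb v X Y z l m (a b : Cplx R) : isrd v X z l -> isrd v Y z m ->
  isrd v (fun w => a *: X w + b *: Y w) z (a *: l + b *: m).
Proof.
move=> /isrdP HX /isrdP HY; apply/isrdP => i.
under eq_fun do rewrite !mxE; rewrite !mxE.
exact: cderD (cderZ a (HX i)) (cderZ b (HY i)).
Qed.

Lemma isrd_scale v f X z c l : pd v f z c -> isrd v X z l ->
  isrd v (fun w => f w *: X w) z (c *: X z + f z *: l).
Proof.
move=> Hf /isrdP HX; apply/isrdP => i.
under eq_fun do rewrite !mxE; rewrite !mxE.
by have := cderM Hf (HX i); rewrite !at0 addrC.
Qed.

Lemma pd_sum (I : Type) (s : seq I) v (f : I -> Cplx R -> Cplx R) z (l : I -> Cplx R) :
  (forall i, pd v (f i) z (l i)) ->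
  pd v (fun w => \sum_(i <- s) f i w) z (\sum_(i <- s) l i).
Proof.
move=> H; elim: s => [|i s IH].
  by rewrite big_nil; under eq_fun do rewrite big_nil; exact: pd_cst.
rewrite big_cons; under eq_fun do rewrite big_cons; exact: cderD (H i) IH.
Qed.

Lemma pd_hdot v X Y z l m : isrd v X z l -> isrd v Y z m ->
  pd v (fun w => hdot (X w) (Y w)) z (hdot l (Y z) + hdot (X z) m).
Proof.
move=> /isrdP HX /isrdP HY; rewrite addrC /hdot -big_split.
by apply: pd_sum => k; have := cderM (HX k) (cderJ (HY k)); rewrite !at0.
Qed.

Lemma line_open (U : set (Cplx R)) v z : open U -> U z ->
  exists2 d : R, 0 < d & forall t : R, `|t| < d -> U (z + toC t * v).
Proof.
move=> oU Uz; have /nbhs_ballP[e /= /Cplx_posP[e' e'0 ->] He] := open_nbhs_nbhs (conj oU Uz).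
have [d d0 Hd] := line_small v e'0.
exists d => // t /Hd h; apply: He; rewrite /ball /=.
by rewrite opprD addrA subrr add0r normrN mod_norm ltcR.
Qed.

Lemma modulus_open (U : set (Cplx R)) z : open U -> U z ->
  exists2 d : R, 0 < d & forall w : Cplx R, modulus (w - z) < d -> U w.
Proof.
move=> oU Uz; have /nbhs_ballP[e /= /Cplx_posP[d d0 ->] He] := open_nbhs_nbhs (conj oU Uz).
by exists d => // w wz; apply: He; rewrite /ball /= mod_norm ltcR modBC.
Qed.

Lemma pd_local (U : set (Cplx R)) v f (g : Cplx R -> Cplx R) z c : open U -> U z ->
  (forall w, U w -> f w = g w) -> pd v f z c -> pd v g z c.
Proof.
move=> oU Uz fg Hf; have [d d0 Hd] := line_open v oU Uz.
by apply: (cder_near d0 _ Hf) => t; rewrite subr0 => /Hd; exact: fg.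
Qed.

Lemma isrd_local (U : set (Cplx R)) v X Y z l : open U -> U z ->
  (forall w, U w -> X w = Y w) -> isrd v X z l -> isrd v Y z l.
Proof.
move=> oU Uz XY /isrdP H; apply/isrdP => i.
have E w : U w -> X w i 0 = Y w i 0 by move=> Uw; rewrite XY.
exact: (pd_local oU Uz E (H i)).
Qed.

Lemma pd_Im (W : R -> R) (W' : R) z : is_derive (complex.Im z) 1 W W' ->
  pd 1 (fun w => toC (W (complex.Im w))) z 0 /\
  pd 'i (fun w => toC (W (complex.Im w))) z (toC W').
Proof.
move=> HW; split; rewrite /pd.
  rewrite (_ : (fun t => _) = fun=> toC (W (complex.Im z))); first exact: cder_cst.
  by apply/funext => t; rewrite !compE mulr0 mul0r !addr0.
rewrite (_ : (fun t => _) = fun t => toC (W (complex.Im z + t))); last first.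
  by apply/funext => t; rewrite !compE mulr1 mul0r addr0.
apply: cder_toC; apply/is_deriveP => e e0.
have [d d0 Hd] := (is_deriveP _ _ _).1 HW e e0.
by exists d => // h /Hd; rewrite add0r addr0.
Qed.

Lemma pd_Im_inv (W : R -> R) z c :
  pd 'i (fun w => toC (W (complex.Im w))) z c -> is_derive (complex.Im z) 1 W (complex.Re c).
Proof.
move=> /cder_Re; rewrite (_ : (fun t => _) = fun t => W (complex.Im z + t)); last first.
  by apply/funext => t; rewrite !compE mulr1 mul0r addr0.
move=> /is_deriveP H; apply/is_deriveP => e /H[d d0 Hd].
by exists d => // h /Hd; rewrite add0r addr0.
Qed.


End LineDerivatives.

Section ClassCn.
Variables (R : realType) (U : set (Cplx R)).
Hypothesis oU : open U.
Implicit Types (X Y : Cplx R -> 'cV[Cplx R]_3) (z : Cplx R).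

Lemma classCn_cont n X : classCn n U X -> forall z, U z -> {for z, continuous X}.
Proof. by case: n => [|n] []. Qed.

Lemma continuous_local X Y z : (forall w, U w -> X w = Y w) -> U z ->
  {for z, continuous X} -> {for z, continuous Y}.
Proof.
move=> XY Uz; rewrite /prop_for /continuous_at XY // => cX.
have UE : U `<=` [set w | X w = Y w] by move=> w Uw /=; rewrite XY.
have nU : nbhs z [set w | X w = Y w].
  by apply: filterS UE _; exact: (open_nbhs_nbhs (conj oU Uz)).
exact: (cvg_trans (@near_eq_cvg _ _ (nbhs z) _ X Y nU) cX).
Qed.

Lemma classCn_d n X : classCn n.+1 U X -> classCn n U (dx X) /\ classCn n U (dy X).
Proof. by move=> [_ [_ Hx Hy]]; split; [exact: Hx|exact: Hy]. Qed.

Lemma classCn_isrd n X z : classCn n.+1 U X -> U z ->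
  isrd 1 X z (dx X z) /\ isrd 'i X z (dy X z).
Proof. by move=> [_ [H _ _]] /H. Qed.

Lemma classCn_eq n X Y : (forall z, U z -> X z = Y z) -> classCn n U X -> classCn n U Y.
Proof.
elim: n X Y => [|n IH] X Y XY HX.
  split=> // z Uz; exact: (continuous_local XY Uz (classCn_cont HX Uz)).
split.
  move=> z Uz; exact: (continuous_local XY Uz (classCn_cont HX Uz)).
have E z : U z -> isrd 1 Y z (dx X z) /\ isrd 'i Y z (dy X z).
  move=> Uz; have [h1 h2] := classCn_isrd HX Uz.
  by split; [exact: (isrd_local oU Uz XY h1)|exact: (isrd_local oU Uz XY h2)].
have [_ [_ Hx Hy]] := HX; split.
- by move=> z /E[h1 h2]; split; [exact: (isrd_rderivable h1)|exact: (isrd_rderivable h2)].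
- by apply: IH Hx => z /E[h1 _]; rewrite /dx (isrd_val h1).
- by apply: IH Hy => z /E[_ h1]; rewrite /dy (isrd_val h1).
Qed.

Lemma classCn_comb n X Y (a b : Cplx R) : classCn n U X -> classCn n U Y ->
  classCn n U (fun w => a *: X w + b *: Y w).
Proof.
have C k (X' Y' : Cplx R -> 'cV[Cplx R]_3) : classCn k U X' -> classCn k U Y' ->
    forall z, U z -> {for z, continuous (fun w => a *: X' w + b *: Y' w)}.
  move=> HX HY z Uz.
  have hX : X' @ z --> X' z := classCn_cont HX Uz.
  have hY : Y' @ z --> Y' z := classCn_cont HY Uz.
  exact: (cvgD (cvgZl_tmp (k := a) hX) (cvgZl_tmp (k := b) hY)).
elim: n X Y => [|n IH] X Y HX HY; first by split=> //; exact: (C 0%N X Y HX HY).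
split; first exact: (C n.+1 X Y HX HY).
have E z : U z -> isrd 1 (fun w => a *: X w + b *: Y w) z (a *: dx X z + b *: dx Y z) /\
   isrd 'i (fun w => a *: X w + b *: Y w) z (a *: dy X z + b *: dy Y z).
  move=> Uz; have [h1 h2] := classCn_isrd HX Uz; have [h3 h4] := classCn_isrd HY Uz.
  by split; exact: isrd_comb.
have [_ [_ HXx HXy]] := HX; have [_ [_ HYx HYy]] := HY; split.
- by move=> z /E[h1 h2]; split; [exact: (isrd_rderivable h1)|exact: (isrd_rderivable h2)].
- by apply: classCn_eq (IH _ _ HXx HYx) => z /E[h1 _]; rewrite /dx (isrd_val h1).
- by apply: classCn_eq (IH _ _ HXy HYy) => z /E[_ h1]; rewrite /dy (isrd_val h1).
Qed.

Lemma classCn_dz n X : classCn n.+1 U X -> classCn n U (dz X) /\ classCn n U (dzbar X).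
Proof.
move=> [_ [_ HX HY]]; split.
  rewrite (_ : dz X = fun w => 2^-1 *: dx X w + (2^-1 * - 'i) *: dy X w).
    exact: (@classCn_comb n (dx X) (dy X) 2^-1 (2^-1 * - 'i) HX HY).
  by apply/funext => w; rewrite /dz scalerBr scalerA mulrN scaleNr.
rewrite (_ : dzbar X = fun w => 2^-1 *: dx X w + (2^-1 * 'i) *: dy X w).
  exact: (@classCn_comb n (dx X) (dy X) 2^-1 (2^-1 * 'i) HX HY).
by apply/funext => w; rewrite /dzbar scalerDr scalerA.
Qed.

Lemma classCn_entry_cont n X z i : classCn n U X -> U z ->
  forall e : R, 0 < e -> exists2 r : R, 0 < r & forall w, modulus (w - z) < r ->
    modulus (X w i 0 - X z i 0) <= e.
Proof.
move=> HX Uz e e0; have /cvgrPdist_le := classCn_cont HX Uz.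
have e0' : 0 < toC e by rewrite ltcR.
move=> /(_ _ e0') /nbhs_ballP[d /= /Cplx_posP[r r0 ->] Hr].
exists r => // w wz.
have : `|X z - X w| <= toC e by apply: Hr; rewrite /ball /= mod_norm ltcR modBC.
move=> /(le_trans (entry_le_norm _ i 0)); rewrite mod_norm lecR !mxE.
by rewrite modBC.
Qed.

Lemma dxdy_comm X z : classCn 2 U X -> U z -> dx (dy X) z = dy (dx X) z.
Proof.
move=> HX Uz.
have [HXx HXy] := classCn_d HX; have [_ HXxy] := classCn_d HXx.
have [HXyx _] := classCn_d HXy.
apply/matrixP => i j; rewrite (ord1 j); symmetry.
have [d d0 Hd] := modulus_open oU Uz.
apply: (@schwarz _ (fun w => X w i 0) (fun w => dx X w i 0) (fun w => dy X w i 0)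
  (fun w => dy (dx X) w i 0) (fun w => dx (dy X) w i 0) z d d0).
  move=> w /Hd Uw; have [/isrdP h1 /isrdP h2] := classCn_isrd HX Uw.
  have [_ /isrdP h3] := classCn_isrd HXx Uw; have [/isrdP h4 _] := classCn_isrd HXy Uw.
  by split; [exact: h1|exact: h2|exact: h3|exact: h4].
move=> e e0; have [r1 r10 H1] := classCn_entry_cont i HXxy Uz e0.
have [r2 r20 H2] := classCn_entry_cont i HXyx Uz e0.
exists (Num.min r1 r2); first by rewrite lt_min r10.
move=> w; rewrite lt_min => /andP[w1 w2].
by split; [exact: (H1 w w1)|exact: (H2 w w2)].
Qed.

End ClassCn.

Section HopfAlgebra.
Variable R : realType.
Implicit Types A B C D X Y : 'cV[Cplx R]_3.

Lemma conj_half : (2^-1 : Cplx R)^* = 2^-1.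
Proof. by rewrite fmorphV /= conjC_nat. Qed.

Lemma hdot_half1 A B C D X Y :
  hdot (2^-1 *: (A - 'i *: B)) Y + hdot X (2^-1 *: (C + 'i *: D)) =
  2^-1 * ((hdot A Y + hdot X C) - 'i * (hdot B Y + hdot X D)).
Proof.
rewrite hdotZl hdotZr hdotBl hdotDr hdotZl hdotZr conj_half conjCi.
by move: (hdot A Y) (hdot X C) (hdot B Y) (hdot X D) => a b c d; ring.
Qed.

Lemma hdot_half2 A B C D X Y :
  hdot (2^-1 *: (A + 'i *: B)) Y + hdot X (2^-1 *: (C - 'i *: D)) =
  2^-1 * ((hdot A Y + hdot X C) + 'i * (hdot B Y + hdot X D)).
Proof.
rewrite hdotZl hdotZr hdotDl hdotBr hdotZl hdotZr conj_half conjCi.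
by move: (hdot A Y) (hdot X C) (hdot B Y) (hdot X D) => a b c d; ring.
Qed.

Lemma laplace_algebra1 A B C :
  2^-1 *: (2^-1 *: A + (2^-1 * - 'i) *: B + 'i *: (2^-1 *: B + (2^-1 * - 'i) *: C))
    = (4^-1 : Cplx R) *: (A + C).
Proof.
apply/matrixP => i j; rewrite !mxE.
move: (A i j) (B i j) (C i j) => a b c.
transitivity (4^-1 * (a + (- 'i ^+ 2) * c)); first by field.
by rewrite sqrCi opprK mul1r.
Qed.

Lemma laplace_algebra2 A B C :
  2^-1 *: (2^-1 *: A + (2^-1 * 'i) *: B - 'i *: (2^-1 *: B + (2^-1 * 'i) *: C))
    = (4^-1 : Cplx R) *: (A + C).
Proof.
apply/matrixP => i j; rewrite !mxE.
move: (A i j) (B i j) (C i j) => a b c.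
transitivity (4^-1 * (a + (- 'i ^+ 2) * c)); first by field.
by rewrite sqrCi opprK mul1r.
Qed.

Lemma orthogonal_triple_eq0 A B C X (a b c : Cplx R) : a != 0 -> b != 0 -> c != 0 ->
  hdot A A = a -> hdot B B = b -> hdot C C = c ->
  hdot A B = 0 -> hdot A C = 0 -> hdot B C = 0 ->
  hdot X A = 0 -> hdot X B = 0 -> hdot X C = 0 -> X = 0.
Proof.
move=> a0 b0 c0 AA BB CC AB AC BC XA XB XC.
have BA : hdot B A = 0 by rewrite hdotC AB conjC0.
have CA : hdot C A = 0 by rewrite hdotC AC conjC0.
have CB : hdot C B = 0 by rewrite hdotC BC conjC0.
apply: (@orthogonal_frame_eq0 _ (fun i : 'I_3 => nth 0 [:: A; B; C] i)
  (fun i : 'I_3 => nth 0 [:: a; b; c] i)).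
- by move=> [[|[|[|//]]] Hi] [[|[|[|//]]] Hj].
- by move=> [[|[|[|//]]] Hi].
- by move=> [[|[|[|//]]] Hi].
Qed.

End HopfAlgebra.

Section HopfCalculus.
Variables (R : realType) (U : set (Cplx R)).
Hypothesis oU : open U.
Implicit Types (X Y : Cplx R -> 'cV[Cplx R]_3) (z : Cplx R).

(** Conjugation in the second slot exchanges [dz] and [dzbar], so each Leibniz rule mixes the
    two. *)
Lemma hdot_dz X Y (phi : Cplx R -> Cplx R) z (px py : Cplx R) :
  classCn 1 U X -> classCn 1 U Y -> U z ->
  (forall w, U w -> hdot (X w) (Y w) = phi w) ->
  pd 1 phi z px -> pd 'i phi z py ->
  hdot (dz X z) (Y z) + hdot (X z) (dzbar Y z) = 2^-1 * (px - 'i * py) /\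
  hdot (dzbar X z) (Y z) + hdot (X z) (dz Y z) = 2^-1 * (px + 'i * py).
Proof.
move=> HX HY Uz HXY Hx Hy.
have [X1 X2] := classCn_isrd HX Uz; have [Y1 Y2] := classCn_isrd HY Uz.
have Ex : px = hdot (dx X z) (Y z) + hdot (X z) (dx Y z).
  exact: (cder_unique Hx (pd_local oU Uz HXY (pd_hdot X1 Y1))).
have Ey : py = hdot (dy X z) (Y z) + hdot (X z) (dy Y z).
  exact: (cder_unique Hy (pd_local oU Uz HXY (pd_hdot X2 Y2))).
by rewrite Ex Ey; split; [exact: hdot_half1|exact: hdot_half2].
Qed.

Lemma dz_dzbar_isrd X z (A B D : 'cV[Cplx R]_3) :
  isrd 1 (dx X) z A -> isrd 'i (dx X) z B -> isrd 1 (dy X) z B -> isrd 'i (dy X) z D ->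
  dzbar (dz X) z = 4^-1 *: (A + D) /\ dz (dzbar X) z = 4^-1 *: (A + D).
Proof.
move=> xx yx xy yy.
have E1 : dz X = fun w => 2^-1 *: dx X w + (2^-1 * - 'i) *: dy X w.
  by apply/funext => w; rewrite /dz scalerBr scalerA mulrN scaleNr.
have E2 : dzbar X = fun w => 2^-1 *: dx X w + (2^-1 * 'i) *: dy X w.
  by apply/funext => w; rewrite /dzbar scalerDr scalerA.
have C v (F G : Cplx R -> 'cV[Cplx R]_3) l m (a b : Cplx R) : isrd v F z l -> isrd v G z m ->
    rderive v (fun w => a *: F w + b *: G w) z = a *: l + b *: m.
  by move=> h1 h2; apply: isrd_val; exact: isrd_comb.
have dx1 : dx (dz X) z = 2^-1 *: A + (2^-1 * - 'i) *: B.
  by rewrite E1; exact: (C _ _ _ _ _ _ _ xx xy).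
have dy1 : dy (dz X) z = 2^-1 *: B + (2^-1 * - 'i) *: D.
  by rewrite E1; exact: (C _ _ _ _ _ _ _ yx yy).
have dx2 : dx (dzbar X) z = 2^-1 *: A + (2^-1 * 'i) *: B.
  by rewrite E2; exact: (C _ _ _ _ _ _ _ xx xy).
have dy2 : dy (dzbar X) z = 2^-1 *: B + (2^-1 * 'i) *: D.
  by rewrite E2; exact: (C _ _ _ _ _ _ _ yx yy).
split.
  rewrite -(laplace_algebra1 A B D).
  exact: (f_equal2 (fun a b : 'cV[Cplx R]_3 => 2^-1 *: (a + 'i *: b)) dx1 dy1).
rewrite -(laplace_algebra2 A B D).
exact: (f_equal2 (fun a b : 'cV[Cplx R]_3 => 2^-1 *: (a - 'i *: b)) dx2 dy2).
Qed.

Lemma dz_dzbar_laplace X z : classCn 2 U X -> U z ->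
  dzbar (dz X) z = 4^-1 *: (dx (dx X) z + dy (dy X) z) /\
  dz (dzbar X) z = 4^-1 *: (dx (dx X) z + dy (dy X) z).
Proof.
move=> HX Uz; have [HXx HXy] := classCn_d HX.
have [xx yx] := classCn_isrd HXx Uz; have [xy0 yy] := classCn_isrd HXy Uz.
have xy : isrd 1 (dy X) z (dy (dx X) z).
  exact: (eq_rect _ (isrd 1 (dy X) z) xy0 _ (dxdy_comm oU HX Uz)).
exact: (dz_dzbar_isrd xx yx xy yy).
Qed.

End HopfCalculus.

(** * Algebra of the frame F, F_z, F_zbar *)

Section MovingFrame.
Variable R : realType.
Implicit Types f A B P Q L V X : 'cV[Cplx R]_3.

Lemma isotropic_frame f A B (W : R) :
  hdot A f = 0 -> hdot B f = 0 -> hdot A A = toC (2 * W) -> hdot B B = toC (2 * W) ->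
  hdot A B = 0 ->
  let P := 2^-1 *: (A - 'i *: B) in let Q := 2^-1 *: (A + 'i *: B) in
  [/\ hdot P f = 0 /\ hdot Q f = 0, hdot P P = toC W, hdot Q Q = toC W, hdot P Q = 0 &
   [/\ hdot A P = toC W, hdot B P = 'i * toC W, hdot A Q = toC W &
       hdot B Q = - 'i * toC W]].
Proof.
move=> Af Bf AA BB AB P Q.
have BA : hdot B A = 0 by rewrite hdotC AB conjC0.
have W2 : 2^-1 * toC (2 * W) = toC W by rewrite toCM (toC_nat R 2) mulrA mulVf ?mul1r // (pnatr_eq0 _ 2).
have AP : hdot A P = toC W.
  by rewrite hdotZr hdotBr hdotZr conj_half AB mulr0 subr0 AA.
have BP : hdot B P = 'i * toC W.
  by rewrite hdotZr hdotBr hdotZr conj_half conjCi BA BB sub0r mulNr opprK mulrCA W2.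
have AQ : hdot A Q = toC W.
  by rewrite hdotZr hdotDr hdotZr conj_half AB mulr0 addr0 AA.
have BQ : hdot B Q = - 'i * toC W.
  by rewrite hdotZr hdotDr hdotZr conj_half conjCi BA BB add0r mulrCA W2.
have hf : (2^-1 : Cplx R) * (1 + 1) = 1 by rewrite mulVf // (pnatr_eq0 _ 2).
split; [| | | |by split; [exact: AP|exact: BP|exact: AQ|exact: BQ]].
- by split; rewrite hdotZl ?hdotBl ?hdotDl hdotZl Af Bf !mulr0 ?subr0 ?addr0 ?mulr0.
- rewrite {1}/P hdotZl hdotBl hdotZl AP BP mulrA -expr2 sqrCi mulN1r opprK.
  by rewrite -[X in X + X]mul1r -mulrDl mulrA hf mul1r.
- rewrite {1}/Q hdotZl hdotDl hdotZl AQ BQ mulrA mulrN -expr2 sqrCi opprK mul1r.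
  by rewrite -[X in X + X]mul1r -mulrDl mulrA hf mul1r.
- rewrite {1}/P hdotZl hdotBl hdotZl AQ BQ mulrA mulrN -expr2 sqrCi opprK mul1r.
  by rewrite subrr mulr0.
Qed.

(** [V] stands for F_xx + F_yy. Minimality puts its horizontal part into the tangent plane; the
    derivative of [hdot P Q = 0] makes both tangential coefficients vanish, and that of
    [hdot P f = 0] gives the coefficient of [f]. *)
Lemma minimal_laplacian f A B P Q V (W s t : R) : 0 < W ->
  hdot f f = 1 -> hdot P f = 0 -> hdot Q f = 0 -> hdot P P = toC W ->
  hdot Q Q = toC W -> hdot P Q = 0 ->
  hdot A P = toC W -> hdot B P = 'i * toC W -> hdot A Q = toC W ->
  hdot B Q = - 'i * toC W ->
  V - hdot V f *: f = toC s *: A + toC t *: B ->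
  hdot (4^-1 *: V) Q + hdot P (4^-1 *: V) = 0 ->
  hdot (4^-1 *: V) f + hdot P P = 0 ->
  4^-1 *: V = - toC W *: f.
Proof.
move=> W0 ff Pf Qf PP QQ PQ AP BP AQ BQ Hmin H1 H2.
have WC : toC W != 0 by apply: contraTneq W0 => /toCI ->; rewrite ltxx.
have fP : hdot f P = 0 by rewrite hdotC Pf conjC0.
have fQ : hdot f Q = 0 by rewrite hdotC Qf conjC0.
have VP : hdot V P = (toC s + 'i * toC t) * toC W.
  have := congr1 (fun X => hdot X P) Hmin.
  rewrite hdotBl hdotZl fP mulr0 subr0 hdotDl !hdotZl AP BP => ->; ring.
have VQ : hdot V Q = (toC s - 'i * toC t) * toC W.
  have := congr1 (fun X => hdot X Q) Hmin.
  rewrite hdotBl hdotZl fQ mulr0 subr0 hdotDl !hdotZl AQ BQ => ->; ring.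
have c4 : (4^-1 : Cplx R)^* = 4^-1 by rewrite fmorphV /= conjC_nat.
have PV : hdot P V = (toC s - 'i * toC t) * toC W.
  rewrite hdotC VP rmorphM rmorphD rmorphM /= !conjC_toC conjCi; ring.
have n4 : (4 : Cplx R) != 0 by rewrite (pnatr_eq0 _ 4).
have n2 : (2 : Cplx R) != 0 by rewrite (pnatr_eq0 _ 2).
have st0 : toC s - 'i * toC t = 0.
  move: H1; rewrite hdotZl hdotZr c4 VQ PV => H1.
  apply: (mulIf WC); rewrite mul0r; apply: (mulfI n2); rewrite mulr0.
  by apply: (mulfI (invr_neq0 n4)); rewrite mulr0 -[RHS]H1; ring.
have s0 : s = 0 by have := congr1 (@complex.Re R) st0; rewrite !compE; lra.
have t0 : t = 0 by have := congr1 (@complex.Im R) st0; rewrite !compE; lra.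
have VP0 : hdot V P = 0 by rewrite VP s0 t0 toC0; ring.
have VQ0 : hdot V Q = 0 by rewrite VQ s0 t0 toC0; ring.
apply/eqP; rewrite -subr_eq0 scaleNr opprK; apply/eqP.
apply: (orthogonal_triple_eq0 (oner_neq0 _) WC WC ff PP QQ fP fQ PQ).
- by rewrite hdotDl [hdot (toC W *: f) f]hdotZl ff mulr1 -PP.
- by rewrite hdotDl !hdotZl VP0 fP !mulr0 addr0.
- by rewrite hdotDl !hdotZl VQ0 fQ !mulr0 addr0.
Qed.

(** Parseval in the frame [f], [P], [Q], to be applied to F_zz. *)
Lemma hopf_norm f P Q X (W : R) (w1 psi : Cplx R) : 0 < W ->
  hdot f f = 1 -> hdot P f = 0 -> hdot Q f = 0 -> hdot P P = toC W ->
  hdot Q Q = toC W -> hdot P Q = 0 ->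
  hdot X f = 0 -> hdot X P = w1 -> hdot X Q = psi ->
  hdot X X * toC W = toC (modulus w1 ^+ 2 + modulus psi ^+ 2).
Proof.
move=> W0 ff Pf Qf PP QQ PQ Xf XP XQ.
have WC : toC W != 0 by apply: contraTneq W0 => /toCI ->; rewrite ltxx.
have QP : hdot Q P = 0 by rewrite hdotC PQ conjC0.
have fP : hdot f P = 0 by rewrite hdotC Pf conjC0.
have fQ : hdot f Q = 0 by rewrite hdotC Qf conjC0.
have E : X - ((w1 / toC W) *: P + (psi / toC W) *: Q) = 0.
  apply: (orthogonal_triple_eq0 (oner_neq0 _) WC WC ff PP QQ fP fQ PQ).
  - by rewrite hdotBl hdotDl !hdotZl Xf Pf Qf !mulr0 addr0 subr0.
  - by rewrite hdotBl hdotDl !hdotZl XP PP QP mulr0 addr0 divfK // subrr.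
  - by rewrite hdotBl hdotDl !hdotZl XQ QQ PQ mulr0 add0r divfK // subrr.
move/eqP: E; rewrite subr_eq0 => /eqP E.
rewrite {2}E hdotDr !hdotZr XP XQ !rmorphM /= toCD -!mulJ.
have cW : ((toC W)^-1)^* = (toC W)^-1 by rewrite fmorphV /= conjC_toC.
by rewrite cW; field.
Qed.

(** [X] stands for F_zz and [N] for F_zz differentiated in zbar, so the last hypothesis is the
    zbar-derivative of [hdot X P]. Here [hdot N P] is - W^2, and [hopf_norm] supplies [hdot X X]. *)
Lemma gauss_algebra f A B P Q X N (W W1 W2 : R) (psi : Cplx R) : 0 < W ->
  hdot f f = 1 -> hdot P f = 0 -> hdot Q f = 0 -> hdot P P = toC W ->
  hdot Q Q = toC W -> hdot P Q = 0 ->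
  hdot A P = toC W -> hdot B P = 'i * toC W ->
  hdot X f = 0 -> hdot X P = 2^-1 * (- 'i) * toC W1 -> hdot X Q = psi ->
  N = 2^-1 *: (0 *: f + toC (- W) *: A - 'i *: (toC (- W1) *: f + toC (- W) *: B)) ->
  hdot N P + hdot X X = 2^-1 * (0 + 'i * (2^-1 * (- 'i) * toC W2)) ->
  W2 * W = - 4 * W ^+ 3 + W1 ^+ 2 + 4 * modulus psi ^+ 2.
Proof.
move=> W0 ff Pf Qf PP QQ PQ AP BP Xf XP XQ NE H.
have XX := hopf_norm W0 ff Pf Qf PP QQ PQ Xf XP XQ.
have fP : hdot f P = 0 by rewrite hdotC Pf conjC0.
have NP : hdot N P = - toC W ^+ 2.
  rewrite NE hdotZl hdotBl hdotZl !hdotDl !hdotZl fP AP BP !mulr0 !add0r toCN.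
  rewrite (_ : _ * _ = - toC W ^+ 2 * (2^-1 * (1 - 'i ^+ 2))); last by ring.
  by rewrite sqrCi opprK mulVf ?mulr1 // (pnatr_eq0 _ 2).
have mh : modulus (2^-1 * (- 'i) * toC W1) = 2^-1 * `|W1|.
  by rewrite !modM modN modi mulr1 modV mod_nat mod_toC.
have E4 : toC 4^-1 = 4^-1 :> Cplx R by rewrite toCV (toC_nat R 4).
have Eh : hdot X X = toC (W ^+ 2 + W2 * 4^-1).
  have -> : hdot X X = (hdot N P + hdot X X) + toC W ^+ 2 by rewrite NP; ring.
  rewrite H toCD toCX toCM E4 [RHS]addrC; congr (_ + _).
  rewrite add0r (_ : _ * _ = - 'i ^+ 2 * (toC W2 * (2^-1 * 2^-1))); last by ring.
  by rewrite sqrCi opprK mul1r; congr (_ * _); field.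
move: XX; rewrite Eh -toCM => /toCI.
rewrite mh exprMn real_normK ?num_real // => XX.
have -> : W2 * W = 4 * ((W ^+ 2 + W2 * 4^-1) * W) - 4 * W ^+ 3 by field.
by rewrite XX; field.
Qed.

Lemma add_eq_sub (a b c d : Cplx R) : a + b = c -> b = d -> a = c - d.
Proof. by move=> <- ->; rewrite addrK. Qed.

End MovingFrame.

Section GaussEquation.
Variables (R : realType) (U : set (Cplx R)) (F : Cplx R -> 'cV[Cplx R]_3)
  (W : R -> R) (psi : Cplx R).
Hypothesis oU : open U.
Hypothesis cF : classCn 3 U F.
Hypothesis W_gt0 : forall z, U z -> 0 < W (complex.Im z).
Hypothesis FF1 : forall z, U z -> hdot (F z) (F z) = 1.
Hypothesis Fx : forall z, U z -> hdot (dx F z) (F z) = 0.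
Hypothesis Fy : forall z, U z -> hdot (dy F z) (F z) = 0.
Hypothesis Gx : forall z, U z -> hdot (dx F z) (dx F z) = toC (2 * W (complex.Im z)).
Hypothesis Gy : forall z, U z -> hdot (dy F z) (dy F z) = toC (2 * W (complex.Im z)).
Hypothesis Gxy : forall z, U z -> hdot (dx F z) (dy F z) = 0.
Hypothesis Hmin : forall z, U z -> exists s t : R,
  hor F z (dx (dx F) z + dy (dy F) z) = toC s *: dx F z + toC t *: dy F z.
Hypothesis Hpsi : forall z, U z -> hdot (dz (dz F) z) (dzbar F z) = psi.

Let cP : classCn 2 U (dz F) := (classCn_dz oU cF).1.
Let cQ : classCn 2 U (dzbar F) := (classCn_dz oU cF).2.
Let cPz : classCn 1 U (dz (dz F)) := (classCn_dz oU cP).1.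

Lemma classCnW n m X : (n <= m)%N -> classCn m U X -> classCn n U (X : Cplx R -> 'cV[Cplx R]_3).
Proof.
elim: n m X => [|n IH] [|m] X //; first by move=> _ [h _].
rewrite ltnS => nm [h [h1 h2 h3]]; split; first exact: h.
split; [exact: h1|exact: (IH m _ nm h2)|exact: (IH m _ nm h3)].
Qed.

Let cF0 : classCn 1 U F := classCnW (isT : (1 <= 3)%N) cF.
Let cP1 : classCn 1 U (dz F) := classCnW (isT : (1 <= 2)%N) cP.
Let cQ1 : classCn 1 U (dzbar F) := classCnW (isT : (1 <= 2)%N) cQ.

Lemma dz_frame z : U z ->
  [/\ hdot (dz F z) (F z) = 0 /\ hdot (dzbar F z) (F z) = 0,
      hdot (dz F z) (dz F z) = toC (W (complex.Im z)),
      hdot (dzbar F z) (dzbar F z) = toC (W (complex.Im z)),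
      hdot (dz F z) (dzbar F z) = 0 &
   [/\ hdot (dx F z) (dz F z) = toC (W (complex.Im z)),
       hdot (dy F z) (dz F z) = 'i * toC (W (complex.Im z)),
       hdot (dx F z) (dzbar F z) = toC (W (complex.Im z)) &
       hdot (dy F z) (dzbar F z) = - 'i * toC (W (complex.Im z))]].
Proof.
move=> Uz; exact: (isotropic_frame (Fx Uz) (Fy Uz) (Gx Uz) (Gy Uz) (Gxy Uz)).
Qed.

Lemma gauss_laplacian z : U z ->
  dzbar (dz F) z = - toC (W (complex.Im z)) *: F z.
Proof.
move=> Uz.
have [[Pf Qf] PP QQ PQ [AP BP AQ BQ]] := dz_frame Uz.
have HPQ w : U w -> hdot (dz F w) (dzbar F w) = 0.
  by move=> Uw; have [_ _ _ h _] := dz_frame Uw.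
have HPF w : U w -> hdot (dz F w) (F w) = 0.
  by move=> Uw; have [[h _] _ _ _ _] := dz_frame Uw.
have z12 : (2^-1 : Cplx R) * (0 + 'i * 0) = 0 by rewrite mulr0 addr0 mulr0.
have [L1 L2] := dz_dzbar_laplace oU (classCnW (isT : (2 <= 3)%N) cF) Uz.
have [_ H1] := hdot_dz oU cP1 cQ1 Uz HPQ (pd_cst 1 z 0) (pd_cst 'i z 0).
have [_ H2] := hdot_dz oU cP1 cF0 Uz HPF (pd_cst 1 z 0) (pd_cst 'i z 0).
rewrite z12 L1 L2 in H1; rewrite z12 L1 in H2.
have [s [t Hst]] := Hmin Uz.
rewrite L1.
exact: (minimal_laplacian (W_gt0 Uz) (FF1 Uz) Pf Qf PP QQ PQ AP BP AQ BQ Hst H1 H2).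
Qed.


Lemma is_derive_derive1 (f : R -> R) (y l : R) : is_derive y 1 f l ->
  is_derive y 1 f (derive1 f y).
Proof. by move=> [h _]; rewrite derive1E; exact: derivableP. Qed.

(** The regularity of [W] is inherited from the lift, as [W] is the inner product of F_z with
    itself. *)
Lemma metric_derivable z : U z -> is_derive (complex.Im z) 1 W (derive1 W (complex.Im z)).
Proof.
move=> Uz; have [_ P2] := classCn_isrd cP1 Uz.
have HPP w : U w -> hdot (dz F w) (dz F w) = toC (W (complex.Im w)).
  by move=> Uw; have [_ h _ _ _] := dz_frame Uw.
apply: is_derive_derive1.
exact: (pd_Im_inv (pd_local oU Uz HPP (pd_hdot P2 P2))).
Qed.

Let W1 := derive1 W.
Let half_i : Cplx R := 2^-1 * (- 'i).

Lemma hopf_tangential z : U z ->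
  hdot (dz (dz F) z) (F z) = 0 /\
  hdot (dz (dz F) z) (dz F z) = half_i * toC (W1 (complex.Im z)).
Proof.
move=> Uz.
have [[Pf Qf] PP QQ PQ _] := dz_frame Uz.
have HPF w : U w -> hdot (dz F w) (F w) = 0.
  by move=> Uw; have [[h _] _ _ _ _] := dz_frame Uw.
have HPP w : U w -> hdot (dz F w) (dz F w) = toC (W (complex.Im w)).
  by move=> Uw; have [_ h _ _ _] := dz_frame Uw.
have [px py] := pd_Im (metric_derivable Uz).
have [H1 _] := hdot_dz oU cP1 cF0 Uz HPF (pd_cst 1 z 0) (pd_cst 'i z 0).
have [H2 _] := hdot_dz oU cP1 cP1 Uz HPP px py.
have fP : hdot (F z) (dz F z) = 0 by rewrite hdotC Pf conjC0.
have PL : hdot (dz F z) (dzbar (dz F) z) = 0.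
  apply: (etrans (congr1 (hdot (dz F z)) (gauss_laplacian Uz))).
  by rewrite hdotZr Pf mulr0.
split; first by apply: (etrans (add_eq_sub H1 PQ)); rewrite mulr0 !subr0 mulr0.
apply: (etrans (add_eq_sub H2 PL)).
by rewrite sub0r subr0 /half_i /W1; ring.
Qed.

Lemma gauss_equation z : U z -> exists2 W2 : R,
  is_derive (complex.Im z) 1 W1 W2 &
  W2 * W (complex.Im z) = - 4 * W (complex.Im z) ^+ 3 + W1 (complex.Im z) ^+ 2
     + 4 * modulus psi ^+ 2.
Proof.
move=> Uz; pose y := complex.Im z.
have [[Pf Qf] PP QQ PQ _] := dz_frame Uz.
have [Xf XP] := hopf_tangential Uz.
have fP : hdot (F z) (dz F z) = 0 by rewrite hdotC Pf conjC0.
have HXP w : U w -> hdot (dz (dz F) w) (dz F w) = half_i * toC (W1 (complex.Im w)).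
  by move=> Uw; have [] := hopf_tangential Uw.
have hi0 : half_i != 0.
  by rewrite mulf_neq0 ?invr_neq0 ?oppr_eq0 ?neq0Ci // (pnatr_eq0 _ 2).
have [_ X2] := classCn_isrd cPz Uz; have [_ P2] := classCn_isrd cP1 Uz.
(* Dividing [hdot] of F_zz and F_z by [half_i] recovers [W1], which shows that [W] is twice
   differentiable. *)
have d2 := cderZ half_i^-1 (pd_hdot X2 P2).
have HW1 w : U w -> half_i^-1 * hdot (dz (dz F) w) (dz F w) = toC (W1 (complex.Im w)).
  by move=> Uw; rewrite (HXP w Uw) mulKf.
have dW1 := pd_Im_inv (pd_local oU Uz HW1 d2).
set W2 := complex.Re _ in dW1.
exists W2 => //; clearbody W2.
have [px py] := pd_Im dW1.
have px' : pd 1 (fun w => half_i * toC (W1 (complex.Im w))) z 0.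
  by have := cderZ half_i px; rewrite mulr0.
have py' : pd 'i (fun w => half_i * toC (W1 (complex.Im w))) z (half_i * toC W2).
  exact: (cderZ half_i py).
have [_ H] := hdot_dz oU cPz cP1 Uz HXP px' py'.
have [L1 L2] := dz_dzbar_laplace oU cP Uz.
have [_ _ _ _ [AP BP _ _]] := dz_frame Uz.
(* The zbar-derivative of F_zz becomes the z-derivative of - W F, which involves only first
   derivatives of [F] and [W]. *)
have HL w : U w -> toC (- W (complex.Im w)) *: F w = dzbar (dz F) w.
  by move=> Uw; rewrite toCN gauss_laplacian.
have [F1 F2] := classCn_isrd cF0 Uz.
have [qx qy] := pd_Im (is_deriveN (metric_derivable Uz)).
have Lx := isrd_val (isrd_local oU Uz HL (isrd_scale qx F1)).
have Ly := isrd_val (isrd_local oU Uz HL (isrd_scale qy F2)).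
have NE := etrans (etrans L1 (esym L2))
  (f_equal2 (fun a b : 'cV[Cplx R]_3 => 2^-1 *: (a - 'i *: b)) Lx Ly).
exact: (gauss_algebra (W_gt0 Uz) (FF1 Uz) Pf Qf PP QQ PQ AP BP Xf XP (Hpsi Uz) NE H).
Qed.

End GaussEquation.

Section StripGauss.
Variable R : realType.

Lemma double_expR_gt0 (t : R) : 0 < 2 * expR t.
Proof. by rewrite mulr_gt0 // expR_gt0. Qed.

(** In conformal coordinates the mixed term has coefficient 0 and the other two share the factor
    [g], so the mean curvature condition concerns F_xx + F_yy alone. *)
Lemma minimal_algebra (X Y Z A B f : 'cV[Cplx R]_3) (s t g : R) : 0 < g ->
  toC g *: (X - hdot X f *: f) - toC (2 * 0) *: Z + toC g *: (Y - hdot Y f *: f) =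
    toC s *: A + toC t *: B ->
  X + Y - hdot (X + Y) f *: f = toC (s / g) *: A + toC (t / g) *: B.
Proof.
move=> g0; have gC : toC g != 0 by apply: contraTneq g0 => /toCI ->; rewrite ltxx.
rewrite mulr0 toC0 scale0r subr0 -scalerDr => H.
have -> : X + Y - hdot (X + Y) f *: f = (X - hdot X f *: f) + (Y - hdot Y f *: f).
  by rewrite hdotDl scalerDl opprD addrACA.
apply: (scalerI gC); rewrite H scalerDr !scalerA -!toCM.
by rewrite !(mulrC g) !divfK // gt_eqF.
Qed.

Lemma minimal_algebra_subst (C1 Z C2 T1 T2 X Y A B f : 'cV[Cplx R]_3)
    (s t g g11 g12 g22 : R) : 0 < g -> g11 = g -> g22 = g -> g12 = 0 ->
  C1 = X - hdot X f *: f -> C2 = Y - hdot Y f *: f -> T1 = A -> T2 = B ->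
  toC g22 *: C1 - toC (2 * g12) *: Z + toC g11 *: C2 = toC s *: T1 + toC t *: T2 ->
  X + Y - hdot (X + Y) f *: f = toC (s / g) *: A + toC (t / g) *: B.
Proof. by move=> g0 -> -> -> -> -> -> ->; exact: minimal_algebra. Qed.

Lemma tang_horizontal (F : Cplx R -> 'cV[Cplx R]_3) v z :
  hdot (rderive v F z) (F z) = 0 -> tang F v z = rderive v F z.
Proof. by move=> H; rewrite /tang /hor H scale0r subr0. Qed.

Lemma cov_deriv_horizontal (F Y : Cplx R -> 'cV[Cplx R]_3) v z X :
  hdot (rderive v F z) (F z) = 0 -> rderive v Y z = X ->
  cov_deriv F v Y z = X - hdot X (F z) *: F z.
Proof. by move=> H E; rewrite /cov_deriv H scale0r subr0 E. Qed.

Lemma real_hdot (X Y : 'cV[Cplx R]_3) (c : R) : complex.Re (hdot X Y) = c ->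
  complex.Im (hdot X Y) = 0 -> hdot X Y = toC c.
Proof. by move=> h1 h2; apply: cplxP; rewrite ?cReC ?cImC. Qed.

Variables (S : set (Cplx R)) (f : Cplx R -> CP2 R) (u : R -> R) (psi : Cplx R).
Hypothesis hf : minimal_lagrangian_immersion S f.
Hypothesis hmetric : induced_metric S f u.
Hypothesis hhopf : hopf_differential S f psi.

Let W y := expR (u y).

(** The metric gives the real part and the Lagrangian condition the imaginary part of [hdot] of F_x
    and F_y. On a horizontal lift [tang] is the plain derivative; three derivatives of the lift are
    used. *)
Lemma minimal_lagrangian_gauss z0 : S z0 ->
  is_derive (complex.Im z0) 1 W (derive1 W (complex.Im z0)) /\
  exists2 W2 : R, is_derive (complex.Im z0) 1 (derive1 W) W2 &
    W2 * W (complex.Im z0) = - 4 * W (complex.Im z0) ^+ 3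
      + (derive1 W (complex.Im z0)) ^+ 2 + 4 * modulus psi ^+ 2.
Proof.
move=> Sz0; have [U [F [Uz0 lift hor_F Hpsi]]] := hhopf Sz0.
have [_ _ lagr mini] := hf; have [oU US smF HF] := lift.
have cF : classCn 3 U F := smF 3%N.
have cF2 : classCn 1 U (dx F) /\ classCn 1 U (dy F).
  by have [h1 h2] := classCn_d cF; split; [exact: (classCnW (isT : (1 <= 2)%N) h1)|
    exact: (classCnW (isT : (1 <= 2)%N) h2)].
have T1 z : U z -> tang F 1 z = dx F z.
  by move=> /hor_F[h _]; exact: tang_horizontal.
have Ti z : U z -> tang F 'i z = dy F z.
  by move=> /hor_F[_ h]; exact: tang_horizontal.
have Wgt0 z : U z -> 0 < W (complex.Im z) by move=> _; exact: expR_gt0.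
have met z (Uz : U z) : [/\ complex.Re (hdot (dx F z) (dx F z)) = 2 * W (complex.Im z),
    complex.Re (hdot (dy F z) (dy F z)) = 2 * W (complex.Im z) &
    complex.Re (hdot (dx F z) (dy F z)) = 0].
  by have := hmetric lift Uz; rewrite /fs_metric (T1 z Uz) (Ti z Uz).
have kah z (Uz : U z) : complex.Im (hdot (dx F z) (dy F z)) = 0.
  by have := lagr U F lift z Uz; rewrite /kahler (T1 z Uz) (Ti z Uz).
have Gx z : U z -> hdot (dx F z) (dx F z) = toC (2 * W (complex.Im z)).
  by move=> /met[h _ _]; apply: real_hdot => //; exact: Im_hdot.
have Gy z : U z -> hdot (dy F z) (dy F z) = toC (2 * W (complex.Im z)).
  by move=> /met[_ h _]; apply: real_hdot => //; exact: Im_hdot.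
have Gxy z : U z -> hdot (dx F z) (dy F z) = 0.
  by move=> Uz; have [_ _ h] := met z Uz; exact: (real_hdot h (kah z Uz)).
have Hmin z : U z -> exists s t : R,
    hor F z (dx (dx F) z + dy (dy F) z) = toC s *: dx F z + toC t *: dy F z.
  move=> Uz; have [s [t Hst]] := mini U F lift z Uz.
  have [g1 g2 g3] := hmetric lift Uz.
  have [x1 _] := classCn_isrd cF2.1 Uz; have [_ x2] := classCn_isrd cF2.2 Uz.
  have d1 := isrd_val (isrd_local oU Uz (fun w Uw => esym (T1 w Uw)) x1).
  have d2 := isrd_val (isrd_local oU Uz (fun w Uw => esym (Ti w Uw)) x2).
  have [hx hy] := hor_F z Uz.
  have g0 : 0 < 2 * W (complex.Im z) := double_expR_gt0 (u (complex.Im z)).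
  exists (s / (2 * W (complex.Im z))), (t / (2 * W (complex.Im z))).
  exact: (minimal_algebra_subst g0 g1 g2 g3 (cov_deriv_horizontal hx d1)
    (cov_deriv_horizontal hy d2) (T1 z Uz) (Ti z Uz) Hst).
have FF1 z : U z -> hdot (F z) (F z) = 1 by move=> /HF[].
have Fx z : U z -> hdot (dx F z) (F z) = 0 by move=> /hor_F[].
have Fy z : U z -> hdot (dy F z) (F z) = 0 by move=> /hor_F[].
split; first exact: (metric_derivable oU cF Fx Fy Gx Gy Gxy Uz0).
exact: (gauss_equation oU cF Wgt0 FF1 Fx Fy Gx Gy Gxy Hmin Hpsi Uz0).
Qed.

End StripGauss.

(** * The first integral and the profile equation *)

Section FirstIntegral.
Variables (R : realType) (lo hi : \bar R) (W W1 : R -> R) (m : R).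
Hypotheses (lo0 : (lo < 0)%E) (hi0 : (0 < hi)%E).
Hypothesis W_gt0 : forall y, 0 < W y.
Hypothesis dW : forall y : R, (lo < y%:E < hi)%E -> is_derive y 1 W (W1 y).
Hypothesis dW1 : forall y : R, (lo < y%:E < hi)%E -> exists2 W2 : R,
  is_derive y 1 W1 W2 & W2 * W y = - 4 * W y ^+ 3 + W1 y ^+ 2 + 4 * m.

(** This is beta with u' = W1 / W inserted, and with [m] for the square of the modulus of psi. *)
Definition energy y := (W1 y ^+ 2 + 8 * W y ^+ 3 + 4 * m) * (W y)^-1 ^+ 2 / 4.

Lemma energy_derive y : (lo < y%:E < hi)%E -> is_derive y 1 energy 0.
Proof.
move=> yI; have d := dW yI; have [W2 d1 E] := dW1 yI.
have W0 : W y != 0 by rewrite gt_eqF.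
have dV : is_derive y 1 (fun t => (W t)^-1) (- (W y)^-1 ^+ 2 * W1 y).
  by rewrite exprVn; exact: (is_deriveV W0 d).
have dN := is_derive_add (is_derive_add (is_derive_pow 1 d1)
  (is_derive_mul (is_derive_cst (8 : R) y (1:R)) (is_derive_pow 2 d)))
  (is_derive_cst (4 * m) y (1:R)).
have dK := is_derive_mul (is_derive_mul dN (is_derive_pow 1 dV)) (is_derive_cst (4^-1 : R) y (1:R)).
apply: (is_derive_eq dK); rewrite /cst /=.
have -> : W2 = (- 4 * W y ^+ 3 + W1 y ^+ 2 + 4 * m) / W y by rewrite -E mulfK.
by field.
Qed.

Lemma strip_between y t : (lo < y%:E < hi)%E -> (0 <= t <= y) || (y <= t <= 0) ->
  (lo < t%:E < hi)%E.
Proof.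
move=> /andP[ly yh] /orP[] /andP[h1 h2]; apply/andP; split.
- by apply: (lt_le_trans lo0); rewrite lee_fin.
- by apply: (le_lt_trans _ yh); rewrite lee_fin.
- by apply: (lt_le_trans ly); rewrite lee_fin.
- by apply: (le_lt_trans _ hi0); rewrite lee_fin.
Qed.

Lemma energy_constant y : (lo < y%:E < hi)%E -> energy y = energy 0.
Proof.
move=> yI; have [y0|y0|->//] := ltgtP 0 y.
  have [|c _] := @mean_value _ energy (fun=> 0) 0 y y0.
    by move=> s sI; apply/energy_derive/(strip_between yI); rewrite sI.
  by rewrite mul0r => /eqP; rewrite subr_eq0 => /eqP.
have [|c _] := @mean_value _ energy (fun=> 0) y 0 y0.
  by move=> s sI; apply/energy_derive/(strip_between yI); rewrite sI orbT.
by rewrite mul0r => /eqP; rewrite subr_eq0 => /eqP.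
Qed.

(** The first integral eliminates [W1 y ^+ 2] and [m] from the Gauss equation. *)
Lemma profile_second_derivative y : (lo < y%:E < hi)%E ->
  is_derive y 1 W1 (4 * energy 0 * W y - 12 * W y ^+ 2).
Proof.
move=> yI; have [W2 d1 E] := dW1 yI.
apply: (is_derive_eq d1); rewrite -(energy_constant yI) /energy.
have W0 : W y != 0 by rewrite gt_eqF.
apply: (mulIf W0); rewrite E; by field.
Qed.

Lemma profile_wp_equation y (g2 : R) : g2 = 4 / 3 * energy 0 ^+ 2 ->
  (lo < y%:E < hi)%E ->
  is_derive y 1 (fun t => energy 0 / 3 - 2 * W t) (- 2 * W1 y) /\
  is_derive y 1 (fun t => - 2 * W1 t) (6 * (energy 0 / 3 - 2 * W y) ^+ 2 - g2 / 2).
Proof.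
move=> g2E yI; have d2 := profile_second_derivative yI.
have Z (f : R -> R) l : is_derive y 1 f l -> is_derive y 1 (fun t => - 2 * f t) (- 2 * l).
  move=> h; apply: (is_derive_eq (is_derive_mul (is_derive_cst (- 2 : R) y (1:R)) h)).
  by rewrite mulr0 addr0.
split.
  rewrite (_ : (fun t => _) = fun t => energy 0 / 3 + - 2 * W t); last first.
    by apply/funext => t; rewrite mulNr.
  apply: (is_derive_eq (is_derive_add (is_derive_cst (energy 0 / 3) y (1:R)) (Z _ _ (dW yI)))).
  by rewrite add0r.
by apply: (is_derive_eq (Z _ _ d2)); rewrite g2E; field.
Qed.

(* The equilibrium [- c] of the second order equation, with [c] the double root
   of the cubic, is the only solution starting there at rest. *)
Lemma double_root_constant (c : R) : energy 0 = 3 * c -> W 0 = c -> W1 0 = 0 ->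
  forall y, (lo < y%:E < hi)%E -> W y = c.
Proof.
move=> Ec W0 W10.
pose g2 := 4 / 3 * energy 0 ^+ 2.
have key (sg b : R) : sg ^+ 2 = 1 ->
   (forall t : R, 0 <= t < b -> (lo < (sg * t)%:E < hi)%E) ->
   forall t : R, 0 <= t < b -> W (sg * t) = c.
  move=> sg2 Hb t tb.
  have dl (s : R) : is_derive s 1 (fun t : R => sg * t) sg.
    have := is_derive_mul (is_derive_cst sg s (1:R)) (is_derive_id s (1:R)).
    by rewrite mulr0 addr0 mulr1; exact.
  pose q (s : R) := energy 0 / 3 - 2 * W (sg * s).
  pose q1 (s : R) := sg * (- 2 * W1 (sg * s)).
  have Dq (s : R) : 0 <= s < b -> cder (fun s => toC (q s)) s (toC (q1 s)) /\
      cder (fun s => toC (q1 s)) s (1 * (6 * toC (q s) ^+ 2 - toC (g2 / 2))).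
    move=> /Hb sI; have [h1 h2] := profile_wp_equation (erefl g2) sI; split.
      apply: cder_toC.
      have h3 := @is_derive1_comp _ _ (fun t : R => sg * t) s _ _ h1 (dl s).
      by apply: (is_derive_eq h3); rewrite /q1 mulrC.
    have h3 := @is_derive1_comp _ _ (fun t : R => sg * t) s _ _ h2 (dl s).
    have h4 := is_derive_mul (is_derive_cst sg s (1:R)) h3.
    have h5 : is_derive s 1 q1 (6 * q s ^+ 2 - g2 / 2).
      apply: (is_derive_eq h4); rewrite /cst mulr0 addr0.
      transitivity (sg ^+ 2 * (6 * q s ^+ 2 - g2 / 2)); last by rewrite sg2 mul1r.
      by rewrite /q; ring.
    have := cder_toC h5; rewrite toCB [toC (6 * _)]toCM.
    by rewrite toCX (toC_nat R 6) mul1r; exact.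
  have Dc (s : R) : 0 <= s < b -> cder (fun=> toC (- c)) s 0 /\
      cder (fun=> 0) s (1 * (6 * toC (- c) ^+ 2 - toC (g2 / 2))).
    move=> _; split; first exact: cder_cst.
    have -> : g2 / 2 = 6 * (- c) ^+ 2 by rewrite /g2 Ec; field.
    rewrite [toC (6 * _)]toCM toCX (toC_nat R 6) subrr mulr0; exact: cder_cst.
  have q0 : toC (q 0) = toC (- c) by congr toC; rewrite /q mulr0 W0 Ec; field.
  have q10 : toC (q1 0) = 0 by rewrite /q1 mulr0 W10 !mulr0.
  have [/toCI H _] := ode2_unique Dq Dc q0 q10 tb.
  move: H; rewrite /q Ec => H; lra.
move=> y yI; have /andP[ly yh] := yI.
have [y0|y0] := leP 0 y.
  have [b yb Hb] := ereal_gap_right yh.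
  have := @key 1 b (expr1n _ _) _ y; rewrite mul1r y0 yb; apply => // t /andP[t0 tb].
  rewrite mul1r Hb // andbT; apply: (lt_le_trans lo0); by rewrite lee_fin.
have [b b_y Hb] := ereal_gap_left ly.
have sg2 : (-1 : R) ^+ 2 = 1 by rewrite sqrrN expr1n.
have := @key (-1) (- b) sg2 _ (- y); rewrite mulrNN mul1r; apply.
  move=> t /andP[t0 tb]; rewrite mulN1r Hb /=; last by lra.
  by apply: (le_lt_trans _ hi0); rewrite lee_fin oppr_le0.
by apply/andP; split; lra.
Qed.

End FirstIntegral.

(** Splitting off w - w0 leaves w^2 + p w + w0 p. As [m] is positive, p < 0 and the remaining roots
    [wm < wp] are real; [wp] is at most [w0], and equality is the first alternative. The
    substitution t = beta / 3 - 2 w reverses the order, so the largest root [w0] gives the smallest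
    root of [wcubic]. *)
Lemma hopf_cubic_roots (R : realType) (beta m w0 : R) : 0 < w0 -> 0 < m ->
  8 * w0 ^+ 3 - 4 * beta * w0 ^+ 2 + 4 * m = 0 ->
  (forall w : R, 8 * w ^+ 3 - 4 * beta * w ^+ 2 + 4 * m = 0 -> w <= w0) ->
  beta = 3 * w0 \/ exists e1 e2 : R,
    [/\ beta / 3 - 2 * w0 < e2, e2 < e1 & forall t,
      wcubic (4 / 3 * beta ^+ 2) (16 * m - 8 / 27 * beta ^+ 3) t =
      4 * (t - e1) * (t - e2) * (t - (beta / 3 - 2 * w0))].
Proof.
move=> w00 m0 Hroot Hmax; pose p := w0 - beta / 2.
have bE : beta = 2 * (w0 - p) by rewrite /p; field.
have mE : m = - 2 * w0 ^+ 2 * p.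
  by apply: (mulfI (_ : 4 != 0 :> R)); [rewrite pnatr_eq0|rewrite /p; lra].
have p0 : p < 0.
  have w2 : 0 < w0 ^+ 2 by rewrite exprn_gt0.
  by rewrite -(pmulr_rlt0 _ w2); lra.
have d0 : 0 < p ^+ 2 - 4 * (w0 * p).
  have h1 := sqr_ge0 p; have h2 : w0 * p < 0 by rewrite pmulr_rlt0.
  lra.
pose sq := Num.sqrt (p ^+ 2 - 4 * (w0 * p)).
have sq0 : 0 < sq by rewrite sqrtr_gt0.
have sq2 : sq ^+ 2 = p ^+ 2 - 4 * (w0 * p) by rewrite sqr_sqrtr // ltW.
pose wp := (- p + sq) / 2; pose wm := (- p - sq) / 2.
have wp2 : wp ^+ 2 = - p * wp - w0 * p.
  have -> : wp ^+ 2 = (p ^+ 2 - 2 * p * sq + sq ^+ 2) / 4 by rewrite /wp; field.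
  by rewrite sq2 /wp; field.
have rt w : 8 * w ^+ 3 - 4 * beta * w ^+ 2 + 4 * m =
    8 * (w - w0) * (w ^+ 2 + p * w + w0 * p) by rewrite bE mE; ring.
have wpw0 : wp <= w0 by apply: Hmax; rewrite rt wp2; ring.
move: wpw0; rewrite le_eqVlt => /predU1P[E|wpw0].
  left; rewrite E in wp2.
  have : w0 * (w0 + 2 * p) = 0 by move: wp2; rewrite expr2; lra.
  by move=> /eqP; rewrite mulf_eq0 gt_eqF //= => /eqP; rewrite bE; lra.
right; exists (beta / 3 - 2 * wm), (beta / 3 - 2 * wp); split.
- lra.
- by rewrite /wp /wm; lra.
move=> t; rewrite /wcubic bE mE.
have -> : 4 * (t - (2 * (w0 - p) / 3 - 2 * wm)) * (t - (2 * (w0 - p) / 3 - 2 * wp)) *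
   (t - (2 * (w0 - p) / 3 - 2 * w0)) =
   4 * ((t - 2 * (w0 - p) / 3 - p) ^+ 2 - sq ^+ 2) * (t - (2 * (w0 - p) / 3 - 2 * w0)).
  by rewrite /wp /wm; field.
by rewrite sq2; field.
Qed.

(** [u] is [ln] of its exponential, so its derivative comes from that of W. *)
Lemma beta_energy (R : realType) (u : R -> R) (psi : Cplx R) (y W1 : R) :
  is_derive y 1 (fun t => expR (u t)) W1 ->
  derive1 u y = W1 / expR (u y) /\
  beta_at u psi y = (W1 ^+ 2 + 8 * expR (u y) ^+ 3 + 4 * modulus psi ^+ 2)
    * (expR (u y))^-1 ^+ 2 / 4.
Proof.
move=> d; have E0 : 0 < expR (u y) by exact: expR_gt0.
have du : is_derive y 1 u (W1 / expR (u y)).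
  have := @is_derive1_comp _ (@ln R) (fun t => expR (u t)) y _ _ (is_derive1_ln E0) d.
  rewrite (_ : @ln R \o _ = u); last by apply/funext => t /=; rewrite expRK.
  by rewrite mulrC.
have dE : derive1 u y = W1 / expR (u y) by rewrite derive1E; have [_ ->] := du.
split => //; rewrite /beta_at dE.
have -> : expR (- (2 * u y)) = (expR (u y))^-1 ^+ 2 by rewrite expRN expRM_natl exprVn.
by field; rewrite gt_eqF.
Qed.

Theorem mainTheorem6 (R : realType) (lo hi : \bar R)
    (hlo : (lo < 0)%E) (hhi : (0 < hi)%E)
    (f : Cplx R -> CP2 R) (u : R -> R) (psi : Cplx R) (beta : R)
    (hf : minimal_lagrangian_immersion (strip lo hi) f)
    (hequiv : translationally_equivariant (strip lo hi) f)
    (hmetric : induced_metric (strip lo hi) f u)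
    (hhopf : hopf_differential (strip lo hi) f psi)
    (hpsi : psi <> 0)
    (hu : exists y1 y2 : R,
        [/\ (lo < y1%:E < hi)%E, (lo < y2%:E < hi)%E & u y1 <> u y2])
    (hu0 : derive1 u 0 = 0)
    (hbeta : beta = beta_at u psi 0)
    (hroot : 8 * expR (u 0) ^+ 3 - 4 * beta * expR (u 0) ^+ 2
             + 4 * modulus psi ^+ 2 = 0)
    (hlargest : forall w : R,
        8 * w ^+ 3 - 4 * beta * w ^+ 2 + 4 * modulus psi ^+ 2 = 0 ->
        w <= expR (u 0)) :
  let g2 : R := 4 / 3 * beta ^+ 2 in
  let g3 : R := 16 * modulus psi ^+ 2 - 8 / 27 * beta ^+ 3 in
  [/\ forall y : R, (lo < y%:E < hi)%E -> beta_at u psi y = beta,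
      exists e1 e2 e3 : R,
        [/\ e3 < e2 /\ e2 < e1,
            forall t : R,
              wcubic g2 g3 t = 4 * (t - e1) * (t - e2) * (t - e3) &
            forall P : Cplx R -> Cplx R, weierstrass_p (toC g2) (toC g3) P ->
            forall y : R, (lo < y%:E < hi)%E ->
              toC (expR (u y))
              = toC (beta / 6) - P (toC y - omega' g2 g3 e3) / 2] &
      forall (FF : Cplx R -> Cplx R -> 'M[Cplx R]_3)
             (D : Cplx R -> 'M[Cplx R]_3) (alpha a b : Cplx R),
        extended_frame (strip lo hi) u psi FF ->
        generating_matrix (strip lo hi) FF D ->
        (forall lam : Cplx R, `|lam| = 1 -> D lam = gen_form alpha a b lam) ->
        psi = - 'i * a ^+ 2 * b].
Proof.
move=> g2 g3.
pose W y := expR (u y); pose W1 := derive1 W; pose m := modulus psi ^+ 2.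
have m0 : 0 < m by rewrite exprn_gt0 // mod_gt0 //; apply/eqP.
have I0 : (lo < (0 : R)%:E < hi)%E by rewrite hlo hhi.
have gauss (y : R) : (lo < y%:E < hi)%E -> is_derive y 1 W (W1 y) /\
    exists2 W2 : R, is_derive y 1 W1 W2 &
      W2 * W y = - 4 * W y ^+ 3 + W1 y ^+ 2 + 4 * m.
  (* The conclusion involves the height [y] only, so one point on each horizontal line is enough. *)
  move=> /andP[yl yh]; pose z0 : Cplx R := 'i * toC y.
  have z0y : complex.Im z0 = y by rewrite !compE mul0r mul1r add0r.
  have Sz0 : strip lo hi z0 by split; rewrite z0y.
  by have := minimal_lagrangian_gauss hf hmetric hhopf Sz0; rewrite z0y.
have dW (y : R) (yI : (lo < y%:E < hi)%E) := (gauss y yI).1.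
have dW1 (y : R) (yI : (lo < y%:E < hi)%E) := (gauss y yI).2.
have W0 y : 0 < W y by exact: expR_gt0.
have bE y : (lo < y%:E < hi)%E -> beta_at u psi y = energy W W1 m y.
  by move=> /dW /(beta_energy psi)[].
have betaE : beta = energy W W1 m 0 by rewrite hbeta bE.
have W10 : W1 0 = 0.
  have [d _] := beta_energy psi (dW 0 I0); move: d; rewrite hu0 => /esym/eqP.
  by rewrite mulf_eq0 invr_eq0 (gt_eqF (expR_gt0 _)) orbF => /eqP.
split.
- by move=> y yI; rewrite bE // betaE (energy_constant hlo hhi W0 dW dW1 yI).
- have [b3|[e1 [e2 [e32 e21 Hc]]]] := hopf_cubic_roots (W0 0) m0 hroot hlargest.
    (* In the case of a double root the profile starts at rest at an equilibrium and would be
       constant, against [hu]. *)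
    exfalso; have [y1 [y2 [I1 I2]]] := hu; apply; apply: expR_inj.
    have K := double_root_constant hlo hhi W0 dW dW1 (etrans (esym betaE) b3) erefl W10.
    by have := K y1 I1; have := K y2 I2; rewrite /W => -> ->.
  exists e1, e2, (beta / 3 - 2 * W 0); split=> // P HP y yI.
  have Hq (t : R) : (lo < t%:E < hi)%E ->
     is_derive t 1 (fun t => beta / 3 - 2 * W t) (- 2 * W1 t) /\
     is_derive t 1 (fun t => - 2 * W1 t) (6 * (beta / 3 - 2 * W t) ^+ 2 - g2 / 2).
    rewrite betaE; apply: (profile_wp_equation hlo hhi W0 dW dW1).
    by rewrite /g2 betaE.
  have q10 : - 2 * W1 0 = 0 by rewrite W10 mulr0.
  rewrite (weierstrass_solution hlo hhi Hc e32 e21 HP Hq erefl q10 yI).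
  have -> : toC (beta / 3 - 2 * W y) / 2 = toC ((beta / 3 - 2 * W y) / 2).
    by rewrite [RHS]toCM toCV (toC_nat R 2).
  by rewrite -toCB; congr toC; rewrite /W; field.
- move=> FF D alpha a b HFF HD Hform.
  by apply: (generating_matrix_hopf _ HFF HD Hform); rewrite /strip /=.
Qed.
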